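(* Fix $t>0$. For every nonnegative measurable function $F$ on $C([0,t];\mathbb{R})$, one has $$\mathbb{E}[F(B)]=\mathbb{E}\left[\int_{\mathbb{R}}\frac{d\xi}{2K_0\bigl(1/Z_t(\phi)\bigr)}\,F\bigl(\mathbb{T}_{\phi_t-\xi}(\phi)\bigr)\exp\left\{-\frac{\cosh\xi}{Z_t(\phi)}\right\}\bigg|_{\phi=B}\right],$$ where $K_0$ is the modified Bessel function of the third kind (the Macdonald function) of order $0$.
   Context: $B=\{B_s\}_{s\ge 0}$ is a one-dimensional standard Brownian motion (started at $0$); inside functionals of paths on $[0,t]$, $B$ stands for its restriction $\{B_s\}_{0\le s\le t}$. For a continuous real-valued path $\phi$ set $$A_s(\phi):=\int_0^s e^{2\phi_u}\,du,\qquad Z_s(\phi):=e^{-\phi_s}A_s(\phi).$$ For $z\in\mathbb{R}$, the path transformation $\mathbb{T}_z$ on $C([0,t];\mathbb{R})$ is defined by $$\mathbb{T}_z(\phi)(s):=\phi_s-\log\left\{1+\frac{A_s(\phi)}{A_t(\phi)}\left(e^z-1\right)\right\},\quad 0\le s\le t,\ \phi\in C([0,t];\mathbb{R}).$$ $C([0,t];\mathbb{R})$ is the space of continuous real-valued functions on $[0,t]$ with the topology of uniform convergence; ''measurable'' means Borel-measurable. *)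

(* Defs.v *)
From HB Require Import structures.
From mathcomp Require Import all_boot all_order all_algebra.
From mathcomp Require Import all_classical all_reals all_analysis.
From mathcomp Require Import measurable_realfun.

Set Implicit Arguments.
Unset Strict Implicit.
Unset Printing Implicit Defensive.

Import Order.TTheory GRing.Theory Num.Theory.
Import numFieldNormedType.Exports.

Local Open Scope classical_set_scope.
Local Open Scope ring_scope.

Section MacdonaldFunction.
Variable R : realType.

Definition cosh (x : R) : R := (expR x + expR (- x)) / 2.

(* Macdonald function of order nu at 0 < x (DLMF 10.32.9); the integral
   diverges for x <= 0, where the value is meaningless. *)
Definition besselK (nu x : R) : R :=
  \int[@lebesgue_measure R]_(u in `[0, +oo[)
    (expR (- (x * cosh u)) * cosh (nu * u)).

End MacdonaldFunction.

Section ExponentialFunctionals.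
Variable R : realType.
Implicit Types (phi : R -> R) (s t z : R).

Definition expA phi s : R :=
  \int[@lebesgue_measure R]_(u in `[0, s]) expR (2 * phi u).

Definition expZ phi s : R := expR (- phi s) * expA phi s.

Definition transform t z phi s : R :=
  phi s - ln (1 + expA phi s / expA phi t * (expR z - 1)).

Lemma transform_continuous t z phi : {within `[0, t], continuous phi} ->
  {within `[0, t], continuous (transform t z phi)}.
Proof.
move=> cphi.
have [t0|t0] := leP 0 t; last first.
  rewrite set_itv_ge ?bnd_simp -?ltNge//.
  exact: continuous_subspace0.
have cexp : {within `[0, t], continuous (fun u => expR (2 * phi u))}.
  apply: (@within_continuous_comp _ _ _ _ phi (fun y => expR (2 * y))) => //.
  move=> y _; apply: continuous_cvg; first exact: continuous_expR.
  exact: mulrl_continuous.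
have iexp : (@lebesgue_measure R).-integrable `[0, t]
    (EFin \o (fun u => expR (2 * phi u))).
  by apply: continuous_compact_integrable => //; exact: segment_compact.
have cA := parameterized_integral_continuous t0 iexp.
have A_ge0 s : 0 <= expA phi s.
  by apply: Rintegral_ge0 => x _; exact: expR_ge0.
have A_le s : s <= t -> expA phi s <= expA phi t.
  move=> st; have sub : `[0, s] `<=` `[0, t].
    by apply: subset_itvl; rewrite bnd_simp.
  rewrite /expA fine_le//.
  - apply: integrable_fin_num => //; exact: integrableS iexp.
  - exact: integrable_fin_num.
  - by apply: ge0_subset_integral => //; case/integrableP: iexp.
have pos s : s <= t -> 0 < 1 + expA phi s / expA phi t * (expR z - 1).
  move=> st; set q := expA phi s / expA phi t.
  have q0 : 0 <= q by rewrite divr_ge0.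
  have q1 : q <= 1.
    have [A0|A0] := eqVneq (expA phi t) 0; first by rewrite /q A0 invr0 mulr0.
    by rewrite ler_pdivrMr ?mul1r ?A_le// lt_def A0 A_ge0.
  have -> : 1 + q * (expR z - 1) = (1 - q) + q * expR z.
    by rewrite mulrBr mulr1 addrCA addrC.
  have [->|qn0] := eqVneq q 0; first by rewrite subr0 mul0r addr0.
  by rewrite ltr_wpDl ?subr_ge0// mulr_gt0 ?expR_gt0// lt_def qn0.
have caff (a b : R) : continuous (fun y : R => 1 + y / a * b).
  move=> y; apply: cvgD; first exact: cvg_cst.
  by apply: cvgMl; apply: cvgMl; exact: cvg_id.
have cln : {within `[0, t], continuous
    (fun s => ln (1 + expA phi s / expA phi t * (expR z - 1)))}.
  apply: (@within_continuous_comp _ _ _ _ (expA phi)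
    (fun y => ln (1 + y / expA phi t * (expR z - 1)))) => //.
  move=> _ /set_mem [s /= + <-]; rewrite in_itv/= => /andP[_ st].
  apply: continuous_cvg; last exact: caff.
  exact/continuous_ln/pos.
by move=> s; apply: (@cvgB _ (subspace `[0, t])); [exact: cphi|exact: cln].
Qed.

End ExponentialFunctionals.

Section PathSpace.
Variables (R : realType) (t : R).

Definition cpath : Type := continuousType (set_type `[0, t]) R.

HB.instance Definition _ := PseudoMetric.copy cpath
  (initial_topology (fun phi : cpath =>
    (phi : set_type `[0, t] -> R) : arrow_uniform_type (set_type `[0, t]) R)).

Definition cpath0 : cpath := cst 0.

HB.instance Definition _ := isPointed.Build cpath cpath0.

Definition borel_cpath : Type := g_sigma_algebraType (@open cpath).

HB.instance Definition _ := Measurable.on borel_cpath.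

(* The value 0 outside `[0, t] is never used. *)
Definition extend (phi : cpath) : R -> R := valL_ 0 phi.

Lemma extend_continuous phi : {within `[0, t], continuous (extend phi)}.
Proof. apply/subspace_valL_continuousP'; exact: cts_fun. Qed.

Definition restr (f : R -> R) (cf : {within `[0, t], continuous f}) : cpath :=
  mkcts ((subspace_sigL_continuousP _ _).1 cf).

Definition path_transform (z : R) (phi : cpath) : cpath :=
  restr (@transform_continuous R t z _ (@extend_continuous phi)).

End PathSpace.

Section BrownianMotion.
Context (d : measure_display) (Omega : measurableType d) (R : realType).
Variable P : probability Omega R.

Definition independent_RVs n (X : 'I_n -> Omega -> R) : Prop :=
  forall A : 'I_n -> set R, (forall i, measurable (A i)) ->
  P (\bigcap_i (X i @^-1` A i)) = (\prod_(i < n) P (X i @^-1` A i))%E.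

Record standard_brownian_motion (B : R -> Omega -> R) : Prop := {
  bm_measurable : forall s, 0 <= s -> measurable_fun setT (B s) ;
  bm_start : {ae P, forall w, B 0 w = 0} ;
  bm_independent_increments : forall n (s : nat -> R),
    0 <= s 0%N -> {homo s : i j / (i <= j)%N >-> i <= j} ->
    independent_RVs (fun (i : 'I_n) w => B (s i.+1) w - B (s i) w) ;
  (* the second parameter of normal_prob is the standard deviation *)
  bm_gaussian_increments : forall s u, 0 <= s -> s < u ->
    forall A, measurable A ->
    P ((fun w => B u w - B s w) @^-1` A) = normal_prob 0 (Num.sqrt (u - s)) A ;
  bm_continuous : forall w, {within `[0, +oo[, continuous (B ^~ w)}
}.

Lemma bm_continuous_itv B (hB : standard_brownian_motion B) t w :
  {within `[0, t], continuous (B ^~ w)}.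
Proof.
have := @bm_continuous _ hB w; apply: continuous_subspaceW.
by apply: subset_itvl; rewrite bnd_simp.
Qed.

Definition bm_path B (hB : standard_brownian_motion B) (t : R) (w : Omega) :
  cpath t := restr (@bm_continuous_itv _ hB t w).

End BrownianMotion.

(* Main.v *)
Require Import Defs.
From HB Require Import structures.
From mathcomp Require Import all_boot all_order all_algebra.
From mathcomp Require Import all_classical all_reals all_analysis.
From mathcomp Require Import measurable_realfun.
From mathcomp Require Import ring lra.

(** The proof rests on a quasi-invariance property of Brownian motion.  Write
    A_s for the exponential functional of a path phi and, for c > 0, let S_c
    be the map phi |-> phi - ln (1 + c A), which is the transformation T_z with
    z = ln (1 + c A_t).  Then, for every nonnegative Borel function F,

      E [F (S_c B)] = E [F (B) D_c (B); c A_t < 1],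
      D_c (phi) = exp (- c / 2 (exp (2 phi_t) / (1 - c A_t) - 1)) / (1 - c A_t)

    ([pushed_law]).  Integrate this identity over c > 0.  On the left the
    substitution c = (exp z - 1) / A_t turns S_c into T_z; on the right
    c = (1 - exp (- z)) / A_t absorbs the factor 1 / (1 - c A_t).  The result is

      E [int G (z, T_z B) dz] = E [int G (z, B) L_z (B) dz],
      L_z (phi) = exp ((cosh phi_t - cosh (phi_t + z)) / Z_t),

    with z ranging over ]0, +oo[ ([half_line_law]).  Since T_z has inverse
    T_(- z), keeps Z_t and changes phi_t into phi_t - z, the same identity
    holds for z < 0, hence over the whole line ([transform_law]).  The theorem
    is the case G (z, phi) = F (phi) exp (- cosh phi_t / Z_t) / (2 K_0 (1 / Z_t)):
    on the right the integral over z is F (phi), because the integral of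
    exp (- y cosh u) over the line is 2 K_0 (y) ([integral_exp_coshE]), and on
    the left the substitution xi = phi_t - z gives the formula of the statement.

    Quasi-invariance itself is proved by discretization.  On a grid of mesh h,
    replace A by sums of h exp (b_i + b_(i+1)), where b is the path at the grid
    points.  With this choice one step of the discrete transformation is affine
    in the variable exp (- b), so the change of variables for the Gaussian walk
    is exact at each mesh, and its inverse is the transformation with - c
    ([discrete_identity]).  The density is a product over the steps; the exact
    formula [cosh_increment] makes it telescope up to an error controlled by the
    sum of the cubes of the increments ([weight_cvg]), and that sum vanishes
    almost surely along meshes t / 4^k ([cubic_variation_cvg0]).  The densities
    are not known to be uniformly integrable, so the limit is taken in two
    halves: Fatou's lemma with - c gives one inequality, and with c, after
    cutting the density off, the other ([shifted_cylinder_identity]).  Finally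
    the path-space Borel sets are generated by the evaluations, so cylinder
    functions determine a finite measure ([cpath_measure_unique]). *)

Import Order.TTheory GRing.Theory Num.Theory.
Import numFieldNormedType.Exports.

Local Open Scope classical_set_scope.
Local Open Scope ring_scope.

Set Implicit Arguments.
Unset Strict Implicit.
Unset Printing Implicit Defensive.

(** * Measurability of elementary expressions *)

Section Measurability.
Context d (T : measurableType d) (R : realType).
Implicit Types f g : T -> R.

(** Inversion is discontinuous at 0, so measurability is obtained on each
    half-line, from x^-1 = exp (- ln x) and its mirror image. *)
Lemma measurable_funV f : measurable_fun [set: T] f ->
  measurable_fun [set: T] (fun x => (f x)^-1).
Proof.
move=> mf; apply: (measurableT_comp _ mf).
rewrite (_ : @GRing.inv R = fun y => if 0 < y then expR (- ln y) else
    if y < 0 then - expR (- ln (- y)) else 0); last first.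
  apply/funext => y; case: ltgtP => [y0|y0|<-]; last by rewrite invr0.
    by rewrite expRN lnK.
  by rewrite expRN lnK ?posrE ?oppr_gt0// invrN opprK.
apply: measurable_fun_ifT.
- exact: measurable_fun_ltr.
- apply: measurableT_comp => //; apply: measurableT_comp => //.
- apply: measurable_fun_ifT.
  + exact: measurable_fun_ltr.
  + apply: measurableT_comp => //; apply: measurableT_comp => //.
    by apply: measurableT_comp => //; apply: measurableT_comp.
  + exact: measurable_cst.
Qed.

Lemma measurable_bool2R (b : T -> bool) : measurable_fun [set: T] b ->
  measurable_fun [set: T] (fun x => (b x)%:R : R).
Proof.
move=> mb.
rewrite (_ : (fun x => _) = (fun x => if b x then 1%R else 0%R)); last first.
  by apply/funext => x; case: (b x).
exact: measurable_fun_ifT.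
Qed.

Lemma measurable_fun_expR f : measurable_fun [set: T] f ->
  measurable_fun [set: T] (fun x => expR (f x)).
Proof. exact: measurableT_comp. Qed.

Lemma measurable_fun_ln f : measurable_fun [set: T] f ->
  measurable_fun [set: T] (fun x => ln (f x)).
Proof. exact: measurableT_comp. Qed.

Lemma measurable_fun_opp f : measurable_fun [set: T] f ->
  measurable_fun [set: T] (fun x => - f x).
Proof. exact: measurableT_comp. Qed.

Lemma measurable_fun_EFin f : measurable_fun [set: T] f ->
  measurable_fun [set: T] (fun x => (f x)%:E).
Proof. exact: measurableT_comp. Qed.

Lemma measurable_fun_muln f n : measurable_fun [set: T] f ->
  measurable_fun [set: T] (fun x => f x *+ n).
Proof.
move=> mf; under eq_fun do rewrite -mulr_natr.
exact: measurable_funM.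
Qed.

Lemma measurable_fun_fst d1 d2 (T1 : measurableType d1) (T2 : measurableType d2)
  (f : T -> T1 * T2) : measurable_fun [set: T] f ->
  measurable_fun [set: T] (fun x => (f x).1).
Proof. by move=> mf; apply: (measurableT_comp measurable_fst). Qed.

Lemma measurable_fun_snd d1 d2 (T1 : measurableType d1) (T2 : measurableType d2)
  (f : T -> T1 * T2) : measurable_fun [set: T] f ->
  measurable_fun [set: T] (fun x => (f x).2).
Proof. by move=> mf; apply: (measurableT_comp measurable_snd). Qed.

End Measurability.

(** Hypotheses are tried before the syntactic rules, so that compositions
    outside the scope of the rules can be supplied as assumptions; what cannot
    be decomposed is left as a goal. *)
Ltac meas_step :=
  lazymatch goal with
  | |- measurable_fun _ (fun x => x) => exact: measurable_id
  | |- measurable_fun _ (fun x => @EFin _ (@?f x)) => apply: measurable_fun_EFin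
  | |- measurable_fun _ (fun x => @mule _ (@?f x) (@?g x)) =>
      apply: emeasurable_funM
  | |- measurable_fun _ (fun x => @GRing.add _ (@?f x) (@GRing.opp _ (@?g x))) =>
      apply: measurable_funB
  | |- measurable_fun _ (fun x => @GRing.add _ (@?f x) (@?g x)) =>
      apply: measurable_funD
  | |- measurable_fun _ (fun x => @GRing.mul _ (@?f x) (@?g x)) =>
      apply: measurable_funM
  | |- measurable_fun _ (fun x => @GRing.opp _ (@?f x)) =>
      apply: measurable_fun_opp
  | |- measurable_fun _ (fun x => @GRing.inv _ (@?f x)) =>
      apply: measurable_funV
  | |- measurable_fun _ (fun x => @GRing.exp _ (@?f x) _) =>
      apply: measurable_funX
  | |- measurable_fun _ (fun x => expR (@?f x)) => apply: measurable_fun_expR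
  | |- measurable_fun _ (fun x => ln (@?f x)) => apply: measurable_fun_ln
  | |- measurable_fun _ (fun x => @GRing.natmul _ _ (nat_of_bool (@?f x))) =>
      apply: measurable_bool2R
  | |- measurable_fun _ (fun x => @GRing.natmul _ (@?f x) _) =>
      apply: measurable_fun_muln
  | |- measurable_fun _ (fun x => (@Order.lt _ _ (@?f x) (@?g x))) =>
      apply: measurable_fun_ltr
  | |- measurable_fun _ (fun x => (@?f x, @?g x)) => apply: measurable_fun_pair
  | |- measurable_fun _ (fun x => fst (@?f x)) => apply: measurable_fun_fst
  | |- measurable_fun _ (fun x => snd (@?f x)) => apply: measurable_fun_snd
  | |- measurable_fun _ expR => exact: measurable_expR
  | |- measurable_fun _ (@ln _) => exact: measurable_ln
  | |- measurable_fun _ (@GRing.inv _) =>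
      apply: (measurable_funV (@measurable_id _ _ _))
  | |- measurable_fun _ (@GRing.add _ ?a) =>
      apply: (@measurable_funD _ _ _ _ (cst a) id)
  | |- measurable_fun _ (@Order.lt _ _ ?a) =>
      apply: (@measurable_fun_ltr _ _ _ _ (cst a) id)
  | |- _ => first [exact: measurable_cst | exact: measurable_fst
                  | exact: measurable_snd | by []]
  end.
Ltac meas := repeat (first [assumption | meas_step]).

(** * Densities, image measures and changes of variable on the line *)

Section MeasureWithDensity.
Local Open Scope ereal_scope.
Context d (T : measurableType d) (R : realType).
Variables (mu : {measure set T -> \bar R}) (f : T -> R).
Hypotheses (f0 : forall x, (0 <= f x)%R) (mf : measurable_fun [set: T] f).

(** The two proofs are arguments of the definition so that the measure
    structure can be inferred from the term. *)
Definition mdens of (forall x, (0 <= f x)%R) & measurable_fun [set: T] f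
  : set T -> \bar R := fun A => \int[mu]_(x in A) (f x)%:E.

Local Notation nu := (mdens f0 mf).

Let nu0 : nu set0 = 0. Proof. exact: integral_set0. Qed.

Let nu_ge0 A : 0 <= nu A.
Proof. by apply: integral_ge0 => x _; rewrite lee_fin. Qed.

Let nu_sigma_additive : semi_sigma_additive nu.
Proof.
move=> /= A mA tA mUA.
rewrite /mdens ge0_integral_bigcup//; last 2 first.
- by apply: measurable_funTS; exact/measurable_EFinP.
- by move=> x _; rewrite lee_fin.
by apply: is_cvg_ereal_nneg_natsum_cond => n _ _; exact: nu_ge0.
Qed.

HB.instance Definition _ :=
  isMeasure.Build _ _ _ nu nu0 nu_ge0 nu_sigma_additive.

Import HBNNSimple.

Let integral_mdens_indic (E : set T) : measurable E ->
  \int[nu]_x (\1_E x)%:E = \int[mu]_x ((\1_E x)%:E * (f x)%:E).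
Proof.
move=> mE; rewrite integral_indic// setIT.
transitivity (\int[mu]_(x in E) (f x)%:E) => //; rewrite [LHS]integral_mkcond.
apply: eq_integral => x _; rewrite patchE indicE.
by case: ifPn; rewrite ?mul1e ?mul0e.
Qed.

(** True for indicators by definition, hence for simple functions by
    linearity and for nonnegative functions by monotone convergence. *)
Lemma integral_mdens (g : T -> \bar R) : (forall x, 0 <= g x) ->
  measurable_fun [set: T] g -> \int[nu]_x g x = \int[mu]_x (g x * (f x)%:E).
Proof.
move=> g0 mg; have mfE : measurable_fun [set: T] (EFin \o f) by exact/measurable_EFinP.
pose g_ := nnsfun_approx measurableT mg.
have ndg n m x : (n <= m)%N -> (g_ n x <= g_ m x)%R.
  by move=> nm; exact/lefP/nd_nnsfun_approx.
have cg x : (g_ n x)%:E @[n --> \oo] --> g x.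
  by apply: cvg_nnsfun_approx => // *; exact: g0.
have H n : \int[nu]_x (g_ n x)%:E = \int[mu]_x ((g_ n x)%:E * (f x)%:E).
  under [LHS]eq_integral do rewrite fimfunE -fsumEFin//.
  rewrite ge0_integral_fsum//; last 2 first.
  - by move=> r; exact/measurable_EFinP/measurable_funM.
  - by move=> y x _; rewrite nnfun_muleindic_ge0.
  transitivity (\sum_(r \in range (g_ n))
      \int[mu]_x (r%:E * (\1_(g_ n @^-1` [set r]) x)%:E * (f x)%:E)).
    apply: eq_fsbigr => r /[!inE] -[z _ <-].
    under [LHS]eq_integral do rewrite EFinM.
    under [RHS]eq_integral do rewrite -muleA.
    rewrite !ge0_integralZl_EFin//.
    - by rewrite integral_mdens_indic.
    - by move=> x _; rewrite mule_ge0// lee_fin.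
    - by apply: emeasurable_funM => //; exact/measurable_EFinP.
    - exact/measurable_EFinP.
  rewrite -ge0_integral_fsum//.
  - apply: eq_integral => x _; rewrite fimfunE -fsumEFin// ge0_mule_fsuml//.
    by move=> r; rewrite nnfun_muleindic_ge0.
  - move=> r; apply: emeasurable_funM => //.
    by apply: emeasurable_funM => //; exact/measurable_EFinP.
  - by move=> r x _; rewrite mule_ge0 ?nnfun_muleindic_ge0 ?lee_fin.
transitivity (limn (fun n => \int[nu]_x (g_ n x)%:E)).
  rewrite -monotone_convergence//.
  - by apply: eq_integral => x _; apply/esym/cvg_lim => //; exact: cg.
  - by move=> n; exact/measurable_EFinP.
  - by move=> n x _; rewrite lee_fin.
  - by move=> x _ n m nm; rewrite lee_fin ndg.
under eq_fun do rewrite H.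
rewrite -monotone_convergence//.
- apply: eq_integral => x _; apply/cvg_lim => //.
  exact: cvgeZr.
- by move=> n; apply: emeasurable_funM => //; exact/measurable_EFinP.
- by move=> n x _; rewrite mule_ge0// lee_fin.
- by move=> x _ n m nm; rewrite lee_wpmul2r ?lee_fin ?ndg.
Qed.

End MeasureWithDensity.

Section ImageMeasure.
Local Open Scope ereal_scope.
Context d d' (T : measurableType d) (T' : measurableType d') (R : realType).
Variables (f : T -> T') (mf : measurable_fun [set: T] f).
Variable mu : {measure set T -> \bar R}.

(** A pushforward that carries the measurability of the map, so that its
    measure structure can be inferred. *)
Definition image_measure of measurable_fun [set: T] f : set T' -> \bar R :=
  pushforward mu f.

Local Notation nu := (image_measure mf).

Let mpre A : measurable A -> measurable (f @^-1` A).
Proof. by move=> mA; rewrite -[X in measurable X]setTI; exact: mf. Qed.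

Let nu0 : nu set0 = 0.
Proof. by rewrite /image_measure /pushforward preimage_set0 measure0. Qed.

Let nu_ge0 A : 0 <= nu A. Proof. exact: measure_ge0. Qed.

Let nu_sigma_additive : semi_sigma_additive nu.
Proof.
move=> A mA tA mUA; rewrite /image_measure /pushforward preimage_bigcup.
apply: measure_semi_sigma_additive => [n||].
- exact: mpre.
- apply/trivIsetP => i j _ _ ij; rewrite -preimage_setI.
  by move/trivIsetP : tA => /(_ _ _ I I ij) ->; rewrite preimage_set0.
- by rewrite -preimage_bigcup; exact: mpre.
Qed.

HB.instance Definition _ :=
  isMeasure.Build _ _ _ nu nu0 nu_ge0 nu_sigma_additive.

Lemma integral_image_measure (g : T' -> \bar R) : (forall x, 0 <= g x) ->
  measurable_fun [set: T'] g -> \int[nu]_x g x = \int[mu]_x g (f x).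
Proof. by move=> g0 mg; rewrite (ge0_integral_pushforward mf mu). Qed.

End ImageMeasure.
Arguments image_measure {d d' T T' R f} mu mf.

Section ChangeOfVariable.
Local Open Scope ereal_scope.
Context {R : realType}.
Local Notation mu := (@lebesgue_measure R).
Implicit Types f : R -> \bar R.

(** The Lebesgue measure is the only measure giving half-open intervals their
    length, and r times its image by the affine map has this property. *)
Lemma ge0_integral_affine (r c : R) f : (0 < r)%R ->
  (forall x, 0 <= f x) -> measurable_fun [set: R] f ->
  \int[mu]_y f y = r%:E * \int[mu]_x f (r * x + c)%R.
Proof.
move=> r0 f0 mf.
pose a := (fun x : R => r * x + c)%R.
have ma : measurable_fun [set: measurableTypeR R] (a : _ -> measurableTypeR R).
  by apply: measurable_funD => //; exact: measurable_funM.
have rN0 : (r != 0)%R by rewrite gt_eqF.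
pose m := mscale (NngNum (ltW r0)) (image_measure mu ma).
rewrite (eq_measure_integral m); last first.
  move=> A mA _; apply: lebesgue_measure_unique => // _ [[p q] _ <-].
  transitivity (r%:E * mu (a @^-1` `]p, q])) => //.
  have -> : a @^-1` `]p, q] = `]((p - c) / r)%R, ((q - c) / r)%R]%classic.
    apply/seteqP; split => x /=; rewrite !in_itv/= ltr_pdivrMr// ler_pdivlMr//;
    by rewrite ltrBlDr lerBrDr [(x * r)%R]mulrC.
  rewrite !lebesgue_measure_itv/= !lte_fin ltr_pM2r ?invr_gt0// ltrD2r.
  case: ifPn => _; last by rewrite mule0.
  rewrite -!EFinD -EFinM; congr EFin; field.
  exact: rN0.
rewrite ge0_integral_mscale//; congr (_ * _).
exact: integral_image_measure.
Qed.

(** The image of the Lebesgue measure of the half-line by ln and the measure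
    of density exp give the same mass exp q - exp p to each interval ]p, q]. *)
Lemma ge0_integral_expR f :
  (forall x, 0 <= f x) -> measurable_fun [set: R] f ->
  \int[mu]_(y in `]0%R, +oo[) f y = \int[mu]_u (f (expR u) * (expR u)%:E).
Proof.
move=> f0 mf.
have mf' : measurable_fun [set: measurableTypeR R] f by [].
have me : measurable_fun [set: measurableTypeR R] (expR : R -> R) by [].
pose m1 := mdens mu (@expR_ge0 R) me.
have i0 (x : R) : (0 <= (\1_`]0, +oo[ x : R))%R by [].
have mi : measurable_fun [set: measurableTypeR R] (\1_`]0%R, +oo[ : R -> R).
  exact: measurable_indic.
have ml : measurable_fun [set: measurableTypeR R] (@ln R : _ -> measurableTypeR R).
  exact: measurable_ln.
pose m2 := image_measure (mdens mu i0 mi) ml.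
transitivity (\int[m2]_u f (expR u)).
  rewrite integral_image_measure//; last exact: measurableT_comp.
  rewrite integral_mdens//; last first.
    by apply: (measurableT_comp mf'); exact: measurableT_comp.
  rewrite [LHS]integral_mkcond; apply: eq_integral => x _.
  rewrite patchE indicE/=; case: ifPn; rewrite ?mule1 ?mule0//.
  by rewrite inE/= in_itv/= andbT => x0; rewrite lnK.
rewrite -(integral_mdens mu (@expR_ge0 R) me)//; last exact: measurableT_comp.
apply: eq_measure_integral => A mA _; apply/esym.
have m1E p q : (p < q)%R -> m1 `]p, q]%classic = (expR q - expR p)%:E.
  move=> pq; rewrite /m1 /mdens integral_itv_obnd_cbnd; last first.
    by apply: measurable_funTS; exact/measurable_EFinP.
  rewrite (continuous_FTC2 pq (F := expR)) ?EFinB//.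
  - by apply: continuous_subspaceT => x; exact: continuous_expR.
  - split; first by [].
    + by apply: cvg_at_right_filter; exact: continuous_expR.
    + by apply: cvg_at_left_filter; exact: continuous_expR.
  - by move=> x _; rewrite derive1E derive_val.
have m2E p q : (p < q)%R -> m2 `]p, q]%classic = (expR q - expR p)%:E.
  move=> pq; rewrite /m2 /image_measure /pushforward /= /mdens integral_indic//; last first.
    by rewrite -[X in measurable X]setTI; apply: (@measurable_ln R).
  rewrite (_ : _ `&` _ = `]expR p, expR q]%classic).
    have := lebesgue_measure_itv `]expR p, expR q].
    by rewrite /= lte_fin ltr_expR pq EFinB.
  apply/seteqP; split => x /=; rewrite !in_itv/= andbT.
    move=> [x0 /andP[px xq]].
    by rewrite -[x]lnK// ltr_expR ler_expR px.
  move=> /andP[px xq]; have x0 : (0 < x)%R by rewrite (lt_trans _ px)// expR_gt0.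
  by split => //; rewrite -[p]expRK -[q]expRK ltr_ln ?posrE ?expR_gt0// px ler_ln ?posrE ?expR_gt0.
apply: (@measure_unique _ R (measurableTypeR R) (@ocitv R)
  (fun n : nat => `](- n%:R)%R, n%:R%R]%classic)) => //.
- exact: ocitvI.
- by move=> i; exists (- i%:R, i%:R)%R.
- exact: bigcup_itvT.
- move=> _ [[p q] _ <-] /=; have [pq|qp] := ltP p q.
    by transitivity (expR q - expR p)%:E; [exact: m1E|exact/esym/m2E].
  by rewrite set_itv_ge ?bnd_simp -?leNgt// !measure0.
- move=> [|k] /=; first by rewrite oppr0 set_itv_ge ?bnd_simp -?leNgt// measure0.
  apply: (eq_ind_r (fun z => z < +oo) (ltry _) (@m1E _ _ _)).
  by rewrite (@lt_trans _ _ 0%R)// oppr_lt0.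
Qed.

End ChangeOfVariable.

(** * Integration against the past of an independent sequence *)

Section IndependentSequence.
Context d (Omega : measurableType d) (R : realType) (P : probability Omega R).
Variable X : nat -> Omega -> R.
Hypothesis mX : forall i, measurable_fun [set: Omega] (X i).
Hypothesis indX : forall n, independent_RVs P (fun i : 'I_n => X i).

(** A pi-system generating the sigma-algebra of X_0, ..., X_(m-1). *)
Definition past_rect m : set (set Omega) :=
  [set A | exists2 C : nat -> set R, (forall i, measurable (C i)) &
     A = \bigcap_(i < m) (X i @^-1` C i)].

(** The same carrier with the coarser sigma-algebra: measurability on
    [past m] expresses that a quantity depends on the first m variables only. *)
Definition past m : Type := g_sigma_algebraType (past_rect m).
HB.instance Definition _ m := Measurable.on (past m).

Lemma past_rectI m : setI_closed (past_rect m).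
Proof.
move=> A1 A2 [C1 mC1 ->] [C2 mC2 ->].
exists (fun i => C1 i `&` C2 i); first by move=> i; exact: measurableI.
by rewrite -bigcapI; apply: eq_bigcapr => i _; rewrite preimage_setI.
Qed.

Lemma past_rectT m : past_rect m setT.
Proof.
exists (fun=> setT) => //; apply/esym; rewrite -subTset => w _ i _ /=.
by [].
Qed.

Lemma past_rect_measurable m : past_rect m `<=` @measurable _ Omega.
Proof.
move=> A [C mC ->]; apply: bigcap_measurableType => //.
by move=> i _; rewrite -[X in measurable X]setTI; exact: mX.
Qed.

Lemma past_measurable m (A : set Omega) :
  @measurable _ (past m) A -> @measurable _ Omega A.
Proof.
by apply: smallest_sub; [exact: sigma_algebra_measurable|exact: past_rect_measurable].
Qed.

Lemma measurable_past m i : (i < m)%N ->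
  measurable_fun [set: past m] (X i : past m -> R).
Proof.
move=> im _ C mC; rewrite setTI; apply: sub_sigma_algebra.
exists (fun j => if j == i then C else setT).
  by move=> j; case: ifP.
apply/seteqP; split => w /=.
  by move=> XC j /= jm; case: eqP => // ->.
by move=> /(_ i im); rewrite /= eqxx.
Qed.

Lemma past_indep_rect m (A : set Omega) (D : set R) :
  past_rect m A -> measurable D ->
  P (A `&` X m @^-1` D) = (P A * P (X m @^-1` D))%E.
Proof.
move=> [C mC ->] mD.
have key (D' : set R) : measurable D' ->
    P ((\bigcap_(i < m) (X i @^-1` C i)) `&` X m @^-1` D') =
    ((\prod_(i < m) P (X i @^-1` C i)) * P (X m @^-1` D'))%E.
  move=> mD'.
  have := @indX m.+1 (fun i : 'I_m.+1 => if (i < m)%N then C i else D').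
  move=> /(_ _)/wrap[]; first by move=> i; case: ifP.
  rewrite big_ord_recr /= ltnn; under eq_bigr do rewrite ltn_ord.
  move=> <-; congr (P _); apply/seteqP; split => w /=.
    move=> [wC wD] i _ /=; case: ifP => im; first exact: wC.
    by have -> : (i : nat) = m by apply/eqP; rewrite eqn_leq -ltnS ltn_ord leqNgt im.
  move=> H; split=> [i /= im|].
    by have := H (widen_ord (leqnSn m) (Ordinal im)) I; rewrite /= im.
  by have := H ord_max I; rewrite /= ltnn.
rewrite key//; congr (_ * _)%E.
by have := key setT measurableT; rewrite preimage_setT setIT probability_setT mule1.
Qed.

(** Both sides are finite measures in A that agree on the rectangles. *)
Lemma past_indep m (A : set Omega) (D : set R) :
  @measurable _ (past m) A -> measurable D ->
  P (A `&` X m @^-1` D) = (P A * P (X m @^-1` D))%E.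
Proof.
move=> mA mD.
have mXD : measurable (X m @^-1` D) by rewrite -[X in measurable X]setTI; exact: mX.
have PD : P (X m @^-1` D) \is a fin_num by exact: fin_num_measure.
pose p := fine (P (X m @^-1` D)).
have p0 : 0 <= p by exact: fine_ge0.
pose m1 := mrestr P mXD.
pose m2 := mscale (NngNum p0) P.
have m2E E : m2 E = (P E * P (X m @^-1` D))%E.
  by rewrite /m2 /mscale /= /p fineK// muleC.
suff : m1 A = m2 A by rewrite m2E.
apply: (@g_sigma_algebra_measure_unique _ R Omega (past_rect m) _ (fun=> setT)) => //.
- exact: past_rect_measurable.
- by move=> _; exact: past_rectT.
- by rewrite bigcup_const//; exists 0%N.
- exact: past_rectI.
- by move=> E GE; transitivity (m2 E) => //; rewrite m2E; exact: past_indep_rect.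
- move=> _; rewrite ltey_eq; apply/orP; left.
  by rewrite /= /mrestr setTI.
Qed.

Local Open Scope ereal_scope.

(** As Y depends on the past of [X m], the pair (Y, X m) has a product law,
    and Fubini's theorem integrates [X m] out. *)
Lemma past_integral m d' (T' : measurableType d') (Y : Omega -> T')
    (Psi : T' * R -> \bar R) :
  measurable_fun [set: past m] (Y : past m -> T') ->
  measurable_fun [set: T' * R] Psi -> (forall x, 0 <= Psi x) ->
  forall g : probability R R, (forall D, measurable D -> P (X m @^-1` D) = g D) ->
  \int[P]_w Psi (Y w, X m w) = \int[P]_w \int[g]_y Psi (Y w, y).
Proof.
move=> mY mPsi Psi0 g gE.
have mYO : measurable_fun [set: Omega] Y.
  move=> _ C mC; rewrite setTI; apply: (@past_measurable m).
  by rewrite -[X in measurable X]setTI; exact: mY.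
have mYX : measurable_fun [set: Omega] (fun w => (Y w, X m w)).
  exact: measurable_fun_pair.
pose Ym : {mfun Omega >-> T'} := mfun_Sub (mem_set mYO).
pose nuY := distribution P Ym.
have mI : measurable_fun [set: T'] (fun x => \int[g]_y Psi (x, y)).
  exact: (measurable_fun_fubini_tonelli_F Psi).
transitivity (\int[nuY \x g]_z Psi z); last first.
  rewrite fubini_tonelli1// ge0_integral_pushforward//.
  by move=> x _; exact: integral_ge0.
rewrite -(integral_image_measure mYX)//; apply: eq_measure_integral => A mA _.
apply/esym; apply: product_measure_unique => // C D mC mD.
rewrite /image_measure /pushforward /=.
have -> : (fun w => (Y w, X m w)) @^-1` (C `*` D) = Y @^-1` C `&` X m @^-1` D.
  by [].
rewrite past_indep// ?gE//.
by rewrite -[X in measurable X]setTI; exact: mY.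
Qed.

End IndependentSequence.

(** * One Gaussian step of the transformation *)

Section CenteredGaussian.
Context {R : realType}.

(** The parameter is the variance, whereas [normal_prob] takes the standard
    deviation. *)
Definition gaussian (h : R) : set R -> \bar R := normal_prob 0 (Num.sqrt h).

Let gaussian0 h : gaussian h set0 = 0%E.
Proof. exact: (measure0 (normal_prob 0 (Num.sqrt h))). Qed.

Let gaussian_ge0 h A : (0 <= gaussian h A)%E.
Proof. exact: (measure_ge0 (normal_prob 0 (Num.sqrt h))). Qed.

Let gaussian_sigma_additive h : semi_sigma_additive (gaussian h).
Proof. exact: (@measure_semi_sigma_additive _ _ _ (normal_prob 0 (Num.sqrt h))). Qed.

HB.instance Definition _ h := isMeasure.Build _ _ _ (gaussian h)
  (gaussian0 h) (@gaussian_ge0 h) (@gaussian_sigma_additive h).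

Let gaussian_setT h : gaussian h [set: R] = 1%E.
Proof. exact: (probability_setT (normal_prob 0 (Num.sqrt h))). Qed.

HB.instance Definition _ h :=
  Measure_isProbability.Build _ _ _ (gaussian h) (gaussian_setT h).

End CenteredGaussian.

Section OneStep.
Context {R : realType}.
Local Notation mu := (@lebesgue_measure R).
Local Open Scope ereal_scope.

Lemma ge0_integral_opp (f : R -> \bar R) : (forall x, 0 <= f x) ->
  measurable_fun [set: R] f -> \int[mu]_x f (- x)%R = \int[mu]_x f x.
Proof.
move=> f0 mf.
have mN : measurable_fun [set: measurableTypeR R] (-%R : R -> measurableTypeR R).
  exact: oppr_measurable.
rewrite -(integral_image_measure mN mu)//.
by apply: eq_measure_integral => A mA _; exact: lebesgue_measureN.
Qed.

Lemma ge0_integral_shift (a : R) (f : R -> \bar R) : (forall x, 0 <= f x) ->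
  measurable_fun [set: R] f -> \int[mu]_x f (x + a)%R = \int[mu]_x f x.
Proof.
move=> f0 mf; rewrite [RHS](@ge0_integral_affine R 1 a)// mul1e.
by under [RHS]eq_integral do rewrite mul1r.
Qed.

Lemma integral_itv0y (f : R -> \bar R) :
  \int[mu]_(y in `]0%R, +oo[) f y = \int[mu]_y ((0 < y)%R%:R%:E * f y).
Proof.
rewrite integral_mkcond; apply: eq_integral => y _; rewrite patchE.
have -> : (y \in `]0%R, +oo[%classic) = (0 < y)%R.
  by apply/idP/idP; rewrite inE/= in_itv/= andbT.
by case: (0 < y)%R; rewrite ?mul1e ?mul0e.
Qed.

(** In the variable Y = exp (- y), the map y |-> y - ln (r + g exp y) becomes
    the affine map Y |-> r Y + g.  This is why the transformation of a walk has
    an explicit Jacobian and an inverse of the same form. *)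
Lemma substitution_step (r g : R) (k : R -> \bar R) : (0 < r)%R ->
  (forall x, 0 <= k x) -> measurable_fun [set: R] k ->
  \int[mu]_y ((r / (r + g * expR y) * (0 < r + g * expR y)%R%:R)%:E
              * k (y - ln (r + g * expR y))%R) =
  \int[mu]_x ((0 < 1 - g * expR x)%R%:R%:E * k x).
Proof.
move=> r0 k0 mk.
have mk' (f : R -> R) : measurable_fun [set: R] f ->
    measurable_fun [set: R] (fun y => k (f y)) by exact: measurableT_comp.
rewrite -[LHS]ge0_integral_opp; last 2 first.
- by move=> y; rewrite mule_ge0// lee_fin; case: ltP => r0'; rewrite ?mulr0// mulr1 divr_ge0// ltW.
- meas; apply: mk'; meas.
rewrite -[RHS]ge0_integral_opp; last 2 first.
- by move=> y; rewrite mule_ge0.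
- by meas.
pose H (Y : R) := ((0 < r * Y + g)%R%:R * (r / (r * Y + g)))%:E * k (- ln (r * Y + g))%R.
pose H' (Y : R) := ((g < Y)%R%:R / Y)%:E * k (- ln Y)%R.
pose H'' (Y : R) := (0 < Y)%R%:R%:E * (((g < Y)%R%:R / Y)%:E * k (- ln Y)%R).
have H0 Y : 0 <= H Y.
  by rewrite mule_ge0// lee_fin; case: ltP => ?; rewrite ?mul0r// mul1r divr_ge0 // ltW.
have H''0 Y : 0 <= H'' Y.
  rewrite /H''; case: ltP => Y0; last by rewrite mul0e.
  by rewrite mule_ge0// mule_ge0// lee_fin divr_ge0// ltW.
have mH : measurable_fun [set: R] H.
  rewrite /H; meas.
  apply: mk'; meas.
have mH' : measurable_fun [set: R] H' by rewrite /H'; meas; apply: mk'; meas.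
have mH'' : measurable_fun [set: R] H'' by rewrite /H''; meas; exact: mH'.
transitivity (\int[mu]_Y ((0 < Y)%R%:R%:E * H Y)).
  rewrite -integral_itv0y ge0_integral_expR//; apply: eq_integral => y _.
  rewrite /H muleAC -EFinM.
  have e0 : (0 < expR y)%R by exact: expR_gt0.
  have -> : (r * expR y + g = (r + g * expR (- y)) * expR y)%R.
    by rewrite mulrDl -mulrA -expRD addNr expR0 mulr1.
  rewrite (pmulr_lgt0 _ e0).
  case: ltP => [p|]; last by rewrite !mul0r mulr0 !mul0e.
  rewrite !mul1r mulr1; congr (_%:E * k _).
    by field; rewrite gt_eqF//= gt_eqF.
  by rewrite lnM ?posrE// expRK opprD addrC.
transitivity (\int[mu]_Y H'' Y); last first.
  transitivity (\int[mu]_Y ((0 < Y)%R%:R%:E * H'' Y)).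
    apply: eq_integral => y _; rewrite /H''.
    by case: (0 < y)%R; rewrite ?mul1e// !mul0e.
  rewrite -integral_itv0y ge0_integral_expR//; apply: eq_integral => y _.
  rewrite /H'' expR_gt0 mul1e muleAC -EFinM mulfVK ?gt_eqF ?expR_gt0//.
  congr (_%:R%:E * k _); last by rewrite expRK.
  rewrite subr_gt0 -[in RHS](ltr_pM2r (expR_gt0 y)) mul1r -mulrA -expRD addNr.
  by rewrite expR0 mulr1.
rewrite (ge0_integral_affine g r0 H''0 mH'') -ge0_integralZl//; last 2 first.
- by apply: (measurableT_comp mH''); meas.
- by rewrite lee_fin ltW.
apply: eq_integral => y _; rewrite /H'' /H.
rewrite ltrDr pmulr_rgt0//.
case: ltP => y0; last by rewrite !mul0e mul0r mul0e !mule0.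
case: ltP => y1; last by rewrite !mul0r !mul0e !mule0.
by rewrite !mul1e !mul1r muleA -EFinM.
Qed.

Lemma integral_gaussian (h : R) (f : R -> \bar R) : (0 < h)%R ->
  (forall x, 0 <= f x) -> measurable_fun [set: R] f ->
  \int[gaussian h]_y f y =
  \int[mu]_y (f y * (normal_peak (Num.sqrt h) * expR (- y ^+ 2 / (2 * h)))%:E).
Proof.
move=> h0 f0 mf.
have mp := @measurable_normal_pdf R 0 (Num.sqrt h).
have p0 := @normal_pdf_ge0 R 0 (Num.sqrt h).
have sh : (Num.sqrt h != 0)%R by rewrite gt_eqF// sqrtr_gt0.
have mid : measurable_fun [set: measurableTypeR R] (id : measurableTypeR R -> R).
  by [].
have -> : \int[gaussian h]_y f y = \int[mdens mu p0 mp]_y f y.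
  rewrite -(integral_image_measure mid (mdens mu p0 mp))//.
rewrite integral_mdens//; apply: eq_integral => y _.
by rewrite normal_pdfE// /normal_fun subr0 sqr_sqrtr ?ltW// -mulr_natl.
Qed.

(** One step of the walk from position b with denominator r.  The position
    after transformation is x' y and the new denominator r' y; read backwards,
    the step is again of this form, from position x with denominator r^-1 and
    with - c in place of c.  The weight is the Jacobian of the step times the
    ratio of the two Gaussian densities. *)
Lemma gauss_step (h c b r : R) (K : R * R -> \bar R) : (0 < h)%R -> (0 < r)%R ->
  (forall z, 0 <= K z) -> measurable_fun [set: R * R] K ->
  let r' y := (r + c * (h * expR (b + (b + y))))%R in
  let x := (b - ln r)%R in
  let x' y := (b + y - ln (r' y))%R in
  let q' y := (r^-1 - c * (h * expR (x + (x + y))))%R in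
  \int[gaussian h]_y
    ((r / r' y * expR ((y ^+ 2 - (x' y - x) ^+ 2) / (2 * h)) *
      (0 < r' y)%R%:R)%:E * K (x' y, (r' y)^-1)%R) =
  \int[gaussian h]_y
    ((0 < q' y)%R%:R%:E * K (x + y, q' y)%R).
Proof.
move=> h0 r0 K0 mK r' x x' q'.
have mK' (f1 f2 : R -> R) : measurable_fun [set: R] f1 ->
    measurable_fun [set: R] f2 ->
    measurable_fun [set: R] (fun y => K (f1 y, f2 y)).
  by move=> m1 m2; apply: (measurableT_comp mK); meas.
have mr' : measurable_fun [set: R] r' by rewrite /r'; meas.
have mx' : measurable_fun [set: R] x' by rewrite /x'; meas.
have mq' : measurable_fun [set: R] q' by rewrite /q'; meas.
rewrite !integral_gaussian//; last 4 first.
- by move=> y; rewrite mule_ge0.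
- by meas; apply: mK'; meas.
- move=> y; rewrite mule_ge0// lee_fin.
  case: ltP => [p|]; last by rewrite mulr0.
  by rewrite mulr1 mulr_ge0 ?expR_ge0// divr_ge0// ltW.
- by meas; apply: mK'; meas.
pose g := (c * (h * expR b))%R.
pose p := normal_peak (Num.sqrt h).
have p0 : (0 <= p)%R by exact: normal_peak_ge0.
pose k (z : R) := K (z, (1 - g * expR z) / r)%R *
  (p * expR (- (z - x) ^+ 2 / (2 * h)))%:E.
have k0 z : 0 <= k z by rewrite mule_ge0// lee_fin mulr_ge0// expR_ge0.
have mk : measurable_fun [set: R] k.
  by rewrite /k; meas; apply: mK'; meas.
have mk' (f : R -> R) : measurable_fun [set: R] f ->
    measurable_fun [set: R] (fun y => k (f y)) by exact: measurableT_comp.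
transitivity (\int[mu]_y ((r / (r + g * expR y) * (0 < r + g * expR y)%R%:R)%:E
              * k (y - ln (r + g * expR y))%R)); last first.
  rewrite substitution_step//.
  rewrite -[LHS](@ge0_integral_shift x); last 2 first.
  - by move=> y; rewrite mule_ge0.
  - by meas.
  apply: eq_integral => y _.
  have qE : q' y = ((1 - g * expR (y + x)) / r)%R.
    rewrite /q' mulrBl mul1r /g; congr (_ - _)%R.
    rewrite -!mulrA; congr (c * (h * _))%R.
    rewrite -{1}[r]lnK// -expRN mulrA -!expRD; congr expR; rewrite /x; ring.
  rewrite qE pmulr_lgt0 ?invr_gt0// -muleA; congr (_ * _).
  rewrite /k addrK; congr (K (_, _) * _); first exact: addrC.
rewrite -[RHS](@ge0_integral_shift b); last 2 first.
- move=> y; rewrite mule_ge0// lee_fin.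
  case: ltP => [p1|]; last by rewrite mulr0.
  by rewrite mulr1 divr_ge0// ltW.
- by meas; apply: mk'; meas.
apply: eq_integral => y _.
have rE : r' y = (r + g * expR (y + b))%R.
  rewrite /r' /g; congr (_ + _)%R; rewrite -!mulrA -expRD.
  by congr (c * (h * expR _))%R; ring.
rewrite -rE; case: ltP => [ry|]; last by rewrite !mulr0 !mul0e.
rewrite !mulr1 /k (_ : y + b - ln (r' y) = x' y)%R; last by rewrite /x'; ring.
have -> : ((1 - g * expR (x' y)) / r = (r' y)^-1)%R.
  rewrite /x' expRB lnK// [(b + y)%R]addrC.
  have -> : (g * (expR (y + b) / r' y) = (r' y - r) / r' y)%R.
    by rewrite mulrA rE addrAC subrr add0r.
  by field; rewrite !gt_eqF.
rewrite [K _ * _]muleC !muleA -!EFinM muleAC -EFinM; congr (_%:E * _).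
rewrite -!mulrA; congr (_ * (_ * _))%R.
rewrite mulrCA -expRD; congr (_ * expR _)%R; field.
by rewrite gt_eqF.
Qed.

End OneStep.

(** * Exact change of variables for a Gaussian random walk *)

Section DiscreteTransform.
Context {R : realType}.
Implicit Types (c h : R) (b : nat -> R).

(** The Riemann sum uses exp (b_i + b_(i+1)), the geometric mean of
    exp (2 b_i) and exp (2 b_(i+1)): this is what makes a step affine in
    exp (- b_(i+1)) and the change of variables exact. *)
Definition dA h b n : R := \sum_(i < n) h * expR (b i + b i.+1).

(** Discrete counterpart of 1 + c A. *)
Definition dr c h b n : R := 1 + c * dA h b n.

(** Discrete counterpart of phi - ln (1 + c A). *)
Definition dX c h b n : R := b n - ln (dr c h b n).

(** Jacobian of step i times the ratio of the Gaussian densities of the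
    increments before and after transformation. *)
Definition dw c h b i : R :=
  dr c h b i / dr c h b i.+1 *
  expR (((b i.+1 - b i) ^+ 2 - (dX c h b i.+1 - dX c h b i) ^+ 2) / (2 * h)).

Lemma dA_recr h b n : dA h b n.+1 = dA h b n + h * expR (b n + b n.+1).
Proof. by rewrite /dA big_ord_recr. Qed.

Lemma dr0 c h b : dr c h b 0 = 1.
Proof. by rewrite /dr /dA big_ord0 mulr0 addr0. Qed.

Lemma dr_recr c h b n :
  dr c h b n.+1 = dr c h b n + c * (h * expR (b n + b n.+1)).
Proof. by rewrite /dr dA_recr mulrDr addrA. Qed.

(** The indicators discard the walks whose denominator reaches 0, which can
    happen for c < 0. *)
Definition dwpos c h b i : R :=
  dw c h b i * (0 < dr c h b i.+1)%R%:R * (0 < dr c h b i)%R%:R.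

Lemma dwpos_ge0 c h b i : 0 <= dwpos c h b i.
Proof.
rewrite /dwpos; case: ltP => r'; last by rewrite mulr0 mul0r.
case: ltP => r; last by rewrite mulr0.
by rewrite !mulr1 /dw mulr_ge0 ?expR_ge0// divr_ge0// ltW.
Qed.

Variable g : nat -> R * R -> R.
Hypothesis g0 : forall i z, 0 <= g i z.
Hypothesis mg : forall i, measurable_fun [set: R * R] (g i).

(** The test functions take the transformed walk and the reciprocals of the
    denominators because, seen from the inverse transformation, these are the
    original walk and its denominators, which are the arguments in [weightR]. *)
Definition weightL c h b n : R :=
  \prod_(i < n.+1) g i (dX c h b i, (dr c h b i)^-1) * \prod_(i < n) dwpos c h b i.

Definition weightR c h b n : R :=
  \prod_(i < n.+1) g i (b i, dr c h b i) * \prod_(i < n) (0 < dr c h b i.+1)%R%:R.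

Lemma weightL_ge0 c h b n : 0 <= weightL c h b n.
Proof.
rewrite mulr_ge0//; apply: prodr_ge0 => i _; first exact: g0.
exact: dwpos_ge0.
Qed.

Lemma weightR_ge0 c h b n : 0 <= weightR c h b n.
Proof. by rewrite mulr_ge0//; apply: prodr_ge0 => i _. Qed.

Lemma weightL_eq0 c h b n : ~~ (0 < dr c h b n) -> weightL c h b n = 0.
Proof.
case: n => [|n]; first by rewrite dr0 ltr01.
move=> /negbTE r0; rewrite /weightL [X in _ * X]big_ord_recr /= /dwpos r0.
by rewrite mulr0 mul0r !mulr0.
Qed.

Lemma weightL_recr c h b n : weightL c h b n.+1 =
  weightL c h b n * (dwpos c h b n * g n.+1 (dX c h b n.+1, (dr c h b n.+1)^-1)).
Proof.
rewrite /weightL big_ord_recr [X in _ * X]big_ord_recr /=; ring.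
Qed.

Lemma weightR_recr c h b n : weightR c h b n.+1 =
  weightR c h b n * ((0 < dr c h b n.+1)%R%:R * g n.+1 (b n.+1, dr c h b n.+1)).
Proof.
rewrite /weightR big_ord_recr [X in _ * X]big_ord_recr /=; ring.
Qed.

Section Measurable.
Context d (T : measurableType d) (beta : T -> nat -> R) (m : nat).
Hypothesis mbeta : forall i, (i <= m)%N -> measurable_fun [set: T] (beta ^~ i).

Lemma measurable_dr c h i : (i <= m)%N ->
  measurable_fun [set: T] (fun w => dr c h (beta w) i).
Proof.
move=> im; rewrite /dr; meas; rewrite /dA; apply: measurable_sum => j.
by meas; apply: mbeta; rewrite (leq_trans _ im)// ltnW.
Qed.

Lemma measurable_dX c h i : (i <= m)%N ->
  measurable_fun [set: T] (fun w => dX c h (beta w) i).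
Proof. by move=> im; rewrite /dX; meas; [exact: mbeta|exact: measurable_dr]. Qed.

Lemma measurable_dw c h i : (i < m)%N ->
  measurable_fun [set: T] (fun w => dw c h (beta w) i).
Proof.
move=> im; have im' := ltnW im.
by rewrite /dw; meas; try (by apply: measurable_dr); try (by apply: measurable_dX); apply: mbeta.
Qed.

Lemma measurable_dwpos c h i : (i < m)%N ->
  measurable_fun [set: T] (fun w => dwpos c h (beta w) i).
Proof.
move=> im; have im' := ltnW im.
by rewrite /dwpos; meas; [exact: measurable_dw|exact: measurable_dr|exact: measurable_dr].
Qed.

Let mgc i (f1 f2 : T -> R) : measurable_fun [set: T] f1 ->
  measurable_fun [set: T] f2 -> measurable_fun [set: T] (fun w => g i (f1 w, f2 w)).
Proof. by move=> m1 m2; apply: (measurableT_comp (mg i)); meas. Qed.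

Lemma measurable_weightL c h :
  measurable_fun [set: T] (fun w => weightL c h (beta w) m).
Proof.
rewrite /weightL; meas; apply: measurable_prod => i _; last exact: measurable_dwpos.
have im : (i <= m)%N by rewrite -ltnS.
by apply: mgc; [exact: measurable_dX|meas; exact: measurable_dr].
Qed.

Lemma measurable_weightR c h :
  measurable_fun [set: T] (fun w => weightR c h (beta w) m).
Proof.
rewrite /weightR; meas; apply: measurable_prod => i _.
  have im : (i <= m)%N by rewrite -ltnS.
  by apply: mgc; [exact: mbeta|exact: measurable_dr].
by meas; exact: measurable_dr.
Qed.

End Measurable.

End DiscreteTransform.

Section DiscreteIdentity.
Context d (Omega : measurableType d) (R : realType) (P : probability Omega R).
Variables (X : nat -> Omega -> R) (h : R).
Hypothesis h0 : 0 < h.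
Hypothesis mX : forall i, measurable_fun [set: Omega] (X i).
Hypothesis indX : forall n, independent_RVs P (fun i : 'I_n => X i).
Hypothesis gaussX : forall i A, measurable A ->
  P (X i @^-1` A) = gaussian h A.

Definition walk (w : Omega) (n : nat) : R := \sum_(i < n) X i w.

Lemma measurable_walk_past m i : (i <= m)%N ->
  measurable_fun [set: past X m] (fun w : past X m => walk w i).
Proof.
move=> im; apply: measurable_sum => j; apply: measurable_past.
exact: leq_trans im.
Qed.

Local Open Scope ereal_scope.

(** The transformations with parameters c and - c are inverse to each other,
    at each mesh and without error.  By induction on the number of steps:
    conditionally on the past, the last step is [gauss_step]. *)
Theorem discrete_identity c (g : nat -> R * R -> R) :
  (forall i z, 0 <= g i z)%R -> (forall i, measurable_fun [set: R * R] (g i)) ->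
  forall n (Psi : R * R -> \bar R), (forall z, 0 <= Psi z) ->
  measurable_fun [set: R * R] Psi ->
  \int[P]_w ((weightL g c h (walk w) n)%:E *
      Psi (dX c h (walk w) n, (dr c h (walk w) n)^-1)%R) =
  \int[P]_w ((weightR g (- c) h (walk w) n)%:E *
      Psi (walk w n, dr (- c) h (walk w) n)).
Proof.
move=> g0 mg; elim=> [|n IH] Psi Psi0 mPsi.
  apply: eq_integral => w _; rewrite /weightL /weightR !big_ord_recl !big_ord0.
  by rewrite /dX !dr0 ln1 subr0 invr1.
pose K z := (g n.+1 z)%:E * Psi z.
have K0 z : 0 <= K z by rewrite mule_ge0// lee_fin.
have mK : measurable_fun [set: R * R] K by rewrite /K; meas.
pose N : probability R R := gaussian h.
pose r' (r b y : R) := (r + c * (h * expR (b + (b + y))))%R.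
pose x' (r b y : R) := (b + y - ln (r' r b y))%R.
pose q' (q x y : R) := (q - c * (h * expR (x + (x + y))))%R.
(* The absolute values keep both integrands nonnegative off the range of
   the variables that occur, as [past_integral] requires. *)
pose PsiL (z : R * (R * R) * R) :=
  (`|z.1.1|)%:E * ((r' z.1.2.2 z.1.2.1 z.2 > 0)%R%:R * (0 < z.1.2.2)%R%:R *
      `|z.1.2.2 / r' z.1.2.2 z.1.2.1 z.2| * expR ((z.2 ^+ 2 -
        (x' z.1.2.2 z.1.2.1 z.2 - (z.1.2.1 - ln z.1.2.2)) ^+ 2) / (2 * h)))%:E *
   K (x' z.1.2.2 z.1.2.1 z.2, (r' z.1.2.2 z.1.2.1 z.2)^-1)%R.
pose PsiR (z : R * (R * R) * R) :=
  (`|z.1.1|)%:E * ((0 < q' z.1.2.2 z.1.2.1 z.2)%R%:R%:E *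
    K (z.1.2.1 + z.2, q' z.1.2.2 z.1.2.1 z.2)%R).
pose Psi' (z : R * R) :=
  \int[N]_y ((0 < q' z.2 z.1 y)%R%:R%:E * K (z.1 + y, q' z.2 z.1 y)%R).
have mKc d' (T : measurableType d') (f1 f2 : T -> R) :
    measurable_fun [set: T] f1 -> measurable_fun [set: T] f2 ->
    measurable_fun [set: T] (fun y => K (f1 y, f2 y)).
  by move=> m1 m2; apply: (measurableT_comp mK); meas.
have mnorm d' (T : measurableType d') (f : T -> R) :
    measurable_fun [set: T] f -> measurable_fun [set: T] (fun y => `|f y|)%R.
  by move=> m1; exact: measurableT_comp.
have PsiL0 z : 0 <= PsiL z.
  by rewrite mule_ge0// mule_ge0// lee_fin mulr_ge0 ?expR_ge0// mulr_ge0.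
have PsiR0 z : 0 <= PsiR z by rewrite mule_ge0 ?lee_fin// mule_ge0// lee_fin.
have mPsiR : measurable_fun [set: R * (R * R) * R] PsiR.
  by rewrite /PsiR /q'; meas; [apply: mnorm; meas|apply: mKc; meas].
have mPsiL : measurable_fun [set: R * (R * R) * R] PsiL.
  by rewrite /PsiL /x' /r'; meas; [apply: mnorm; meas|apply: mnorm; meas|apply: mKc; meas].
have Psi'0 z : 0 <= Psi' z by apply: integral_ge0 => y _; rewrite mule_ge0// lee_fin.
have mPsi' : measurable_fun [set: R * R] Psi'.
  apply: (@measurable_fun_fubini_tonelli_F _ _ _ _ _ N (fun z : (R * R) * R =>
    (0 < q' z.1.2 z.1.1 z.2)%R%:R%:E * K (z.1.1 + z.2, q' z.1.2 z.1.1 z.2)%R)).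
    by rewrite /q'; meas; apply: mKc; meas.
  by move=> z; rewrite mule_ge0// lee_fin.
have walkS w : walk w n.+1 = (walk w n + X n w)%R by rewrite /walk big_ord_recr.
have drS c' w : dr c' h (walk w) n.+1 = (dr c' h (walk w) n +
    c' * (h * expR (walk w n + (walk w n + X n w))))%R.
  by rewrite dr_recr walkS.
have drS_r' w : dr c h (walk w) n.+1 =
    r' (dr c h (walk w) n) (walk w n) (X n w) by rewrite drS.
have dXS_x' w : dX c h (walk w) n.+1 =
    x' (dr c h (walk w) n) (walk w n) (X n w) by rewrite /dX /x' -drS_r' walkS.
have mYL : measurable_fun [set: past X n] (fun w : past X n =>
    (weightL g c h (walk w) n, (walk w n, dr c h (walk w) n))).
  meas; [|exact: measurable_walk_past|].
    by apply: measurable_weightL => // i im; exact: measurable_walk_past.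
  by apply: (@measurable_dr _ _ _ _ n) => // i im; exact: measurable_walk_past.
have mYR : measurable_fun [set: past X n] (fun w : past X n =>
    (weightR g (- c) h (walk w) n, (walk w n, dr (- c) h (walk w) n))).
  meas; [|exact: measurable_walk_past|].
    by apply: measurable_weightR => // i im; exact: measurable_walk_past.
  by apply: (@measurable_dr _ _ _ _ n) => // i im; exact: measurable_walk_past.
have NE D : measurable D -> P (X n @^-1` D) = N D by exact: gaussX.
transitivity (\int[P]_w PsiL
    ((weightL g c h (walk w) n, (walk w n, dr c h (walk w) n)), X n w)).
  apply: eq_integral => w _; rewrite weightL_recr /PsiL/= /K.
  rewrite ger0_norm ?weightL_ge0// -drS_r' -dXS_x' EFinM -[RHS]muleA.
  rewrite -muleA; congr (_ * _); rewrite [RHS]muleA -EFinM.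
  congr ((_ * _)%:E * Psi _).
  rewrite /dwpos /dw.
  case: (ltP 0%R (dr c h _ n)) => rn; last by rewrite !mulr0 !mul0r.
  case: (ltP 0%R (dr c h _ n.+1)) => rn1; last by rewrite !mulr0 !mul0r.
  rewrite !mulr1 !mul1r ger0_norm; last by rewrite divr_ge0// ltW.
  by rewrite walkS (addrC (walk w n) (X n w)) addrK.
rewrite (past_integral mX indX (g := N) mYL mPsiL PsiL0 NE).
transitivity (\int[P]_w ((weightL g c h (walk w) n)%:E *
    Psi' (dX c h (walk w) n, (dr c h (walk w) n)^-1)%R)).
  apply: eq_integral => w _.
  have [rn|rn] := boolP (0 < dr c h (walk w) n)%R; last first.
    rewrite weightL_eq0// mul0e integral0_eq// => y _.
    by rewrite /PsiL/= normr0 !mul0e.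
  have -> : Psi' (dX c h (walk w) n, (dr c h (walk w) n)^-1)%R = _ :=
    esym (gauss_step c (walk w n) h0 rn K0 mK).
  rewrite /= -ge0_integralZl_EFin//.
  - apply: eq_integral => y _; rewrite /PsiL/= ger0_norm ?weightL_ge0//.
    rewrite rn mulr1 -/(r' _ _ y) -/(x' _ _ y) -/(dX c h (walk w) n).
    rewrite -[LHS]muleA; congr (_ * (_%:E * _)).
    case: (ltP 0%R (r' _ _ y)) => ry; last by rewrite !mul0r mulr0.
    by rewrite mulr1 mul1r ger0_norm// divr_ge0// ltW.
  - move=> y _; rewrite mule_ge0// lee_fin -/(r' _ _ y).
    case: (ltP 0%R (r' _ _ y)) => ry; last by rewrite !mulr0.
    by rewrite mulr1 mulr_ge0 ?expR_ge0// divr_ge0// ltW.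
  - by meas; apply: mKc; meas.
  - exact: weightL_ge0.
rewrite IH//.
transitivity (\int[P]_w \int[N]_y PsiR
    ((weightR g (- c) h (walk w) n, (walk w n, dr (- c) h (walk w) n)), y)).
  apply: eq_integral => w _; rewrite -ge0_integralZl_EFin//.
  - apply: eq_integral => y _; rewrite /PsiR/= ger0_norm//.
    exact: weightR_ge0.
  - by move=> y _; rewrite mule_ge0// lee_fin.
  - by rewrite /q'; meas; apply: mKc; meas.
  - exact: weightR_ge0.
rewrite -(past_integral mX indX (g := N) mYR mPsiR PsiR0 NE).
apply: eq_integral => w _; rewrite weightR_recr /PsiR/= /K.
rewrite ger0_norm ?weightR_ge0// /q' -mulNr -drS -walkS !EFinM -!muleA.
by [].
Qed.

End DiscreteIdentity.

(** * The exponential functional of a continuous path and its Riemann sums *)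

Section ContinuousPath.
Context {R : realType} (t : R) (phi : R -> R).
Hypothesis t0 : 0 < t.
Hypothesis cphi : {within `[0, t], continuous phi}.
Local Notation mu := (@lebesgue_measure R).

Lemma path_unif_continuous (e : R) : 0 < e -> exists2 del : R, 0 < del &
  forall x y : R, 0 <= x <= t -> 0 <= y <= t -> `|x - y| < del ->
    `|phi x - phi y| < e.
Proof.
move=> e0.
have cK := @segment_compact R 0 t.
have : \forall del \near (0 : R)^'+, `[0, t] `<=`
    (fun x : R => forall y : R, 0 <= y <= t -> `|x - y| < del -> `|phi x - phi y| < e).
  move/compact_near_coveringP/near_covering_withinP : cK; apply.
  move=> x xt.
  have e20 : 0 < e / 2 by rewrite divr_gt0.
  have /subspace_continuousP/(_ x xt)/cvgrPdist_lt/(_ _ e20) := cphi.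
  rewrite near_withinE /within /= => -[r /= r0 Hr].
  have Hr' (y : R) : `[0, t]%classic y -> `|x - y| < r -> `|phi x - phi y| < e / 2.
    by move=> yt xy; have := Hr y xy yt.
  exists (ball x (r / 2), [set del | 0 < del < r / 2]).
    split=> /=; first exact: (nbhsx_ballx x (r / 2) (divr_gt0 r0 (ltr0n _ 2))).
    near=> z; apply/andP; split => //; near: z; exact: nbhs_right_lt (divr_gt0 _ _).
  move=> [x' del] /= [xx' /andP[d0 dr]] x't y yt x'y.
  have H1 : `|phi x - phi x'| < e / 2.
    by apply: Hr' => //; have : `|x - x'| < r / 2 := xx'; lra.
  have H2 : `|phi x - phi y| < e / 2.
    apply: Hr'; first by rewrite /= in_itv.
    rewrite (_ : x - y = (x - x') + (x' - y)); last by ring.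
    have : `|x - x'| < r / 2 := xx'; have := ler_normD (x - x') (x' - y); lra.
  rewrite (_ : phi x' - phi y = - (phi x - phi x') + (phi x - phi y)); last by ring.
  have := ler_normD (- (phi x - phi x')) (phi x - phi y); rewrite normrN; lra.
move=> H; near (0 : R)^'+ => del.
exists del => // x y xt yt xy.
have /(_ del) : forall del : R, `[0, t] `<=`
    (fun x : R => forall y : R, 0 <= y <= t -> `|x - y| < del -> `|phi x - phi y| < e) ->
    `|x - y| < del -> `|phi x - phi y| < e.
  by move=> dl /(_ x) /=; rewrite in_itv /= => /(_ xt y yt).
apply => //; near: del; exact: H.
Unshelve. all: by end_near. Qed.

Lemma path_bounded : exists2 M : R, 0 < M & forall x : R, 0 <= x <= t -> `|phi x| <= M.
Proof.
have [x1 _ H1] := EVT_max (ltW t0) cphi.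
have [x2 _ H2] := EVT_min (ltW t0) cphi.
exists (`|phi x1| + `|phi x2| + 1); first by rewrite ltr_wpDl// addr_ge0.
move=> x xt; have xI : x \in `[0, t] by rewrite in_itv.
have := H1 _ xI; have := H2 _ xI.
rewrite ler_norml.
have := ler_norm (phi x1); have := ler_norm (- phi x2); rewrite normrN.
have := normr_ge0 (phi x1); have := normr_ge0 (phi x2).
by move=> *; apply/andP; split; lra.
Qed.

Let f (u : R) := expR (2 * phi u).

Lemma path_exp_continuous : {within `[0, t], continuous f}.
Proof.
apply: (@within_continuous_comp _ _ _ _ phi (fun y => expR (2 * y))) => //.
move=> y _; apply: continuous_cvg; first exact: continuous_expR.
exact: mulrl_continuous.
Qed.

Lemma path_exp_integrable (a b : R) : 0 <= a -> b <= t ->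
  mu.-integrable `[a, b] (EFin \o f).
Proof.
move=> a0 bt.
have : mu.-integrable `[0, t] (EFin \o f).
  apply: continuous_compact_integrable; first exact: segment_compact.
  exact: path_exp_continuous.
apply: integrableS => //; apply: subset_itv; by rewrite bnd_simp.
Qed.

Lemma expA0 : expA phi 0 = 0.
Proof. by rewrite /expA set_itv1 Rintegral_set1. Qed.

Lemma expA_incrE (a b : R) : 0 <= a -> a <= b -> b <= t ->
  expA phi b - expA phi a = \int[mu]_(u in `[a, b]) f u.
Proof.
move=> a0 ab bt; rewrite /expA Rintegral_itvB ?bnd_simp//; last first.
  exact: path_exp_integrable.
rewrite Rintegral_itv_obnd_cbnd//.
have : mu.-integrable `[a, b] (EFin \o f) by exact: path_exp_integrable.
by apply: integrableS => //; exact: subset_itv_oc_cc.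
Qed.

Lemma expA_incr_le (a b m : R) : 0 <= a -> a <= b -> b <= t ->
  (forall u, a <= u <= b -> f u <= m) ->
  expA phi b - expA phi a <= m * (b - a).
Proof.
move=> a0 ab bt H; rewrite expA_incrE//.
have lab : fine (mu `[a, b]%classic) = b - a.
  rewrite lebesgue_measure_itv/= lte_fin.
  by move: ab; rewrite le_eqVlt => /predU1P[->|->]//; rewrite ltxx subrr.
have fin : (mu `[a, b]%classic < +oo)%E.
  by rewrite lebesgue_measure_itv/=; case: ifP => _; rewrite ?ltry// -EFinB ltry.
rewrite -lab -Rintegral_cst//; apply: le_Rintegral => //.
- exact: path_exp_integrable.
- apply: continuous_compact_integrable; first exact: segment_compact.
  by apply: continuous_subspaceT => x; exact: cvg_cst.
Qed.

Lemma expA_incr_ge (a b m : R) : 0 <= a -> a <= b -> b <= t ->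
  (forall u, a <= u <= b -> m <= f u) ->
  m * (b - a) <= expA phi b - expA phi a.
Proof.
move=> a0 ab bt H; rewrite expA_incrE//.
have lab : fine (mu `[a, b]%classic) = b - a.
  rewrite lebesgue_measure_itv/= lte_fin.
  by move: ab; rewrite le_eqVlt => /predU1P[->|->]//; rewrite ltxx subrr.
have fin : (mu `[a, b]%classic < +oo)%E.
  by rewrite lebesgue_measure_itv/=; case: ifP => _; rewrite ?ltry// -EFinB ltry.
rewrite -lab -Rintegral_cst//; apply: le_Rintegral => //.
- apply: continuous_compact_integrable; first exact: segment_compact.
  by apply: continuous_subspaceT => x; exact: cvg_cst.
- exact: path_exp_integrable.
Qed.

Lemma expA_le (a b : R) : 0 <= a -> a <= b -> b <= t -> expA phi a <= expA phi b.
Proof.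
move=> a0 ab bt; rewrite -subr_ge0 -(mul0r (b - a)).
by apply: expA_incr_ge => // u _; exact: expR_ge0.
Qed.

Lemma expA_ge0 (s : R) : 0 <= expA phi s.
Proof. by apply: Rintegral_ge0 => x _; exact: expR_ge0. Qed.

Lemma expA_gt0 (s : R) : 0 < s -> s <= t -> 0 < expA phi s.
Proof.
move=> s0 st; have [M M0 HM] := path_bounded.
have := @expA_incr_ge 0 s (expR (- (2 * M))) (lexx 0) (ltW s0) st.
rewrite expA0 !subr0 => G; apply: lt_le_trans (G _).
  by rewrite mulr_gt0// expR_gt0.
move=> u /andP[u0 us]; rewrite ler_expR.
have : `|phi u| <= M by apply: HM; rewrite u0 (le_trans us).
by rewrite ler_norml => /andP[]; lra.
Qed.

Lemma expA_continuous : {within `[0, t], continuous (expA phi)}.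
Proof.
apply: parameterized_integral_continuous; first exact: ltW.
exact: path_exp_integrable.
Qed.

Section Grid.
Variables (n : nat) (h : R).
Hypotheses (n0 : (0 < n)%N) (hE : h * n%:R = t).

Definition grid : nat -> R := fun i => phi (i%:R * h).

Lemma grid_step_gt0 : 0 < h.
Proof. by move: t0; rewrite -hE pmulr_lgt0// ltr0n. Qed.

Lemma grid_le (i : nat) : (i <= n)%N -> 0 <= i%:R * h <= t.
Proof.
move=> im; have h0 := grid_step_gt0; rewrite mulr_ge0//= ?(ltW h0)//.
by rewrite -hE [h * _]mulrC ler_pM2r// ler_nat.
Qed.

Lemma grid_incr_bounds (eta : R) i : (i < n)%N ->
  (forall x y : R, 0 <= x <= t -> 0 <= y <= t -> `|x - y| <= h ->
    `|phi x - phi y| <= eta) ->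
  expR (- (2 * eta)) * (expA phi (i.+1%:R * h) - expA phi (i%:R * h)) <=
     h * expR (grid i + grid i.+1) <=
  expR (2 * eta) * (expA phi (i.+1%:R * h) - expA phi (i%:R * h)).
Proof.
move=> im H; have h0 := grid_step_gt0.
have /andP[i0 _] := grid_le (ltnW im).
have /andP[_ it] := grid_le im.
have hS : i.+1%:R * h - i%:R * h = h by rewrite -natr1 mulrDl mul1r addrAC subrr add0r.
have hi : i%:R * h <= i.+1%:R * h by rewrite -subr_ge0 hS ltW.
have Hu u : i%:R * h <= u <= i.+1%:R * h ->
    `|grid i - phi u| <= eta /\ `|grid i.+1 - phi u| <= eta.
  move=> /andP[u1 u2]; split; apply: H; try (by apply: grid_le => //; exact: ltnW);
    try (by rewrite (le_trans i0 u1) (le_trans u2 it)); rewrite ler_norml; lra.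
have L := expA_incr_le (m := expR (2 * eta + (grid i + grid i.+1))) i0 hi it.
have G := expA_incr_ge (m := expR (grid i + grid i.+1 - 2 * eta)) i0 hi it.
rewrite hS in L G; apply/andP; split.
  rewrite expRN ler_pdivrMl ?expR_gt0// (le_trans (L _))//; last first.
    by rewrite [expR (_ + (_ + _))]expRD -mulrA [expR (grid i + _) * h]mulrC.
  move=> u /Hu []; rewrite !ler_norml ler_expR => /andP[? ?] /andP[? ?]; lra.
rewrite -ler_pdivrMl ?expR_gt0// -expRN (le_trans _ (G _))//.
  by rewrite [expR (_ - _)]expRD mulrC -[leLHS]mulrA [leLHS]mulrC.
by move=> u /Hu []; rewrite !ler_norml ler_expR => /andP[? ?] /andP[? ?]; lra.
Qed.

(** The bounds are multiplicative: if the path oscillates by at most eta on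
    a mesh step, each term of the sum is off by a factor at most exp (2 eta),
    and so is the sum, however many terms it has. *)
Lemma grid_dA_bounds (eta : R) i : (i <= n)%N ->
  (forall x y : R, 0 <= x <= t -> 0 <= y <= t -> `|x - y| <= h ->
    `|phi x - phi y| <= eta) ->
  expR (- (2 * eta)) * expA phi (i%:R * h) <= dA h grid i <=
  expR (2 * eta) * expA phi (i%:R * h).
Proof.
move=> + H; elim: i => [_|i IH im].
  by rewrite mul0r expA0 /dA big_ord0 !mulr0 lexx.
have /andP[I1 I2] := IH (ltnW im).
have /andP[G1 G2] := grid_incr_bounds im H.
rewrite dA_recr; apply/andP; split; lra.
Qed.

End Grid.

End ContinuousPath.

(** * Cubic bounds for hyperbolic functions *)

Section Elementary.
Context {R : realType}.
Implicit Types (x y : R).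

Lemma derivable_increasing_from0 (f df : R -> R) (a : R) : 0 <= a ->
  (forall x, is_derive x 1 f (df x)) ->
  (forall x, 0 <= x <= a -> 0 <= df x) -> f 0 <= f a.
Proof.
move=> a0 fd df0.
have cf : {within `[0, a], continuous f}.
  by apply: derivable_within_continuous => x _; have [] := fd x.
have [c ca E] := MVT_segment a0 (fun x _ => fd x) cf.
rewrite -subr_ge0 E mulr_ge0//; last by rewrite subr0.
by apply: df0; move: ca; rewrite in_itv.
Qed.

Definition sinh x := (expR x - expR (- x)) / 2.

Lemma sinhN x : sinh (- x) = - sinh x.
Proof. rewrite /sinh opprK; lra. Qed.

Lemma sinh_le_2x x : 0 <= x <= 2^-1 -> sinh x <= 2 * x.
Proof.
move=> /andP[x0 x1]; have := expR_ge1Dx (- x).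
have : expR x <= 1 + 2 * x.
  have e0 : 0 < 1 - x by lra.
  have : expR x <= (1 - x)^-1.
    rewrite -[x in leLHS]opprK expRN lef_pV2 ?posrE ?expR_gt0//.
    exact: expR_ge1Dx.
  move=> /le_trans; apply; rewrite -div1r ler_pdivrMr//; nra.
by rewrite /sinh; lra.
Qed.

Lemma sinh_ge_x x : 0 <= x -> x <= sinh x.
Proof.
move=> x0.
suff : 0 <= sinh x - x by lra.
have -> : 0 = sinh 0 - 0 by rewrite /sinh oppr0; lra.
apply: (@derivable_increasing_from0 (fun x => sinh x - x)
  (fun x => (expR x + expR (- x)) / 2 - 1)) => //.
- move=> z; rewrite /sinh; apply: is_derive_eq.
  by rewrite !scaler0 add0r /GRing.scale/=; lra.
- by move=> z _; have := expR_ge1Dx z; have := expR_ge1Dx (- z); lra.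
Qed.

Lemma cosh_le x : 0 <= x <= 2^-1 -> (expR x + expR (- x)) / 2 <= 1 + x ^+ 2.
Proof.
move=> /andP[x0 x1].
suff : 0 <= 1 + x ^+ 2 - (expR x + expR (- x)) / 2 by lra.
have {1}-> : 0 = 1 + 0 ^+ 2 - (expR 0 + expR (- 0)) / 2 :> R.
  by rewrite oppr0 expR0 expr0n/=; lra.
apply: (@derivable_increasing_from0 (fun x => 1 + x ^+ 2 - (expR x + expR (- x)) / 2)
  (fun x => 2 * x - sinh x)) => //.
- move=> z; rewrite /sinh; apply: is_derive_eq.
  by rewrite !scaler0 /GRing.scale/=; lra.
- move=> z /andP[z0 zx]; have := @sinh_le_2x z; rewrite z0/= => /(_ _)/wrap[]; lra.
Qed.

Lemma sinh_cubic_ge0 x : 0 <= x <= 2^-1 -> sinh x <= x + x ^+ 3.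
Proof.
move=> /andP[x0 x1].
suff : 0 <= x + x ^+ 3 - sinh x by lra.
have {1}-> : 0 = 0 + 0 ^+ 3 - sinh 0 :> R.
  by rewrite /sinh oppr0 expR0 expr0n/=; lra.
apply: (@derivable_increasing_from0 (fun x => x + x ^+ 3 - sinh x)
  (fun x => 1 + 3 * x ^+ 2 - (expR x + expR (- x)) / 2)) => //.
- move=> z; rewrite /sinh; apply: is_derive_eq.
  by rewrite !scaler0 /GRing.scale/=; lra.
- move=> z /andP[z0 zx]; have := @cosh_le z; rewrite z0/= => /(_ _)/wrap[]; nra.
Qed.

Lemma sinh_cubic x : `|x| <= 2^-1 -> `|sinh x - x| <= `|x| ^+ 3.
Proof.
have H y : 0 <= y -> y <= 2^-1 -> `|sinh y - y| <= y ^+ 3.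
  move=> y0 y1; rewrite ger0_norm ?subr_ge0 ?sinh_ge_x//.
  by have := @sinh_cubic_ge0 y; rewrite y0 y1 => /(_ isT); lra.
have [x0|x0] := leP 0 x; first by rewrite ger0_norm//; exact: H.
rewrite ltr0_norm// => x1; have := H (- x); rewrite sinhN -opprD normrN.
by apply => //; lra.
Qed.

(** The difference factors as 2 sinh p sinh d, and its quadratic part as 2 p d,
    which keeps a factor d in each term of the error.  The lemma is used with d
    of the order of the mesh, so that the error remains negligible after
    division by the mesh. *)
Lemma cosh_sub_sqr (p d : R) : `|p| <= 2^-1 -> `|d| <= 2^-1 ->
  `|(expR (p + d) + expR (- (p + d))) / 2 - (expR (p - d) + expR (- (p - d))) / 2
    - ((p + d) ^+ 2 - (p - d) ^+ 2) / 2| <=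
  4 * `|d| * `|p| ^+ 3 + 2 * `|p| * `|d| ^+ 3.
Proof.
move=> p2 d2.
have -> : (expR (p + d) + expR (- (p + d))) / 2 - (expR (p - d) + expR (- (p - d))) / 2
    - ((p + d) ^+ 2 - (p - d) ^+ 2) / 2 =
    2 * (sinh p - p) * sinh d + 2 * p * (sinh d - d).
  rewrite /sinh !opprD opprK !expRD; lra.
have Hp := sinh_cubic p2; have Hd := sinh_cubic d2.
have Hd' : `|sinh d| <= 2 * `|d|.
  rewrite -[sinh d](subrK d) (le_trans (ler_normD _ _))//.
  have : `|d| ^+ 3 <= `|d| by have := normr_ge0 d; nra.
  lra.
have E1 : `|2 * (sinh p - p) * sinh d| = 2 * `|sinh p - p| * `|sinh d|.
  by rewrite [LHS]normrM [X in X * _]normrM (@ger0_norm _ 2).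
have E2 : `|2 * p * (sinh d - d)| = 2 * `|p| * `|sinh d - d|.
  by rewrite [LHS]normrM [X in X * _]normrM (@ger0_norm _ 2).
rewrite (le_trans (ler_normD _ _))// E1 E2; apply: lerD.
  rewrite -!mulrA [leRHS](_ : _ = 2 * (`|p| ^+ 3 * (2 * `|d|))); last by ring.
  by rewrite ler_pM2l// ler_pM.
by rewrite -!mulrA ler_pM2l// ler_wpM2l.
Qed.

End Elementary.

(** * The density of the discrete transformation in closed form *)

Section WeightFormula.
Context {R : realType}.
Implicit Types (c h : R) (b : nat -> R).

(** This is exp (b_i + x_i), where x is the transformed walk. *)
Definition dv c h b i : R := expR (2 * b i) / dr c h b i.

(** Error made in step i when cosh is replaced by its quadratic part. *)
Definition derr c h b i : R :=
  let p := b i.+1 - b i in let q := dX c h b i.+1 - dX c h b i in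
  (expR p + expR (- p)) / 2 - (expR q + expR (- q)) / 2 - (p ^+ 2 - q ^+ 2) / 2.

(** Plays the part of Ito's formula at a fixed mesh: the difference of the two
    cosh is an exact multiple of an increment of [dv], so it telescopes over the
    steps. *)
Lemma cosh_increment c h b i : 0 < dr c h b i -> 0 < dr c h b i.+1 ->
  let p := b i.+1 - b i in let q := dX c h b i.+1 - dX c h b i in
  (expR p + expR (- p)) / 2 - (expR q + expR (- q)) / 2 =
  c * h / 2 * (dv c h b i.+1 - dv c h b i).
Proof.
move=> r0 r1 p q; rewrite /dv.
have rE := dr_recr c h b i.
have E0 := expR_gt0 (b i); have E1 := expR_gt0 (b i.+1).
have -> : expR q = expR (b i.+1) * dr c h b i / (expR (b i) * dr c h b i.+1).
  rewrite /q /dX !expRB !lnK ?posrE//; field.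
  by rewrite !gt_eqF.
have -> : expR (- q) = expR (b i) * dr c h b i.+1 / (expR (b i.+1) * dr c h b i).
  rewrite /q /dX opprB !expRB !lnK ?posrE//; field.
  by rewrite !gt_eqF.
rewrite /p opprB !expRB ![2 * b _]mulr_natl !mulr2n !expRD.
have -> : c * h = (dr c h b i.+1 - dr c h b i) / (expR (b i) * expR (b i.+1)).
  rewrite rE expRD; field; by rewrite !gt_eqF.
field; by rewrite !gt_eqF.
Qed.

Lemma dw_exact c h b i : 0 < h -> 0 < dr c h b i -> 0 < dr c h b i.+1 ->
  dw c h b i = dr c h b i / dr c h b i.+1 *
    expR (c / 2 * (dv c h b i.+1 - dv c h b i) - derr c h b i / h).
Proof.
move=> h0 r0 r1; rewrite /dw; congr (_ * expR _).
rewrite /derr cosh_increment//; field; by rewrite gt_eqF.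
Qed.

(** The Gaussian ratios are exponentials of squares of increments; up to
    [derr] these are the cosh of [cosh_increment], and everything telescopes. *)
Lemma prod_dwpos c h b n : 0 < h -> (forall i, (i <= n)%N -> 0 < dr c h b i) ->
  \prod_(i < n) dwpos c h b i = (dr c h b n)^-1 *
    expR (c / 2 * (dv c h b n - dv c h b 0) - (\sum_(i < n) derr c h b i) / h).
Proof.
move=> h0; elim: n => [_|n IH H].
  by rewrite !big_ord0 dr0 subrr mulr0 mul0r subrr expR0 invr1 mulr1.
have rn := H n (leqnSn n); have rn1 := H n.+1 (leqnn _).
rewrite !big_ord_recr /= IH; last by move=> i im; apply: H; exact: leqW.
rewrite /dwpos rn rn1 !mulr1 dw_exact// mulrACA -expRD; congr (_ * expR _).
  by field; rewrite !gt_eqF.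
by field; rewrite gt_eqF.
Qed.

(** Apply [cosh_sub_sqr] with d half the increment of ln r, which is of
    order h, and p the mean of the two increments. *)
Lemma derr_bound c h b i (L : R) : 0 < h -> 0 <= L -> L * h <= 4^-1 ->
  `|b i.+1 - b i| <= 4^-1 ->
  `|ln (dr c h b i.+1) - ln (dr c h b i)| <= L * h ->
  `|derr c h b i| <= h * (16 * L * `|b i.+1 - b i| ^+ 3 + (16 * L ^+ 4 * h ^+ 3 + L ^+ 3 * h ^+ 2)).
Proof.
move=> h0 L0 Lh; set a := b i.+1 - b i; set l := ln _ - ln _ => a4 lL.
pose d := l / 2; pose p := a - d.
have dL : `|d| <= L * h.
  rewrite /d normrM (@ger0_norm _ 2^-1) ?invr_ge0// ler_pdivrMr//.
  by have := normr_ge0 l; lra.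
have pB : `|p| <= `|a| + L * h.
  by rewrite /p (le_trans (ler_normB _ _))// lerD2l.
have H := @cosh_sub_sqr _ p d.
have pd1 : p + d = a by rewrite /p subrK.
have pd2 : p - d = dX c h b i.+1 - dX c h b i.
  by rewrite /p /d /a /dX /l; field.
rewrite pd1 pd2 in H.
apply: (le_trans (H _ _)); [lra|lra|].
have a0 := normr_ge0 a; have p0 := normr_ge0 p; have d0 := normr_ge0 d.
have Lh0 : 0 <= L * h by rewrite mulr_ge0// ltW.
(* Convexity of the cube. *)
have B1 : `|p| ^+ 3 <= 4 * `|a| ^+ 3 + 4 * (L * h) ^+ 3.
  apply: (@le_trans _ _ ((`|a| + L * h) ^+ 3)).
    by rewrite lerXn2r// nnegrE addr_ge0.
  rewrite -subr_ge0.
  have -> : 4 * `|a| ^+ 3 + 4 * (L * h) ^+ 3 - (`|a| + L * h) ^+ 3 =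
    3 * (`|a| + L * h) * (`|a| - L * h) ^+ 2 by ring.
  by rewrite mulr_ge0 ?sqr_ge0// mulr_ge0// addr_ge0.
have B2 : `|d| ^+ 3 <= (L * h) ^+ 3 by rewrite lerXn2r// nnegrE.
have B3 : 4 * `|d| * `|p| ^+ 3 <= 4 * (L * h) * (4 * `|a| ^+ 3 + 4 * (L * h) ^+ 3).
  by apply: ler_pM => //; rewrite ?exprn_ge0 ?mulr_ge0// ler_pM2l.
have B4 : 2 * `|p| * `|d| ^+ 3 <= 1 * (L * h) ^+ 3.
  by apply: ler_pM => //; rewrite ?exprn_ge0 ?mulr_ge0//; lra.
apply: (le_trans (lerD B3 B4)).
by rewrite le_eqVlt; apply/orP; left; apply/eqP; ring.
Qed.

Lemma ln_lipschitz (x y del : R) : 0 < del -> del <= x -> del <= y ->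
  `|ln y - ln x| <= `|y - x| / del.
Proof.
move=> d0.
have H u v : del <= u -> u <= v -> `|ln v - ln u| <= `|v - u| / del.
  move=> du uv; have u0 := lt_le_trans d0 du; have v0 := lt_le_trans u0 uv.
  rewrite !ger0_norm ?subr_ge0 ?ler_ln//.
  rewrite -ln_div ?posrE//.
  have -> : v / u = 1 + (v - u) / u by field; rewrite gt_eqF.
  apply: (le_trans (le_ln1Dx _)).
    by rewrite (lt_le_trans (ltrN10 _))// divr_ge0 ?subr_ge0// ltW.
  by rewrite ler_wpM2l ?subr_ge0// lef_pV2.
have [xy|/ltW yx] := leP x y; first by move=> dx _; exact: H.
by move=> _ dy; rewrite distrC [X in X / _]distrC; exact: H.
Qed.

End WeightFormula.

(** * Limit of the discrete transformation along a fixed path *)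

Section MeshLimit.
Context {R : realType} (t : R) (phi : R -> R).
Hypothesis t0 : 0 < t.
Hypothesis cphi : {within `[0, t], continuous phi}.
Variables (N : nat -> nat) (h : nat -> R).
Hypothesis N0 : forall k, (0 < N k)%N.
Hypothesis hE : forall k, h k * (N k)%:R = t.
Hypothesis h_cvg : h k @[k --> \oo] --> 0.

Local Notation G k := (grid phi (h k)).

Let h0 k : 0 < h k.
Proof. by have := t0; rewrite -(hE k) pmulr_lgt0// ltr0n. Qed.

Lemma mesh_lt (e : R) : 0 < e -> \forall k \near \oo, h k < e.
Proof.
move=> e0; move/cvgrPdist_lt: h_cvg => /(_ _ e0).
apply: filterS => k; rewrite sub0r normrN ger0_norm//; exact: ltW.
Qed.

Lemma mesh_unif (e : R) : 0 < e -> \forall k \near \oo,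
  forall x y : R, 0 <= x <= t -> 0 <= y <= t -> `|x - y| <= h k ->
    `|phi x - phi y| <= e.
Proof.
move=> e0; have [del d0 H] := path_unif_continuous cphi e0.
have := mesh_lt d0; apply: filterS => k hk x y xt yt xy.
by apply/ltW/H => //; exact: le_lt_trans hk.
Qed.

Lemma dA_unif (e : R) : 0 < e -> \forall k \near \oo,
  forall i, (i <= N k)%N -> `|dA (h k) (G k) i - expA phi (i%:R * h k)| <= e.
Proof.
move=> e0.
have At0 : 0 < expA phi t by exact: (expA_gt0 t0 cphi).
pose a := 1 + e / expA phi t.
have a1 : 1 < a by rewrite ltrDl divr_gt0.
have a0 : 0 < a by rewrite (lt_trans _ a1).
have eta0 : 0 < ln a / 2 by rewrite divr_gt0// ln_gt0.
have := mesh_unif eta0; apply: filterS => k H i iN.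
have /andP[i0 it] := grid_le t0 (N0 k) (hE k) iN.
have Ai : expA phi (i%:R * h k) <= expA phi t by apply: expA_le.
have Ai0 := @expA_ge0 R phi (i%:R * h k).
have := grid_dA_bounds t0 cphi (N0 k) (hE k) iN H.
have -> : 2 * (ln a / 2) = ln a by field.
rewrite expRN lnK ?posrE// => /andP[L U].
have aA : (a - 1) * expA phi t = e by rewrite /a addrAC subrr add0r mulfVK ?gt_eqF.
have ia : 1 - a^-1 <= a - 1.
  rewrite -subr_ge0 (_ : _ - _ = (a - 1) ^+ 2 / a); last by field; rewrite gt_eqF.
  by rewrite divr_ge0 ?sqr_ge0// ltW.
rewrite ler_norml; apply/andP; split.
  have : (1 - a^-1) * expA phi (i%:R * h k) <= (a - 1) * expA phi t.
    by apply: ler_pM => //; rewrite subr_ge0 invf_le1// ltW.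
  by lra.
have : (a - 1) * expA phi (i%:R * h k) <= (a - 1) * expA phi t.
  by rewrite ler_wpM2l// subr_ge0 ltW.
by lra.
Qed.

(** Index of the last grid point that does not exceed s. *)
Definition idx (s : R) k : nat := Num.truncn (s / h k).

Lemma idx_le s k : s <= t -> (idx s k <= N k)%N.
Proof.
move=> st; rewrite /idx -ltnS.
have [s0|s0] := ltP (s / h k) 0.
  by rewrite truncn_floor leNgt s0.
rewrite truncn_lt_nat// ltr_pdivrMr//.
rewrite (le_lt_trans st)// -(hE k) -natr1 mulrDl mul1r [_%:R * _]mulrC ltrDl.
exact: h0.
Qed.

Lemma idx_dist s k : 0 <= s -> `|s - (idx s k)%:R * h k| <= h k.
Proof.
move=> s0; have := @truncn_itv R (s / h k); rewrite -/(idx s k).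
rewrite divr_ge0 ?(ltW (h0 k))// => /(_ isT) /andP[].
rewrite ler_pdivlMr// ltr_pdivrMr// -natr1 mulrDl mul1r => A1 A2.
by rewrite ler_norml; apply/andP; split; have := h0 k; lra.
Qed.

Lemma idx_itv s k : 0 <= s <= t -> 0 <= (idx s k)%:R * h k <= t.
Proof. by move=> /andP[_ st]; exact: grid_le (idx_le k st). Qed.

Lemma grid_idx_cvg s : 0 <= s <= t -> G k (idx s k) @[k --> \oo] --> phi s.
Proof.
move=> st; apply/cvgrPdist_le => e e0.
have := mesh_unif e0; apply: filterS => k H.
apply: H => //; first exact: idx_itv.
by apply: idx_dist; case/andP: st.
Qed.

Lemma dA_idx_cvg s : 0 <= s <= t ->
  dA (h k) (G k) (idx s k) @[k --> \oo] --> expA phi s.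
Proof.
move=> st; apply/cvgrPdist_le => e e0.
have e2 : 0 < e / 2 by rewrite divr_gt0.
have /subspace_continuousP/(_ s)/(_ _)/wrap[] := expA_continuous t0 cphi.
  by rewrite /= in_itv.
move=> /cvgrPdist_le/(_ _ e2); rewrite near_withinE => -[r /= r0 Hr].
have h1 := dA_unif e2; have h2 := mesh_lt r0.
near=> k.
have H1 : `|dA (h k) (G k) (idx s k) - expA phi ((idx s k)%:R * h k)| <= e / 2.
  have iN : (idx s k <= N k)%N by apply: idx_le; case/andP: st.
  by move: iN; move: (idx s k); near: k.
have H2 : `|expA phi s - expA phi ((idx s k)%:R * h k)| <= e / 2.
  apply: Hr => /=; last by rewrite in_itv/=; exact: idx_itv.
  apply: le_lt_trans (idx_dist k _) _; first by case/andP: st.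
  by near: k.
rewrite (_ : expA phi s - _ = expA phi s - expA phi ((idx s k)%:R * h k) -
  (dA (h k) (G k) (idx s k) - expA phi ((idx s k)%:R * h k))); last by ring.
by rewrite (le_trans (ler_normB _ _))// [leRHS]splitr lerD.
Unshelve. all: by end_near. Qed.

Lemma idx_end k : idx t k = N k.
Proof. by rewrite /idx -(hE k) [h k * _]mulrC mulfK ?gt_eqF// natrK. Qed.

Lemma dr_idx_cvg c s : 0 <= s <= t ->
  dr c (h k) (G k) (idx s k) @[k --> \oo] --> 1 + c * expA phi s.
Proof.
move=> st; rewrite /dr; apply: cvgD; first exact: cvg_cst.
by apply: cvgMr; exact: dA_idx_cvg.
Qed.

Lemma dX_idx_cvg c s : 0 <= s <= t -> 0 < 1 + c * expA phi s ->
  dX c (h k) (G k) (idx s k) @[k --> \oo] --> phi s - ln (1 + c * expA phi s).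
Proof.
move=> st c0; rewrite /dX; apply: cvgB; first exact: grid_idx_cvg.
by apply: continuous_cvg; [exact: continuous_ln|exact: dr_idx_cvg].
Qed.

Lemma dA_ge0 hh b n : 0 <= hh -> 0 <= dA hh b n :> R.
Proof. by move=> ?; apply: sumr_ge0 => i _; rewrite mulr_ge0// expR_ge0. Qed.

Lemma dA_le hh b m n : 0 <= hh -> (m <= n)%N -> dA hh b m <= dA hh b n :> R.
Proof.
move=> hh0; elim: n => [|n IH]; first by rewrite leqn0 => /eqP ->.
rewrite leq_eqVlt => /predU1P[->//|]; rewrite ltnS => /IH /le_trans; apply.
by rewrite dA_recr lerDl mulr_ge0// expR_ge0.
Qed.

(** A uniform lower bound on the denominators makes their logarithms
    Lipschitz functions of them. *)
Lemma dr_lower c : 0 < 1 + c * expA phi t ->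
  exists2 del : R, 0 < del & \forall k \near \oo,
    forall i, (i <= N k)%N -> del <= dr c (h k) (G k) i.
Proof.
move=> c0; exists (Order.min 1 ((1 + c * expA phi t) / 2)).
  by rewrite lt_min ltr01/= divr_gt0.
have tt : 0 <= t <= t by rewrite lexx ltW.
have e0 : 0 < (1 + c * expA phi t) / 2 by rewrite divr_gt0.
move/cvgrPdist_le: (@dr_idx_cvg c _ tt) => /(_ _ e0).
apply: filterS => k; rewrite idx_end => H i iN.
have {}H : (1 + c * expA phi t) / 2 <= dr c (h k) (G k) (N k).
  by move: H; rewrite ler_norml => /andP[]; lra.
have h0' := ltW (h0 k).
have Ai := dA_ge0 (G k) i h0'; have AiN := dA_le (G k) h0' iN.
rewrite ge_min; have [cp|cn] := leP 0 c.
  by rewrite /dr lerDl mulr_ge0.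
rewrite (le_trans H) ?orbT// /dr lerD2l.
by rewrite ler_wnM2l// ltW.
Qed.

Definition cubic_variation k := \sum_(i < N k) `|G k i.+1 - G k i| ^+ 3.

(** The limit of the discrete densities, at x = phi t and a = A_t; the
    density D_c of the quasi-invariance property is [Lam (- c)]. *)
Definition Lam c (x a : R) := (1 + c * a)^-1 * expR (c / 2 * (expR (2 * x) / (1 + c * a) - 1)).

(** By [prod_dwpos] the product has a closed form in terms of the end point,
    apart from the accumulated error, which [derr_bound] bounds by a multiple
    of the cubic variation plus a term of the order of the mesh. *)
Lemma weight_cvg c : phi 0 = 0 -> 0 < 1 + c * expA phi t ->
  cubic_variation k @[k --> \oo] --> (0 : R) ->
  \prod_(i < N k) dwpos c (h k) (G k) i @[k --> \oo] --> Lam c (phi t) (expA phi t).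
Proof.
move=> phi0 c0 ccv.
have [del d0 Hdel] := dr_lower c0.
have [M M0 HM] := path_bounded t0 cphi.
pose L := `|c| * expR (2 * M) / del.
have L0 : 0 <= L by rewrite divr_ge0 ?(ltW d0)// mulr_ge0// expR_ge0.
pose E k := (\sum_(i < N k) derr c (h k) (G k) i) / h k.
have Ecvg : E k @[k --> \oo] --> (0 : R).
  (* The sum of the bounds of [derr_bound], divided by the mesh. *)
  pose u k := 16 * L * cubic_variation k +
    t * (16 * L ^+ 4 * (h k) ^+ 2 + L ^+ 3 * h k).
  have ucvg : u k @[k --> \oo] --> (0 : R).
    have : u k @[k --> \oo] --> 16 * L * 0 + t * (16 * L ^+ 4 * (0 * 0) + L ^+ 3 * 0).
      apply: cvgD; first exact: cvgMr.
      apply: cvgMr; apply: cvgD; last exact: cvgMr.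
      by apply: cvgMr; under eq_fun do rewrite expr2; exact: cvgM.
    by rewrite !mulr0 addr0 mulr0 addr0.
  apply/cvgrPdist_le => e e0.
  have q0 : (0 : R) < 4^-1 by rewrite invr_gt0.
  have L1 : 0 < 4^-1 / (L + 1) by rewrite divr_gt0// ltr_wpDl.
  have n1 := mesh_lt L1; have n2 := mesh_unif q0.
  move/cvgrPdist_le : ucvg => /(_ _ e0) n3.
  near=> k; rewrite sub0r normrN.
  have Lh : L * h k <= 4^-1.
    have : h k < 4^-1 / (L + 1) by near: k.
    rewrite ltr_pdivlMr ?ltr_wpDl// => ?; have := h0 k; nra.
  have hunif : forall x y : R, 0 <= x <= t -> 0 <= y <= t -> `|x - y| <= h k ->
      `|phi x - phi y| <= 4^-1 by near: k.
  have drk : forall i, (i <= N k)%N -> del <= dr c (h k) (G k) i by near: k.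
  have uk : `|0 - u k| <= e by near: k.
  have u0 : 0 <= u k.
    rewrite /u addr_ge0// mulr_ge0 ?(ltW t0)//; first by rewrite mulr_ge0.
      by apply: sumr_ge0 => i _; rewrite exprn_ge0.
    have h0' := ltW (h0 k).
    apply: addr_ge0; apply: mulr_ge0 => //; try exact: exprn_ge0.
    by apply: mulr_ge0 => //; exact: exprn_ge0.
  rewrite sub0r normrN ger0_norm// in uk; apply: le_trans uk.
  rewrite /E normrM [X in _ * X]ger0_norm ?invr_ge0 ?(ltW (h0 k))//.
  rewrite ler_pdivrMr//; apply: (le_trans (ler_norm_sum _ _ _)).
  apply: (@le_trans _ _ (\sum_(i < N k) h k * (16 * L * `|G k i.+1 - G k i| ^+ 3 +
      (16 * L ^+ 4 * h k ^+ 3 + L ^+ 3 * h k ^+ 2)))).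
    apply: ler_sum => i _; apply: derr_bound => //.
      have /andP[a1 a2] := grid_le t0 (N0 k) (hE k) (ltnW (ltn_ord i)).
      have /andP[b1 b2] := grid_le t0 (N0 k) (hE k) (ltn_ord i).
      apply: hunif; rewrite ?a1 ?b1//.
      by rewrite -natr1 mulrDl mul1r addrAC subrr add0r ger0_norm// ltW.
    have d1 := drk _ (ltn_ord i); have d2 := drk _ (ltnW (ltn_ord i)).
    apply: (le_trans (ln_lipschitz d0 d2 d1)).
    rewrite dr_recr addrAC subrr add0r normrM [`|h k * _|]ger0_norm; last first.
      by rewrite mulr_ge0 ?expR_ge0// ltW.
    rewrite /L -!mulrA ler_wpM2l// [leRHS]mulrC mulrA.
    rewrite [leLHS]mulrC mulrA; apply: ler_wpM2l.
      by rewrite mulr_ge0// ?invr_ge0 ltW.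
    rewrite ler_expR.
    have gM j : (j <= N k)%N -> G k j <= M.
      move=> jN; apply: (le_trans (ler_norm _)); apply: HM.
      exact: (grid_le t0 (N0 k) (hE k) jN).
    by have := gM _ (ltn_ord i); have := gM _ (ltnW (ltn_ord i)); lra.
  rewrite -mulr_sumr mulrC ler_pM2r// big_split /= -mulr_sumr -/(cubic_variation k).
  rewrite /u lerD2l sumr_const card_ord -mulr_natr -(hE k).
  by rewrite le_eqVlt; apply/orP; left; apply/eqP; ring.
have tt : 0 <= t <= t by rewrite lexx ltW.
have drc := @dr_idx_cvg c _ tt.
have gc := grid_idx_cvg tt.
have H : ((dr c (h k) (G k) (idx t k))^-1 *
    expR (c / 2 * (expR (2 * G k (idx t k)) / dr c (h k) (G k) (idx t k) - 1) - E k))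
    @[k --> \oo] --> Lam c (phi t) (expA phi t).
  rewrite /Lam -[X in _ * expR X]subr0; apply: cvgM.
    by apply: cvgV => //; rewrite gt_eqF.
  apply: continuous_cvg; first exact: continuous_expR.
  apply: cvgB => //; apply: cvgMr; apply: cvgB; last exact: cvg_cst.
  apply: cvgM; last by apply: cvgV => //; rewrite gt_eqF.
  apply: continuous_cvg; first exact: continuous_expR.
  by apply: cvgMr.
apply: cvg_trans H; apply: near_eq_cvg; near=> k.
rewrite idx_end prod_dwpos//; last first.
  move=> i iN; apply: lt_le_trans d0 _.
  by move: i iN; near: k.
rewrite /dv dr0 /grid mul0r phi0 mulr0 expR0 divr1.
by [].
Unshelve. all: by end_near. Qed.

End MeshLimit.

(** * The Borel sigma-algebra of the path space *)

Section PathSpaceBasics.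
Context {R : realType} (t : R).
Implicit Types (phi psi : cpath t).

Lemma extend_val phi (x : set_type `[0, t]) : extend phi (val x) = phi x.
Proof.
by rewrite -[RHS](congr1 (@^~ x) (valLK 0 (phi : set_type `[0, t] -> R))).
Qed.

Lemma extend_restr (f : R -> R) (cf : {within `[0, t], continuous f}) s :
  0 <= s <= t -> extend (restr cf) s = f s.
Proof.
move=> st; have sA : s \in `[0, t]%classic by rewrite inE /= in_itv.
by rewrite -[s]/(val (SigSub sA)) extend_val.
Qed.

Lemma cpath_eqP phi psi :
  (forall s, 0 <= s <= t -> extend phi s = extend psi s) -> phi = psi.
Proof.
move=> H; apply/continuousEP => x; rewrite -!extend_val; apply: H.
by have := valP x; rewrite inE /= in_itv.
Qed.

Lemma cpath_ballE phi (e : R) psi : ball phi e psi <->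
  forall s, 0 <= s <= t -> `|extend phi s - extend psi s| < e.
Proof.
split=> H.
  move=> s st; have sA : s \in `[0, t]%classic by rewrite inE /= in_itv.
  by rewrite -[s]/(val (SigSub sA)) !extend_val; exact: H.
move=> x; rewrite /ball/= -!extend_val; apply: H.
by have := valP x; rewrite inE /= in_itv.
Qed.

Lemma cpath_openP (U : set (cpath t)) : open U <->
  forall phi, U phi -> exists2 e : R, 0 < e & forall psi,
    (forall s, 0 <= s <= t -> `|extend phi s - extend psi s| < e) -> U psi.
Proof.
rewrite openE; split=> H.
  move=> phi /H; rewrite /interior => /nbhs_ballP[e /= e0 He].
  by exists e => // psi /cpath_ballE; exact: He.
move=> phi /H [e e0 He]; apply/nbhs_ballP; exists e => //= psi /cpath_ballE.
exact: He.
Qed.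

Lemma measurable_eval s : 0 <= s <= t ->
  measurable_fun [set: borel_cpath t] (fun phi : borel_cpath t => extend phi s).
Proof.
move=> st; apply: (@measurability _ _ (borel_cpath t) R setT _
  (@RGenInftyO.G R) (RGenInftyO.measurableE R)).
move=> _ [_ [a -> <-]]; rewrite setTI; apply: sub_sigma_algebra.
apply/cpath_openP => phi /=; rewrite in_itv/= => pa.
exists (a - extend phi s); first by rewrite subr_gt0.
move=> psi /(_ s st); rewrite /= in_itv/= ltr_norml => /andP[]; lra.
Qed.

Hypothesis t0 : 0 < t.

(** Sets of paths indexed by a countable set and each defined by countably
    many evaluations: at rational times, phi stays within 1 / (i.1.2 + 1) of
    the step function with steps of length 1 / i.1.1 and rational values i.2. *)
Definition ratbox (i : nat * nat * seq rat) : set (cpath t) :=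
  [set phi | forall r : rat, 0 <= (ratr r : R) <= t ->
    `|extend phi (ratr r) -
      ratr (nth 0%R i.2 (Num.truncn (ratr r * i.1.1%:R : R)))| <= (i.1.2.+1%:R^-1 : R)].

Lemma dense_close phi psi (e : R) :
  (forall r : rat, 0 <= (ratr r : R) <= t ->
     `|extend phi (ratr r) - extend psi (ratr r)| <= e) ->
  forall s : R, 0 <= s <= t -> `|extend phi s - extend psi s| <= e.
Proof.
move=> H s st; apply/ler_addgt0Pr => /= a a0.
have a2 : 0 < a / 2 by rewrite divr_gt0.
have [d1 d10 H1] := path_unif_continuous (@extend_continuous _ _ phi) a2.
have [d2 d20 H2] := path_unif_continuous (@extend_continuous _ _ psi) a2.
have [d d0 [dd1 dd2]] : exists2 d : R, 0 < d & d <= d1 /\ d <= d2.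
  by exists (Order.min d1 d2); [rewrite lt_min d10|rewrite !ge_min !lexx orbT].
have [r /andP[r1 r2] rs] : exists2 r : rat, 0 <= (ratr r : R) <= t & `|s - ratr r| < d.
  have : Order.max 0 (s - d) < Order.min t (s + d).
    by case/andP: st => s0 s1; rewrite gt_max !lt_min; apply/andP; split; apply/andP; split=> //; lra.
  move=> /rat_in_itvoo[r]; rewrite in_itv/= gt_max lt_min => /andP[/andP[A1 A2] /andP[A3 A4]].
  by exists r; [rewrite !ltW|rewrite ltr_norml; lra].
have rt : 0 <= (ratr r : R) <= t by rewrite r1.
have := H r rt; have := H1 s (ratr r) st rt; have := H2 s (ratr r) st rt.
move=> /(_ (lt_le_trans rs dd2)) B2 /(_ (lt_le_trans rs dd1)) B1 B3.
rewrite (_ : extend phi s - extend psi s = (extend phi s - extend phi (ratr r)) +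
  (extend phi (ratr r) - extend psi (ratr r)) - (extend psi s - extend psi (ratr r)));
  last by ring.
rewrite (le_trans (ler_normB _ _))// addrC.
rewrite (le_trans (lerD (ltW B2) (ler_normD _ _)))//; lra.
Qed.

(** Separability of the path space: a uniformly continuous path is close to
    a step function with rational values. *)
Lemma ratbox_cover (U : set (cpath t)) phi : open U -> U phi ->
  exists2 i, ratbox i `<=` U & ratbox i phi.
Proof.
move=> /cpath_openP oU /oU [e e0 He].
have [m me] : exists m : nat, 2 * m.+1%:R^-1 < e.
  exists (Num.truncn (2 / e)).
  rewrite ltr_pdivrMr// mulrC -ltr_pdivrMr//.
  exact: truncnS_gt.
pose a : R := m.+1%:R^-1 / 2.
have a0 : 0 < a by rewrite divr_gt0// invr_gt0.
have [d d0 Hd] := path_unif_continuous (@extend_continuous _ _ phi) a0.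
pose n := (Num.truncn (1 / d)).+1.
have nd : n%:R^-1 < d.
  rewrite -div1r ltr_pdivrMr ?ltr0n// mulrC -ltr_pdivrMr//.
  exact: truncnS_gt.
have n0 : (0 : R) < n%:R by rewrite ltr0n.
have qex (i : nat) : exists q : rat, `|extend phi (i%:R / n%:R) - ratr q| < a.
  have : extend phi (i%:R / n%:R) - a < extend phi (i%:R / n%:R) + a by lra.
  move=> /rat_in_itvoo[q]; rewrite in_itv/= => /andP[? ?].
  by exists q; rewrite ltr_norml; lra.
pose q i := projT1 (cid (qex i)).
have Hq i : `|extend phi (i%:R / n%:R) - ratr (q i)| < a by exact: projT2 (cid (qex i)).
(* The one extra value is for the step that starts at or before t. *)
pose l := mkseq q (Num.truncn (t * n%:R)).+1.
have box : ratbox (n, m, l) phi.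
  move=> r rt /=; set s : R := ratr r in rt *.
  have [s0 st] := andP rt.
  set i := Num.truncn (s * n%:R).
  have iN : (i < (Num.truncn (t * n%:R)).+1)%N.
    by rewrite ltnS; apply: le_truncn; rewrite ler_pM2r.
  rewrite nth_mkseq//.
  have := @truncn_itv R (s * n%:R); rewrite mulr_ge0 ?(ltW n0)// -/i.
  move=> /(_ isT)/andP[i1 i2].
  have is1 : i%:R / n%:R <= s by rewrite ler_pdivrMr.
  have i0 : 0 <= i%:R / n%:R :> R by rewrite divr_ge0// ltW.
  have : `|extend phi s - extend phi (i%:R / n%:R)| < a.
    apply: Hd => //; first by rewrite i0 (le_trans is1).
    rewrite ger0_norm ?subr_ge0//; apply: lt_trans nd.
    have : s < i.+1%:R / n%:R by rewrite ltr_pdivlMr.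
    by rewrite -natr1 mulrDl div1r ltrBlDl.
  have -> : m.+1%:R^-1 = a + a by rewrite /a; field.
  move=> B1; have B2 := Hq i.
  have := ler_distD (extend phi (i%:R / n%:R)) (extend phi s) (ratr (q i)).
  by move=> /le_trans; apply; rewrite lerD// ltW.
exists (n, m, l) => // psi boxpsi; apply: He => s st.
apply: le_lt_trans me; move: s st; apply: dense_close => r rt.
have := box r rt; have := boxpsi r rt => /=.
set z := ratr (nth _ _ _).
rewrite (_ : extend phi _ - extend psi _ = (extend phi (ratr r) - z) -
  (extend psi (ratr r) - z)); last by ring.
move=> B1 B2; apply: (le_trans (ler_normB _ _)).
by rewrite mulr_natl mulr2n lerD.
Qed.

(** By [ratbox_cover] an open set is a countable union of sets [ratbox]. *)
Lemma measurable_into_cpath d (T : measurableType d) (Phi : T -> cpath t) :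
  (forall s, 0 <= s <= t -> measurable_fun [set: T] (fun x => extend (Phi x) s)) ->
  measurable_fun [set: T] (Phi : T -> borel_cpath t).
Proof.
move=> mPhi; apply: (@measurability _ _ T (borel_cpath t) setT Phi (@open (cpath t))) => //.
move=> _ [U oU <-]; rewrite setTI.
pose F (i : nat * nat * seq rat) : set T :=
  if `[< ratbox i `<=` U >] then Phi @^-1` (ratbox i) else set0.
have -> : Phi @^-1` U = \bigcup_i F i.
  apply/seteqP; split => x /=.
    move=> /(ratbox_cover oU)[i iU ip]; exists i => //.
    by rewrite /F; case: asboolP.
  by move=> [i _]; rewrite /F; case: asboolP => // iU /iU.
apply: countable_bigcupT_measurable; first exact: countableP.
move=> i; rewrite /F; case: ifP => // _.
pose H (r : rat) : set T := if (0 <= (ratr r : R) <= t) then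
  [set x | `|extend (Phi x) (ratr r) -
      ratr (nth 0%R i.2 (Num.truncn (ratr r * i.1.1%:R : R)))| <= (i.1.2.+1%:R^-1 : R)]
  else setT.
have -> : Phi @^-1` ratbox i = ~` \bigcup_r ~` H r.
  rewrite setC_bigcup; apply/seteqP; split => x /=.
    by move=> bx r _; rewrite setCK /H; case: ifP => // rt; exact: bx.
  by move=> Hx r rt; have := Hx r I; rewrite setCK /H rt.
apply: measurableC; apply: bigcupT_measurable_rat => r; apply: measurableC.
rewrite /H; case: ifP => // rt; rewrite -[X in measurable X]setTI.
have mf : measurable_fun [set: T] (fun x => `|extend (Phi x) (ratr r) -
      ratr (nth 0%R i.2 (Num.truncn (ratr r * i.1.1%:R : R)))|).
  apply: (measurableT_comp (@normr_measurable R setT)); meas; exact: mPhi.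
have := mf measurableT `]-oo, (i.1.2.+1%:R^-1 : R)]%classic
  (measurable_itv _).
by congr (measurable (_ `&` _)); apply/seteqP; split => x /=; rewrite in_itv.
Qed.

Definition cylinder_set : set (set (borel_cpath t)) :=
  [set A | exists m (s a : nat -> R), (forall j, 0 <= s j <= t) /\
    A = [set phi : borel_cpath t | forall j, (j < m)%N -> extend phi (s j) < a j]].

Lemma cylinder_setI : setI_closed cylinder_set.
Proof.
move=> _ _ [m1 [s1 [a1 [H1 ->]]]] [m2 [s2 [a2 [H2 ->]]]].
exists (m1 + m2)%N, (fun j => if (j < m1)%N then s1 j else s2 (j - m1)%N),
  (fun j => if (j < m1)%N then a1 j else a2 (j - m1)%N).
split; first by move=> j; case: ifP.
apply/seteqP; split => phi /=.
  move=> [A1 A2] j jm; case: ifP => jm1; first exact: A1.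
  by apply: A2; rewrite ltn_subLR// leqNgt jm1.
move=> H; split=> j jm.
  by have := H j (ltn_addr _ jm); rewrite jm.
have := H (m1 + j)%N; rewrite ltn_add2l => /(_ jm).
by rewrite ltnNge leq_addr /= addKn.
Qed.

Lemma cylinder_measurable : cylinder_set `<=` measurable.
Proof.
move=> _ [m [s [a [H ->]]]].
rewrite (_ : [set _ | _] = \bigcap_(j < m)
    [set phi : borel_cpath t | extend phi (s j) < a j]); last first.
  by apply/seteqP; split => phi.
apply: bigcap_measurableType => j _; rewrite -[X in measurable X]setTI.
have := measurable_eval (H j) measurableT (measurable_itv `]-oo, a j[).
by congr (measurable (_ `&` _)); apply/seteqP; split => x /=; rewrite in_itv.
Qed.

Lemma cylinder_generates :
  @measurable _ (borel_cpath t) `<=` <<s cylinder_set >>.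
Proof.
pose T : measurableType _ := g_sigma_algebraType cylinder_set.
have mid : measurable_fun [set: T] (id : T -> borel_cpath t).
  apply: measurable_into_cpath => s st.
  apply: (@measurability _ _ T R setT _ (@RGenInftyO.G R) (RGenInftyO.measurableE R)).
  move=> _ [_ [a -> <-]]; rewrite setTI; apply: sub_sigma_algebra.
  exists 1%N, (fun=> s), (fun=> a); split => //.
  apply/seteqP; split => x /=; rewrite in_itv/=; first by move=> ? [].
  by move=> /(_ 0%N); exact.
by move=> A mA; have := mid measurableT A mA; rewrite setTI.
Qed.

(** Continuous functions increasing with k to the indicator of ]-oo, a[. *)
Definition ramp (a : R) (k : nat) (y : R) : R :=
  Order.min 1 (Order.max 0 (k%:R * (a - y))).

Lemma ramp01 a k y : 0 <= ramp a k y <= 1.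
Proof. by rewrite /ramp le_min ler01/= le_max lexx/= ge_min lexx. Qed.

Lemma ramp_continuous a k : continuous (ramp a k).
Proof.
move=> y; apply: (@continuous_min _ _ (cst 1) _ y); first exact: cvg_cst.
apply: (@continuous_max _ _ (cst 0) _ y); first exact: cvg_cst.
apply: cvgMr; apply: cvgB; [exact: cvg_cst|exact: cvg_id].
Qed.

Lemma ramp_nd a y : nondecreasing_seq (fun k => ramp a k y).
Proof.
move=> k l kl; apply: le_min2 => //; have [ya|ya] := leP 0 (a - y).
  by apply: le_max2 => //; rewrite ler_wpM2r// ler_nat.
by rewrite ge_max !le_max lexx/= mulr_ge0_le0// ltW.
Qed.

Lemma ramp_cvg a y : ramp a k y @[k --> \oo] --> ((y < a)%R%:R : R).
Proof.
have [ya|ay] := ltP y a; last first.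
  rewrite (_ : (fun k => ramp a k y) = fun=> 0); first exact: cvg_cst.
  apply/funext => k; rewrite /ramp (_ : Order.max _ _ = 0).
    by apply/min_idPr; rewrite ler01.
  by apply/max_idPl; rewrite mulr_ge0_le0// subr_le0.
apply: cvg_near_cst; near=> k; rewrite /ramp; apply/min_idPl.
rewrite le_max; apply/orP; right; rewrite -ler_pdivrMr ?subr_gt0// mul1r.
near: k; exact: nbhs_infty_ger.
Unshelve. all: by end_near. Qed.

Lemma cvg_prod_ord m (u : nat -> nat -> R) (v : nat -> R) :
  (forall j, u j k @[k --> \oo] --> v j) ->
  \prod_(j < m) u j k @[k --> \oo] --> \prod_(j < m) v j.
Proof.
move=> uv; elim: m => [|m IH].
  by rewrite big_ord0; under eq_fun do rewrite big_ord0; exact: cvg_cst.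
by rewrite big_ord_recr; under eq_fun do rewrite big_ord_recr; exact: cvgM.
Qed.

Lemma measurable_cylinder_prod m (s : nat -> R) (f : nat -> R -> R) :
  (forall j, 0 <= s j <= t) -> (forall j, continuous (f j)) ->
  measurable_fun [set: borel_cpath t]
    (fun phi : borel_cpath t => \prod_(j < m) f j (extend phi (s j))).
Proof.
move=> st cf; apply: measurable_prod => j _.
apply: measurableT_comp; last exact: measurable_eval.
exact: continuous_measurable_fun.
Qed.

Local Open Scope ereal_scope.

(** Ramps recover the measure of the sets cut out by finitely many
    evaluations, and these sets form a pi-system generating the Borel sets. *)
Lemma cpath_measure_unique (m1 m2 : {measure set (borel_cpath t) -> \bar R}) :
  m1 setT < +oo ->
  (forall m (s : nat -> R) (f : nat -> R -> R), (forall j, 0 <= s j <= t)%R ->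
     (forall j, continuous (f j)) -> (forall j y, 0 <= f j y <= 1)%R ->
   \int[m1]_phi (\prod_(j < m) f j (extend phi (s j)))%:E =
   \int[m2]_phi (\prod_(j < m) f j (extend phi (s j)))%:E) ->
  forall A, measurable A -> m1 A = m2 A.
Proof.
move=> m1oo H A mA.
apply: (@g_sigma_algebra_measure_unique _ R _ cylinder_set _ (fun=> setT)) => //.
- exact: cylinder_measurable.
- by move=> _; exists 0%N, (fun=> 0%R), (fun=> 0%R); split => [_|];
    [rewrite lexx ltW|apply/seteqP; split].
- by rewrite bigcup_const//; exists 0%N.
- exact: cylinder_setI.
- move=> _ [m [s [a [st ->]]]].
  set C := [set _ | _].
  have mC : measurable C by apply: cylinder_measurable; exists m, s, a.
  have key (mm : {measure set (borel_cpath t) -> \bar R}) :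
      (\int[mm]_phi (\prod_(j < m) ramp (a j) k (extend phi (s j)))%:E)
        @[k --> \oo] --> mm C.
    have -> : mm C = \int[mm]_phi (\prod_(j < m) ((extend phi (s j) < a j)%R%:R : R))%:E.
      rewrite -(setIT C) -integral_indic//; apply: eq_integral => phi _.
      rewrite indicE; congr (_%:E); have [phiC|phiC] := boolP (phi \in C).
        by rewrite big1// => j _; move: phiC; rewrite inE => ->.
      apply/esym; apply/eqP; rewrite prodf_seq_eq0; apply/hasP.
      have : ~ forall j : 'I_m, (extend phi (s j) < a j)%R.
        move=> Hj; move/negP: phiC; apply; rewrite inE => j jm.
        exact: (Hj (Ordinal jm)).
      move=> /existsNP[j /negP jN]; exists j; first by rewrite mem_index_enum.
      by rewrite (negbTE jN)/=.
    rewrite [X in _ --> X](_ : _ = \int[mm]_phi limn (fun k =>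
        (\prod_(j < m) ramp (a j) k (extend phi (s j)))%:E)); last first.
      apply: eq_integral => phi _; apply/esym/cvg_lim => //.
      apply: cvg_EFin; first exact: nearW.
      by apply: (@cvg_prod_ord m (fun j k => ramp (a j) k (extend phi (s j)))
        (fun j => (extend phi (s j) < a j)%R%:R)) => j; exact: ramp_cvg.
    apply: cvg_monotone_convergence => //.
    - move=> k; apply: measurable_fun_EFin.
      apply: (@measurable_cylinder_prod m s (fun j => ramp (a j) k)) => // j.
      exact: ramp_continuous.
    - move=> k phi _; rewrite lee_fin prodr_ge0// => j _.
      by case/andP: (ramp01 (a j) k (extend phi (s j))).
    - move=> phi _ k l kl; rewrite lee_fin ler_prod// => j _.
      by have /andP[-> _] := ramp01 (a j) k (extend phi (s j)); exact: ramp_nd.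
  transitivity (limn (fun k => \int[m1]_phi
      (\prod_(j < m) ramp (a j) k (extend phi (s j)))%:E)).
    by apply/esym/cvg_lim => //; exact: key.
  apply/cvg_lim => //.
  rewrite (_ : (fun k => _) = (fun k => \int[m2]_phi
      (\prod_(j < m) ramp (a j) k (extend phi (s j)))%:E)); first exact: key.
  apply/funext => k; apply: (H m s (fun j => ramp (a j) k)) => //.
  - by move=> j; exact: ramp_continuous.
  - by move=> j y; exact: ramp01.
- exact: cylinder_generates.
Qed.

End PathSpaceBasics.

(** * Refining meshes and a one-sided Fatou comparison *)

Section Mesh.
Context {R : realType} (t : R).
Hypothesis t0 : 0 < t.

(** The factor 4 halves the square root of the mesh at each refinement; the
    expected cubic variation, of the order of this root, is then summable. *)
Definition mesh k : R := t / (4 ^ k)%:R.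

Lemma pow4_gt0 k : (0 < 4 ^ k)%N. Proof. by rewrite expn_gt0. Qed.

Lemma meshE k : mesh k * (4 ^ k)%:R = t.
Proof. by rewrite /mesh mulfVK// pnatr_eq0 -lt0n pow4_gt0. Qed.

Lemma mesh_gt0 k : 0 < mesh k.
Proof. by rewrite /mesh divr_gt0// ltr0n pow4_gt0. Qed.

Lemma mesh_cvg : mesh k @[k --> \oo] --> (0 : R).
Proof.
rewrite -[X in _ --> X](mulr0 t); apply: cvgMr.
rewrite (_ : (fun k => _) = (fun k => (4^-1 : R) ^+ k)); last first.
  by apply/funext => k; rewrite natrX exprVn.
by apply: cvg_expr; rewrite ger0_norm// invf_lt1// ltr1n.
Qed.

Lemma measurable_expA d (T : measurableType d) (Y : T -> R -> R) s :
  (forall x, {within `[0, t], continuous (Y x)}) ->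
  (forall u, 0 <= u <= t -> measurable_fun [set: T] (Y ^~ u)) ->
  0 <= s <= t -> measurable_fun [set: T] (fun x => expA (Y x) s).
Proof.
move=> cY mY st.
apply: (@measurable_fun_cvg _ T R setT
  (fun k x => dA (mesh k) (grid (Y x) (mesh k)) (idx mesh s k))).
  move=> k; rewrite /dA; apply: measurable_sum => i; rewrite /grid.
  have iN : (idx mesh s k <= 4 ^ k)%N.
    by apply: (@idx_le R t t0 (fun k => 4 ^ k)%N mesh pow4_gt0 meshE); case/andP: st.
  have gt j : (j <= 4 ^ k)%N -> 0 <= j%:R * mesh k <= t.
    exact: (grid_le t0 (pow4_gt0 k) (meshE k)).
  meas; apply: mY; apply: gt; rewrite (leq_trans _ iN)//; exact: ltnW.
move=> x _; exact: (dA_idx_cvg t0 (cY x) pow4_gt0 meshE mesh_cvg st).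
Qed.

End Mesh.

Section FatouComparison.
Context d (T : measurableType d) (R : realType) (mu : {finite_measure set T -> \bar R}).
Local Open Scope ereal_scope.

(** A passage to the limit in an inequality of integrals in which only the
    larger side is dominated.  Truncating [u k] at [min (u', K)] makes the
    smaller side bounded as well, and K then increases to infinity.  Where
    u' vanishes, nothing has to be known about the limit of [u k]. *)
Lemma fatou_compare (u v : nat -> T -> R) (u' v' : T -> R) (M : R) :
  (forall k, measurable_fun [set: T] (u k)) -> measurable_fun [set: T] u' ->
  (forall k, measurable_fun [set: T] (v k)) -> measurable_fun [set: T] v' ->
  (forall k x, 0 <= u k x)%R -> (forall k x, 0 <= v k x <= M)%R ->
  (forall x, 0 <= u' x)%R ->
  (forall k, \int[mu]_x (u k x)%:E <= \int[mu]_x (v k x)%:E) ->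
  {ae mu, forall x, u' x = 0%R \/ u k x @[k --> \oo] --> u' x} ->
  {ae mu, forall x, v k x @[k --> \oo] --> v' x} ->
  \int[mu]_x (u' x)%:E <= \int[mu]_x (v' x)%:E.
Proof.
move=> mu_ mu' mv mv' u0 v0 u'0 uv cu cv.
have muE k : measurable_fun [set: T] (fun x => (u k x)%:E) by exact: measurable_fun_EFin.
have mvE k : measurable_fun [set: T] (fun x => (v k x)%:E) by exact: measurable_fun_EFin.
have bounded_cvg (f : nat -> T -> R) (f' : T -> R) (K : R) :
    (forall k, measurable_fun [set: T] (f k)) -> measurable_fun [set: T] f' ->
    (forall k x, 0 <= f k x <= K)%R ->
    {ae mu, forall x, f k x @[k --> \oo] --> f' x} ->
    \int[mu]_x (f k x)%:E @[k --> \oo] --> \int[mu]_x (f' x)%:E.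
  move=> mf mf' f0 cf.
  have [] := @dominated_convergence _ T R mu setT measurableT
    (fun k x => (f k x)%:E) (EFin \o f') (EFin \o cst K) => //.
  - by move=> k; exact: measurable_fun_EFin.
  - exact: measurable_fun_EFin.
  - apply: filterS cf => x cx _; apply: cvg_EFin; first exact: nearW.
    exact: cx.
  - exact: finite_measure_integrable_cst.
  - apply: nearW => x k _ /=; have /andP[f1 f2] := f0 k x.
    by rewrite lee_fin ger0_norm.
have vcvg := bounded_cvg v v' M mv mv' v0 cv.
have trunc (K : R) : (0 <= K)%R ->
    \int[mu]_x (Order.min (u' x) K)%:E <= \int[mu]_x (v' x)%:E.
  move=> K0.
  have mmin (f g : T -> R) : measurable_fun [set: T] f ->
      measurable_fun [set: T] g ->
      measurable_fun [set: T] (fun x => Order.min (f x) (g x)).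
    exact: measurable_minr.
  have mu'K : measurable_fun [set: T] (fun x => Order.min (u' x) K).
    by apply: mmin => //; exact: measurable_cst.
  have ucvg : \int[mu]_x (Order.min (u k x) (Order.min (u' x) K))%:E @[k --> \oo]
      --> \int[mu]_x (Order.min (u' x) K)%:E.
    apply: (bounded_cvg (fun k x => Order.min (u k x) (Order.min (u' x) K)) _ K) => //.
    - by move=> k; exact: mmin.
    - move=> k x; rewrite !le_min u0 u'0 K0 /=.
      by rewrite !ge_min lexx !orbT.
    - apply: filterS cu => x [->|cx].
        rewrite (min_l K0) (_ : (fun k => _) = fun=> 0%R); first exact: cvg_cst.
        by apply/funext => k; rewrite min_r.
      have {2}-> : Order.min (u' x) K = Order.min (u' x) (Order.min (u' x) K).
        by rewrite minA minxx.
      by apply: (@cvg_comp _ _ _ (fun k => u k x)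
        (fun y => Order.min y (Order.min (u' x) K)) _ _ _ cx);
        apply: (@continuous_min R R id (cst _)); [exact: cvg_id|exact: cvg_cst].
  rewrite -(cvg_lim _ ucvg)// -(cvg_lim _ vcvg)//; apply: lee_lim.
  - by apply/cvg_ex; eexists; exact: ucvg.
  - by apply/cvg_ex; eexists; exact: vcvg.
  - apply: nearW => k; apply: le_trans (uv k); apply: ge0_le_integral => //.
    + by move=> x _; rewrite lee_fin !le_min u0 u'0.
    + by apply: measurable_fun_EFin; exact: mmin.
    + by move=> x _; rewrite lee_fin ge_min lexx.
have mK k : measurable_fun [set: T] (fun x => (Order.min (u' x) k%:R)%:E).
  by apply: measurable_fun_EFin; apply: measurable_minr => //; exact: measurable_cst.
have umono : \int[mu]_x (Order.min (u' x) k%:R)%:E @[k --> \oo] -->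
    \int[mu]_x (u' x)%:E.
  rewrite [X in _ --> X](_ : _ = \int[mu]_x limn (fun k : nat =>
      (Order.min (u' x) k%:R)%:E)); last first.
    apply: eq_integral => x _; apply/esym/cvg_lim => //.
    apply: cvg_near_cst; near=> k; congr (_%:E); apply/min_idPl.
    near: k; exact: nbhs_infty_ger.
  apply: cvg_monotone_convergence => //.
  - by move=> k x _; rewrite lee_fin le_min u'0/=.
  - by move=> x _ k l kl; rewrite lee_fin le_min2// ler_nat.
apply: (cvge_to_le umono); apply: nearW => k.
exact: trunc.
Unshelve. all: by end_near. Qed.

End FatouComparison.

(** * The third absolute moment of a Gaussian variable *)

Section GaussianMoment.
Context {R : realType}.

(** From u^3 <= 1 + u^4 and v^2 / 4 <= exp v with v = u^2 / 4, which gives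
    the constant 1 + 64. *)
Lemma cube_le_expR (u : R) : 0 <= u -> u ^+ 3 <= 65 * expR (u ^+ 2 / 4).
Proof.
move=> u0; pose v := u ^+ 2 / 4.
have v0 : 0 <= v by rewrite divr_ge0// sqr_ge0.
have e1 : 1 <= expR v by rewrite -expR0 ler_expR.
have e2 : v / 2 <= expR (v / 2).
  by rewrite (le_trans _ (expR_ge1Dx _))// lerDr.
have e3 : (v / 2) ^+ 2 <= expR v.
  rewrite [X in expR X](_ : v = v / 2 * 2%:R); last by rewrite mulfVK.
  by rewrite expRM_natr lerXn2r// nnegrE ?expR_ge0// divr_ge0.
have e4 : u ^+ 3 <= 1 + u ^+ 4.
  have [u1|u1] := leP u 1.
    have : u ^+ 3 <= 1 by rewrite exprn_ile1.
    have : 0 <= u ^+ 4 by rewrite exprn_ge0.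
    by move=> ? ?; lra.
  have : u ^+ 3 <= u ^+ 4 by rewrite ler_weXn2l// ltW.
  by move=> ?; lra.
have e5 : u ^+ 4 = 64 * (v / 2) ^+ 2 by rewrite /v; field.
by rewrite -/v; lra.
Qed.

Local Open Scope ereal_scope.

(** The factor exp (y^2 / (4 h)) supplied by [cube_le_expR] turns the
    Gaussian density of variance h into that of variance 2 h, up to the ratio
    of their normalizing constants, which is at most 2. *)
Lemma gaussian_third_moment (h : R) : (0 < h)%R ->
  \int[gaussian h]_y (`|y| ^+ 3)%:E <= (130 * (h * Num.sqrt h))%:E.
Proof.
move=> h0; pose s := Num.sqrt h; have s0 : (0 < s)%R by rewrite sqrtr_gt0.
have sE : (s ^+ 2 = h)%R by rewrite sqr_sqrtr// ltW.
have h20 : (0 < 2 * h)%R by rewrite mulr_gt0.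
have mabs : measurable_fun [set: R] (fun y : R => (`|y| ^+ 3)%:E).
  by meas; exact: measurableT_comp.
have peak_le : (normal_peak s <= 2 * normal_peak (Num.sqrt (2 * h)))%R.
  rewrite /normal_peak sE sqr_sqrtr ?(ltW h20)//; set a := (h * pi *+ 2)%R.
  have a0 : (0 < a)%R by rewrite mulrn_wgt0// mulr_gt0// pi_gt0.
  have -> : (2 * h * pi *+ 2 = 2 * a)%R by rewrite /a mulrnAr mulrA.
  have sa : (0 < Num.sqrt a)%R by rewrite sqrtr_gt0.
  have s2a : (0 < Num.sqrt (2 * a))%R by rewrite sqrtr_gt0 mulr_gt0.
  rewrite ler_pdivlMr// mulrC ler_pdivrMr//.
  have -> : (2 * Num.sqrt a = Num.sqrt (4 * a))%R.
    by rewrite sqrtrM// (_ : 4 = 2 ^+ 2)%R ?sqrtr_sqr ?ger0_norm// -natrX.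
  by rewrite ler_sqrt ?mulr_gt0//; lra.
have mexp (e : R) : measurable_fun [set: R] (fun y : R => expR (y ^+ 2 / e)).
  by meas.
rewrite integral_gaussian//.
have -> : (130 * (h * s))%:E = (130 * (h * s))%:E * \int[gaussian (2 * h)]_y (cst 1 y).
  rewrite integral_cst//.
  rewrite [X in _ * (_ * X)](_ : _ = 1) ?mule1//.
  exact: (@probability_setT _ _ _ (gaussian (2 * h))).
rewrite (@integral_gaussian _ (2 * h)%R (cst 1))//.
rewrite -ge0_integralZl_EFin//; last 3 first.
- by move=> y _; rewrite mul1e lee_fin mulr_ge0 ?expR_ge0// normal_peak_ge0.
- by meas.
- by rewrite mulr_ge0// mulr_ge0// ltW.
apply: ge0_le_integral => //.
- by move=> y _; rewrite mule_ge0// lee_fin// mulr_ge0 ?expR_ge0// normal_peak_ge0.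
- by meas; exact: measurableT_comp.
- by meas.
move=> y _; rewrite mul1e -!EFinM lee_fin.
have c3 : (`|y| ^+ 3 <= 65 * (h * s) * expR (y ^+ 2 / (4 * h)))%R.
  have : (0 <= `|y| / s)%R by rewrite divr_ge0 ?(ltW s0).
  move=> /cube_le_expR.
  rewrite !expr_div_n real_normK ?num_real// sE ler_pdivrMr ?exprn_gt0//.
  move=> /le_trans; apply.
  have -> : (y ^+ 2 / h / 4 = y ^+ 2 / (4 * h))%R by rewrite invfM mulrA mulrAC -mulrA.
  by rewrite (exprSr s 2) sE le_eqVlt; apply/orP; left; apply/eqP; ring.
have -> : (130 * (h * s) * (normal_peak (Num.sqrt (2 * h)) *
    expR (- y ^+ 2 / (2 * (2 * h)))) = (65 * (h * s) * expR (y ^+ 2 / (4 * h))) *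
    ((2 * normal_peak (Num.sqrt (2 * h))) * expR (- y ^+ 2 / (2 * h))))%R.
  have -> : (- y ^+ 2 / (2 * (2 * h)) = y ^+ 2 / (4 * h) + - y ^+ 2 / (2 * h))%R.
    by field; rewrite gt_eqF.
  by rewrite expRD; ring.
apply: ler_pM => //.
  by rewrite mulr_ge0 ?expR_ge0// normal_peak_ge0.
by rewrite ler_wpM2r ?expR_ge0.
Qed.

End GaussianMoment.

(** * Brownian motion on the grid *)

Section SummableExpectation.
Context d (T : measurableType d) (R : realType) (mu : {measure set T -> \bar R}).
Local Open Scope ereal_scope.

(** The sum of the series has finite integral, hence is finite almost
    everywhere. *)
Lemma summable_integral_cvg0 (f : nat -> T -> R) (a q : R) :
  (forall k, measurable_fun [set: T] (f k)) -> (forall k x, 0 <= f k x)%R ->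
  (0 <= q < 1)%R -> (0 <= a)%R -> (forall k, \int[mu]_x (f k x)%:E <= (a * q ^+ k)%:E) ->
  {ae mu, forall x, f k x @[k --> \oo] --> 0%R}.
Proof.
move=> mf f0 /andP[q0 q1] a0 fa.
have mfE k : measurable_fun [set: T] (fun x => (f k x)%:E) by exact: measurable_fun_EFin.
pose S x := \sum_(k <oo) (f k x)%:E.
have S0 x : 0 <= S x by apply: nneseries_ge0 => k _ _; rewrite lee_fin.
have mS : measurable_fun [set: T] S.
  by apply: ge0_emeasurable_sum => // k x _ _; rewrite lee_fin.
have q1' : (0 < 1 - q)%R by rewrite subr_gt0.
have iS : mu.-integrable setT S.
  apply/integrableP; split=> //.
  under eq_integral do rewrite gee0_abs//.
  rewrite integral_nneseries//; last by move=> k x _; rewrite lee_fin.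
  apply: (@le_lt_trans _ _ (a / (1 - q))%:E); last exact: ltry.
  apply: lime_le.
    by apply: is_cvg_nneseries => k _ _; apply: integral_ge0 => x _; rewrite lee_fin.
  apply: nearW => n.
  apply: (@le_trans _ _ (\sum_(0 <= k < n) (a * q ^+ k)%:E)).
    exact: lee_sum.
  rewrite sumEFin lee_fin.
  have := @geometric_seriesE _ a q; rewrite lt_eqF// => /(_ isT)/(congr1 (@^~ n)) /=.
  rewrite /series /geometric/= => ->.
  by rewrite ler_pM2r ?invr_gt0// ler_piMr// gerBl exprn_ge0.
have := integrable_ae measurableT iS; apply: filterS => x /(_ I) fS.
apply: cvg_series_cvg_0; apply: nondecreasing_is_cvgn.
  by apply/nondecreasing_seqP => n; rewrite /series/= big_nat_recr//= lerDl.
exists (fine (S x)) => _ [n _ <-].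
rewrite -lee_fin fineK// /series/= -sumEFin.
by apply: nneseries_lim_ge => k _; rewrite lee_fin.
Qed.

End SummableExpectation.

Section BrownianGrid.
Context d (Omega : measurableType d) (R : realType) (P : probability Omega R).
Variables (B : R -> Omega -> R) (hB : standard_brownian_motion P B) (t : R).
Hypothesis t0 : 0 < t.

(** The process starts at 0 only almost surely; subtracting its initial
    value gives a path that starts at 0 for each outcome. *)
Definition recentred (w : Omega) (s : R) : R := B s w - B 0 w.

Definition incr k i (w : Omega) : R :=
  B (i.+1%:R * mesh t k) w - B (i%:R * mesh t k) w.

Lemma recentred_continuous w : {within `[0, t], continuous (recentred w)}.
Proof.
move=> s; apply: cvgB; last exact: cvg_cst.
exact: (@bm_continuous_itv _ _ _ _ _ hB t w s).
Qed.

Lemma measurable_recentred s : 0 <= s ->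
  measurable_fun [set: Omega] (fun w => recentred w s).
Proof. by move=> s0; apply: measurable_funB; apply: (bm_measurable hB). Qed.

Let node_ge0 k i : 0 <= i%:R * mesh t k.
Proof. by rewrite mulr_ge0// ltW// mesh_gt0. Qed.

Lemma measurable_incr k i : measurable_fun [set: Omega] (incr k i).
Proof. by apply: measurable_funB; apply: (bm_measurable hB). Qed.

Lemma incr_independent k n : independent_RVs P (fun i : 'I_n => incr k i).
Proof.
apply: (bm_independent_increments hB (s := fun i => i%:R * mesh t k)) => //.
by move=> i j ij; rewrite ler_wpM2r ?ler_nat// ltW// mesh_gt0.
Qed.

Lemma incr_gaussian k i A : measurable A ->
  P (incr k i @^-1` A) = gaussian (mesh t k) A.
Proof.
move=> mA.
have lt_node : i%:R * mesh t k < i.+1%:R * mesh t k.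
  by rewrite ltr_pM2r ?mesh_gt0// ltr_nat.
have gapE : i.+1%:R * mesh t k - i%:R * mesh t k = mesh t k.
  by rewrite -mulrBl -natrB// subSnn mul1r.
have := bm_gaussian_increments hB (node_ge0 k i) lt_node mA.
by rewrite gapE.
Qed.

Lemma walk_incr k w : walk (incr k) w = grid (recentred w) (mesh t k).
Proof.
apply/funext => n; rewrite /walk /grid /recentred; elim: n => [|n IH].
  by rewrite big_ord0 mul0r subrr.
by rewrite big_ord_recr/= IH /incr; ring.
Qed.

(** There are 4^k increments, of third moment at most 130 (t / 4^k)^(3/2)
    each, so the expectations decrease like 2^(- k). *)
Lemma cubic_variation_cvg0 : {ae P, forall w,
  cubic_variation (recentred w) (fun k => 4 ^ k)%N (mesh t) k @[k --> \oo] --> (0 : R)}.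
Proof.
pose st := Num.sqrt t.
have smesh k : Num.sqrt (mesh t k) = st * 2^-1 ^+ k.
  rewrite /mesh sqrtrM ?(ltW t0)//; congr (_ * _).
  rewrite -[RHS]ger0_norm ?exprn_ge0// -sqrtr_sqr; congr Num.sqrt.
  by rewrite natrX -exprVn -exprM mulnC exprM; congr (_ ^+ _); rewrite exprVn -natrX.
apply: (@summable_integral_cvg0 _ _ _ P _ (130 * (t * st)) (2^-1)).
- move=> k; rewrite /cubic_variation; apply: measurable_sum => i.
  apply: measurable_funX; apply: measurableT_comp => //.
  by apply: measurable_funB; exact: measurable_recentred.
- by move=> k w; apply: sumr_ge0 => i _; rewrite exprn_ge0.
- by rewrite invr_ge0 ler0n/= invf_lt1// ltr1n.
- by rewrite !mulr_ge0// ?sqrtr_ge0// ltW.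
move=> k.
have E3 i : (\int[P]_w (`|incr k i w| ^+ 3)%:E <=
    (130 * (mesh t k * Num.sqrt (mesh t k)))%:E)%E.
  apply: le_trans (gaussian_third_moment (mesh_gt0 t0 k)).
  rewrite -(@integral_image_measure _ _ _ _ _ _ (measurable_incr k i) P
    (fun y => (`|y| ^+ 3)%:E))//; last by meas; exact: measurableT_comp.
  by rewrite (eq_measure_integral (gaussian (mesh t k)))// => A mA _; exact: incr_gaussian.
rewrite /cubic_variation.
under eq_integral do rewrite -sumEFin.
rewrite ge0_integral_sum//.
- rewrite (@le_trans _ _ (\sum_(i < 4 ^ k) (130 * (mesh t k * Num.sqrt (mesh t k)))%:E)%E)//.
    apply: lee_sum => i _; apply: le_trans (E3 i); rewrite le_eqVlt; apply/orP; left.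
    apply/eqP; apply: eq_integral => w _; congr ((`|_| ^+ 3)%:E).
    by rewrite /grid /recentred /incr; ring.
  rewrite sumEFin lee_fin sumr_const card_ord smesh.
  have tE := meshE t k; rewrite -[X in _ <= X](_ : 130 * (mesh t k * (4 ^ k)%:R * st) * 2^-1 ^+ k = _).
    by rewrite -mulr_natr le_eqVlt; apply/orP; left; apply/eqP; ring.
  by rewrite tE.
- move=> i; meas; apply: measurableT_comp => //.
  by apply: measurable_funB; exact: measurable_recentred.
Qed.

End BrownianGrid.

(** * Quasi-invariance tested on cylinder functions *)

Section KeyIdentity.
Context d (Omega : measurableType d) (R : realType) (P : probability Omega R).
Variables (B : R -> Omega -> R) (hB : standard_brownian_motion P B) (t : R).
Hypothesis t0 : 0 < t.
Variable c : R.
Hypothesis c0 : 0 < c.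
Variables (m : nat) (s : nat -> R) (f : nat -> R -> R).
Hypothesis st : forall j, 0 <= s j <= t.
Hypothesis cf : forall j, continuous (f j).
Hypothesis f01 : forall j y, 0 <= f j y <= 1.

Local Notation W := (recentred B).
Local Notation A w := (expA (recentred B w)).
Local Notation h := (mesh t).
Local Notation G k w := (grid (recentred B w) (mesh t k)).
Local Notation l j k := (idx (mesh t) (s j) k).

Lemma prod_pick n (p : nat -> nat) (y : nat -> nat -> R) :
  (forall j, (p j <= n)%N) ->
  \prod_(i < n.+1) \prod_(j < m) (if i == p j :> nat then y j i else 1) =
  \prod_(j < m) y j (p j).
Proof.
move=> pn; rewrite exchange_big /=; apply: eq_bigr => j _.
rewrite (bigD1 (inord (p j)))//= inordK ?ltnS// eqxx big1 ?mulr1// => i.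
move=> /eqP ne; case: eqP => // ij; case: ne; apply: val_inj.
by rewrite /= inordK ?ltnS.
Qed.

Let len j k : (l j k <= 4 ^ k)%N.
Proof.
by apply: (idx_le t0 (pow4_gt0) (meshE t)); case/andP: (st j).
Qed.

Let cW w := @recentred_continuous _ _ _ _ _ hB t w.
Arguments cW : clear implicits.

Lemma prod_f01 (y : nat -> R) : 0 <= \prod_(j < m) f j (y j) <= 1.
Proof.
apply/andP; split; first by apply: prodr_ge0 => j _; case/andP: (f01 j (y j)).
by apply: prodr_ile1 => j _; exact: f01.
Qed.

Lemma prod_f_cvg (y : nat -> nat -> R) (y' : nat -> R) :
  (forall j, y j k @[k --> \oo] --> y' j) ->
  \prod_(j < m) f j (y j k) @[k --> \oo] --> \prod_(j < m) f j (y' j).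
Proof.
move=> yy; apply: (@cvg_prod_ord R m (fun j k => f j (y j k)) (fun j => f j (y' j))) => j.
apply: (@cvg_comp _ _ _ (y j) (f j) _ _ _ (yy j)); exact: cf.
Qed.

Lemma measurable_prod_f d' (T : measurableType d') (y : nat -> T -> R) :
  (forall j, measurable_fun [set: T] (y j)) ->
  measurable_fun [set: T] (fun x => \prod_(j < m) f j (y j x)).
Proof.
move=> my; apply: measurable_prod => j _; apply: measurableT_comp => //.
exact: continuous_measurable_fun.
Qed.

(** Test functions for [discrete_identity]: at step i only the factors
    [f j] whose time s_j falls on grid point i are present. *)
Definition pickX k (i : nat) (z : R * R) : R :=
  \prod_(j < m) (if i == l j k then f j z.1 else 1).

(** The same test functions applied to z.1 - ln z.2, which is the original
    walk when z is the transformed walk with its reciprocal denominator, and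
    the transformed walk when z is the original walk with its denominator. *)
Definition pickB k (i : nat) (z : R * R) : R :=
  \prod_(j < m) (if i == l j k then f j (z.1 - ln z.2) else 1).

Lemma pickX_ge0 k i z : 0 <= pickX k i z.
Proof. by apply: prodr_ge0 => j _; case: eqP => // _; case/andP: (f01 j z.1). Qed.

Lemma pickB_ge0 k i z : 0 <= pickB k i z.
Proof.
by apply: prodr_ge0 => j _; case: eqP => // _; case/andP: (f01 j (z.1 - ln z.2)).
Qed.

Let mf j d' (T : measurableType d') (y : T -> R) : measurable_fun [set: T] y ->
  measurable_fun [set: T] (fun x => f j (y x)).
Proof. by move=> my; apply: measurableT_comp => //; exact: continuous_measurable_fun. Qed.

Lemma measurable_pickX k i : measurable_fun [set: R * R] (pickX k i).
Proof.
apply: measurable_prod => j _; case: eqP => _; last exact: measurable_cst.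
by apply: mf; meas.
Qed.

Lemma measurable_pickB k i : measurable_fun [set: R * R] (pickB k i).
Proof.
apply: measurable_prod => j _; case: eqP => _; last exact: measurable_cst.
by apply: mf; meas.
Qed.

Let tt : 0 <= t <= t. Proof. by rewrite lexx ltW. Qed.

Let A_ge0 w u : 0 <= u <= t -> 0 <= A w u.
Proof. by move=> ut; exact: expA_ge0. Qed.

Let mW u : 0 <= u <= t -> measurable_fun [set: Omega] (fun w => W w u).
Proof. by move=> /andP[u0 _]; exact: (measurable_recentred hB). Qed.

Let mA u : 0 <= u <= t -> measurable_fun [set: Omega] (fun w => A w u).
Proof. by move=> ut; apply: (measurable_expA t0 cW) => //; exact: mW. Qed.

Let mG k i : (i <= 4 ^ k)%N -> measurable_fun [set: Omega] (fun w => G k w i).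
Proof. by move=> iN; apply: mW; exact: (grid_le t0 (pow4_gt0 k) (meshE t k)). Qed.

Definition shifted (w : Omega) (u : R) : R := W w u - ln (1 + c * A w u).

Let den_gt0 w u : 0 <= u <= t -> 0 < 1 + c * A w u.
Proof. by move=> ut; rewrite ltr_pwDl// mulr_ge0 ?A_ge0// ltW. Qed.

Let dr_gt0 k w i : 0 < dr c (h k) (G k w) i.
Proof.
by rewrite /dr ltr_pwDl// mulr_ge0 ?(ltW c0)// dA_ge0// ltW// mesh_gt0.
Qed.

Let mshifted u : 0 <= u <= t -> measurable_fun [set: Omega] (fun w => shifted w u).
Proof. by move=> ut; rewrite /shifted; meas; [exact: mW|exact: mA]. Qed.

Lemma measurable_prod_recentred : measurable_fun [set: Omega] (fun w => \prod_(j < m) f j (W w (s j))).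
Proof. by apply: (measurable_prod_f (y := fun j w => W w (s j))) => j; exact: mW. Qed.

Lemma measurable_prod_shifted : measurable_fun [set: Omega] (fun w => \prod_(j < m) f j (shifted w (s j))).
Proof.
by apply: (measurable_prod_f (y := fun j w => shifted w (s j))) => j; exact: mshifted.
Qed.

Lemma measurable_Lam c' : measurable_fun [set: Omega] (fun w => Lam c' (W w t) (A w t)).
Proof. by rewrite /Lam; have := mW tt; have := mA tt => ? ?; meas. Qed.

Lemma measurable_prod_density : measurable_fun [set: Omega] (fun w =>
  \prod_(j < m) f j (W w (s j)) * (Lam (- c) (W w t) (A w t) * (0 < 1 - c * A w t)%R%:R)).
Proof.
have := mA tt => mAt; apply: measurable_funM; first exact: measurable_prod_recentred.
by apply: measurable_funM; [exact: measurable_Lam|meas].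
Qed.

Lemma pickX_prod k (y q : nat -> R) : \prod_(i < (4 ^ k).+1) pickX k i (y i, q i) =
  \prod_(j < m) f j (y (l j k)).
Proof. exact: (@prod_pick _ (fun j => l j k) (fun j i => f j (y i)) (len ^~ k)). Qed.

Lemma pickB_prod k (y q : nat -> R) : \prod_(i < (4 ^ k).+1) pickB k i (y i, q i) =
  \prod_(j < m) f j (y (l j k) - ln (q (l j k))).
Proof. exact: (@prod_pick _ (fun j => l j k) (fun j i => f j (y i - ln (q i))) (len ^~ k)). Qed.

Local Open Scope ereal_scope.

Lemma brownian_discrete_identity k c' (g : nat -> R * R -> R) (Psi : R * R -> \bar R) :
  (forall i z, 0 <= g i z)%R -> (forall i, measurable_fun [set: R * R] (g i)) ->
  (forall z, 0 <= Psi z) -> measurable_fun [set: R * R] Psi ->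
  \int[P]_w ((weightL g c' (h k) (G k w) (4 ^ k))%:E *
    Psi (dX c' (h k) (G k w) (4 ^ k)%N, (dr c' (h k) (G k w) (4 ^ k)%N)^-1)%R) =
  \int[P]_w ((weightR g (- c') (h k) (G k w) (4 ^ k))%:E *
    Psi (G k w (4 ^ k)%N, dr (- c') (h k) (G k w) (4 ^ k)%N)).
Proof.
move=> g0 mg Psi0 mPsi.
have := discrete_identity (mesh_gt0 t0 k) (@measurable_incr _ _ _ _ _ hB t t0 k)
    (@incr_independent _ _ _ _ _ hB t t0 k) (@incr_gaussian _ _ _ _ _ hB t t0 k) c'
    g0 mg (4 ^ k)%N Psi0 mPsi.
under eq_integral do rewrite walk_incr.
by under [in X in _ = X -> _]eq_integral do rewrite walk_incr.
Qed.

(** [discrete_identity] with - c: the left-hand weights converge where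
    1 - c A_t > 0, and the right-hand sides are bounded by 1. *)
Lemma shifted_lower_bound :
  \int[P]_w (\prod_(j < m) f j (W w (s j)) * (Lam (- c) (W w t) (A w t) *
     (0 < 1 - c * A w t)%R%:R))%R%:E <=
  \int[P]_w (\prod_(j < m) f j (shifted w (s j)))%R%:E.
Proof.
pose u k w := weightL (pickB k) (- c) (h k) (G k w) (4 ^ k).
pose v k w := weightR (pickB k) c (h k) (G k w) (4 ^ k).
have pickE k w : (\prod_(i < (4 ^ k).+1) pickB k i
    (dX (- c) (h k) (G k w) i, (dr (- c) (h k) (G k w) i)^-1) =
    \prod_(j < m) f j (G k w (l j k)))%R.
  rewrite (@pickB_prod k (fun i => dX (- c) (h k) (G k w) i)
    (fun i => (dr (- c) (h k) (G k w) i)^-1)%R).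
  apply: eq_bigr => j _; congr f; rewrite /dX.
  have [p|p] := ltP 0%R (dr (- c) (h k) (G k w) (l j k)).
    by rewrite lnV// opprK subrK.
  by rewrite !ln0 ?invr_le0// !subr0.
have vE k w : v k w = (\prod_(j < m) f j (dX c (h k) (G k w) (l j k)))%R.
  rewrite /v /weightR (@pickB_prod k (G k w) (dr c (h k) (G k w))).
  by rewrite [X in (_ * X)%R]big1 ?mulr1// => i _; rewrite dr_gt0.
apply: (@fatou_compare _ _ _ P u v _ _ 1%R).
- move=> k; apply: (measurable_weightL (measurable_pickB k) (beta := fun w => G k w)).
  by move=> i iN; exact: mG.
- exact: measurable_prod_density.
- move=> k; apply: (measurable_weightR (measurable_pickB k) (beta := fun w => G k w)).
  by move=> i iN; exact: mG.
- exact: measurable_prod_shifted.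
- by move=> k w; apply: weightL_ge0; exact: pickB_ge0.
- move=> k w; rewrite weightR_ge0 /=; last exact: pickB_ge0.
  rewrite vE.
  by case/andP: (prod_f01 (fun j => dX c (h k) (G k w) (l j k))).
- move=> w; apply: mulr_ge0; first by case/andP: (prod_f01 (fun j => W w (s j))).
  case: ltP => [p|]; last by rewrite mulr0.
  by rewrite mulr1 /Lam mulNr mulr_ge0 ?expR_ge0// invr_ge0 ltW.
- move=> k.
  have := @brownian_discrete_identity k (- c)%R _ _ (pickB_ge0 k) (measurable_pickB k)
    (fun=> @lee01 R) (@measurable_cst _ _ _ _ setT 1).
  rewrite opprK; under eq_integral do rewrite mule1.
  by under [in X in _ = X -> _]eq_integral do rewrite mule1; move=> ->.
- apply: filterS (cubic_variation_cvg0 hB t0) => w cv.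
  have [p|p] := ltP 0%R (1 - c * A w t)%R; last by left; rewrite mulr0 mulr0.
  right; rewrite mulr1.
  under eq_fun do rewrite /u /weightL pickE.
  apply: cvgM.
    apply: (prod_f_cvg (y := fun j k => G k w (l j k)) (y' := fun j => W w (s j))) => j.
    exact: (grid_idx_cvg t0 (cW w) pow4_gt0 (meshE t) (mesh_cvg t) (st j)).
  apply: (weight_cvg t0 (cW w) pow4_gt0 (meshE t) (mesh_cvg t)) => //.
    by rewrite /recentred subrr.
  by rewrite mulNr.
- apply: aeW => w; under eq_fun do rewrite vE.
  apply: (prod_f_cvg (y := fun j k => dX c (h k) (G k w) (l j k))
    (y' := fun j => shifted w (s j))) => j.
  exact: (dX_idx_cvg t0 (cW w) pow4_gt0 (meshE t) (mesh_cvg t) (st j) (den_gt0 w (st j))).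
Qed.

Local Close Scope ereal_scope.

(** The function [Lam (- c)] in terms of q = 1 - c a. *)
Definition Lamq (x q : R) : R := q^-1 * expR (- c / 2 * (expR (2 * x) / q - 1)).

(** A continuous function of q that vanishes up to 1 / M and reaches 1 at
    2 / M. *)
Definition cutoff (M q : R) : R := Order.min 1 (Order.max 0 (M * q - 1)).

(** The maximum with 1 / M changes nothing where the cutoff is positive,
    and makes the function continuous and bounded everywhere. *)
Definition cutLam (M : R) (z : R * R) : R :=
  cutoff M z.2 * Lamq z.1 (Order.max z.2 M^-1).

Lemma cutoff01 M q : 0 <= cutoff M q <= 1.
Proof. by rewrite /cutoff le_min ler01/= le_max lexx/= ge_min lexx. Qed.

Lemma cutoff_eq0 M q : 0 < M -> q <= M^-1 -> cutoff M q = 0.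
Proof.
move=> M0 qM; rewrite /cutoff (_ : Order.max _ _ = 0); first by apply/min_idPr.
by apply/max_idPl; rewrite subr_le0 mulrC -ler_pdivlMr// mul1r.
Qed.

Lemma cutLamE M z : 0 < M -> cutLam M z = cutoff M z.2 * Lamq z.1 z.2.
Proof.
move=> M0; rewrite /cutLam; have [q|q] := leP z.2 M^-1; last by [].
by rewrite cutoff_eq0// !mul0r.
Qed.

Lemma cutLam_bound M z : 0 < M -> 0 <= cutLam M z <= M * expR (c / 2).
Proof.
move=> M0; rewrite /cutLam; have /andP[k0 k1] := cutoff01 M z.2.
set q := Order.max _ _; have qM : M^-1 <= q by rewrite le_max lexx orbT.
have q0 : 0 < q by rewrite (lt_le_trans _ qM)// invr_gt0.
have qV : q^-1 <= M by rewrite -[leRHS]invrK lef_pV2// posrE ?invr_gt0.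
have e1 : expR (- c / 2 * (expR (2 * z.1) / q - 1)) <= expR (c / 2).
  rewrite ler_expR; have : 0 <= c / 2 * (expR (2 * z.1) / q).
    by rewrite mulr_ge0 ?divr_ge0 ?expR_ge0// ltW.
  by rewrite mulrBr mulr1 !mulNr opprK gerDr oppr_le0.
have L0 : 0 <= Lamq z.1 q by rewrite mulr_ge0 ?expR_ge0// invr_ge0 ltW.
rewrite mulr_ge0//=.
rewrite (@le_trans _ _ (Lamq z.1 q))//; first by rewrite ler_piMl.
by rewrite ler_pM ?expR_ge0// invr_ge0 ltW.
Qed.

Lemma measurable_cutoff M d' (T : measurableType d') (q : T -> R) :
  measurable_fun [set: T] q -> measurable_fun [set: T] (fun x => cutoff M (q x)).
Proof.
move=> mq; apply: measurable_minr; first exact: measurable_cst.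
by apply: measurable_maxr; [exact: measurable_cst|meas].
Qed.

Lemma measurable_cutLam M : measurable_fun [set: R * R] (cutLam M).
Proof.
apply: measurable_funM; first by apply: measurable_cutoff; meas.
have mq : measurable_fun [set: R * R] (fun z : R * R => Order.max z.2 M^-1).
  by apply: measurable_maxr; meas.
by rewrite /Lamq; meas.
Qed.

Lemma cutLam_cvg M (x q : nat -> R) (x' q' : R) : 0 < M ->
  x k @[k --> \oo] --> x' -> q k @[k --> \oo] --> q' ->
  cutLam M (x k, q k) @[k --> \oo] --> cutLam M (x', q').
Proof.
move=> M0 cx cq.
have comp (g : R -> R) (y : nat -> R) y' : {for y', continuous g} ->
    y k @[k --> \oo] --> y' -> g (y k) @[k --> \oo] --> g y'.
  by move=> cg cy; apply: (@cvg_comp _ _ _ y g _ _ _ cy).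
have cmax : Order.max (q k) M^-1 @[k --> \oo] --> Order.max q' M^-1.
  apply: (comp (fun y => Order.max y M^-1)) cq.
  by apply: (@continuous_max R R id (cst _)); [exact: cvg_id|exact: cvg_cst].
have q0 : Order.max q' M^-1 != 0.
  by rewrite gt_eqF// lt_max invr_gt0 M0 orbT.
apply: cvgM.
  apply: (comp (cutoff M)) cq => /=.
  apply: (@continuous_min R R (cst _)); first exact: cvg_cst.
  apply: (@continuous_max R R (cst _)); first exact: cvg_cst.
  by apply: cvgB; [apply: cvgMr; exact: cvg_id|exact: cvg_cst].
rewrite /Lamq/=; apply: cvgM; first exact: cvgV.
apply: (comp expR) => //; first exact: continuous_expR.
apply: cvgMr; apply: cvgB; last exact: cvg_cst.
apply: cvgM; last exact: cvgV.
apply: (comp expR); first exact: continuous_expR.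
by apply: cvgMr.
Qed.

Lemma Lam_Lamq x a : Lam (- c) x a = Lamq x (1 - c * a).
Proof. by rewrite /Lam /Lamq mulNr. Qed.

(** The densities of the transformation and of its inverse are reciprocal. *)
Lemma Lam_shifted x a : 0 < 1 + c * a ->
  Lam c x a * Lamq (x - ln (1 + c * a)) (1 + c * a)^-1 = 1.
Proof.
move=> r0; rewrite /Lam /Lamq invrK mulrACA mulVf ?gt_eqF// mul1r -expRD.
set r := 1 + c * a; have rn : r != 0 by rewrite gt_eqF.
have -> : expR (2 * (x - ln r)) = expR (2 * x) / r ^+ 2.
  by rewrite mulrBr expRD expRN (mulrC 2 (ln r)) expRM_natr lnK ?posrE.
rewrite [X in expR X](_ : _ = 0) ?expR0//.
by field.
Qed.

Local Open Scope ereal_scope.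

(** [discrete_identity] with c and the extra weight [cutLam]: on the right
    it cuts off the small values of 1 - c A_t and so makes the weights bounded,
    and on the left it cancels the density, by [Lam_shifted]. *)
Lemma shifted_upper_bound_cut (M : R) : (0 < M)%R ->
  \int[P]_w (\prod_(j < m) f j (shifted w (s j)) *
     cutoff M (1 + c * A w t)^-1)%R%:E <=
  \int[P]_w (\prod_(j < m) f j (W w (s j)) * cutLam M (W w t, 1 - c * A w t)%R)%R%:E.
Proof.
move=> M0.
pose u k w := (weightL (pickX k) c (h k) (G k w) (4 ^ k) *
  cutLam M (dX c (h k) (G k w) (4 ^ k)%N, (dr c (h k) (G k w) (4 ^ k)%N)^-1))%R.
pose v k w := (weightR (pickX k) (- c) (h k) (G k w) (4 ^ k) *
  cutLam M (G k w (4 ^ k)%N, dr (- c) (h k) (G k w) (4 ^ k)%N))%R.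
have H0 z : (0 <= cutLam M z)%R by case/andP: (cutLam_bound z M0).
have mH d' (T : measurableType d') (f1 f2 : T -> R) :
    measurable_fun [set: T] f1 -> measurable_fun [set: T] f2 ->
    measurable_fun [set: T] (fun y => cutLam M (f1 y, f2 y)).
  by move=> m1 m2; apply: (measurableT_comp (measurable_cutLam M)); meas.
have mAt := mA tt; have mWt := mW tt.
have vE k w : v k w = (\prod_(j < m) f j (G k w (l j k)) *
    cutLam M (G k w (4 ^ k)%N, dr (- c) (h k) (G k w) (4 ^ k)%N))%R.
  rewrite /v /weightR (@pickX_prod k (G k w) (dr (- c) (h k) (G k w))) cutLamE//=.
  (* The denominators decrease: a positive last one makes all indicators equal
     to 1, and otherwise the cutoff vanishes. *)
  have [p|p] := ltP 0%R (dr (- c) (h k) (G k w) (4 ^ k)%N); last first.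
    by rewrite cutoff_eq0 ?mul0r ?mulr0// (le_trans p)// invr_ge0 ltW.
  rewrite [X in (_ * X * _)%R]big1 ?mulr1// => i _.
  rewrite (lt_le_trans p)// /dr lerD2l !mulNr lerN2 ler_pM2l//.
  by rewrite dA_le// ltW// mesh_gt0.
have uE k w : (u k w = \prod_(j < m) f j (dX c (h k) (G k w) (l j k)) *
    \prod_(i < 4 ^ k) dwpos c (h k) (G k w) i *
    cutLam M (dX c (h k) (G k w) (4 ^ k)%N, (dr c (h k) (G k w) (4 ^ k)%N)^-1))%R.
  rewrite /u /weightL (@pickX_prod k (fun i => dX c (h k) (G k w) i)
    (fun i => (dr c (h k) (G k w) i)^-1)%R)//.
have idxt k : idx (mesh t) t k = (4 ^ k)%N by exact: (idx_end t0 pow4_gt0 (meshE t)).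
have prod0 (y : nat -> R) : (0 <= \prod_(j < m) f j (y j))%R by case/andP: (prod_f01 y).
apply: (@fatou_compare _ _ _ P u v _ _ (M * expR (c / 2))%R).
- move=> k; apply: measurable_funM.
    apply: (measurable_weightL (measurable_pickX k) (beta := fun w => G k w)).
    by move=> i iN; exact: mG.
  apply: mH; first by apply: (measurable_dX (m := (4 ^ k)%N)) => // i; exact: mG.
  by meas; apply: (measurable_dr (m := (4 ^ k)%N)) => // i; exact: mG.
- apply: measurable_funM; first exact: measurable_prod_shifted.
  by apply: measurable_cutoff; meas.
- move=> k; apply: measurable_funM.
    apply: (measurable_weightR (measurable_pickX k) (beta := fun w => G k w)).
    by move=> i iN; exact: mG.
  apply: mH; first exact: mG.
  by apply: (measurable_dr (m := (4 ^ k)%N)) => // i; exact: mG.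
- by apply: measurable_funM; [exact: measurable_prod_recentred|apply: mH => //; meas].
- by move=> k w; rewrite mulr_ge0// weightL_ge0//; exact: pickX_ge0.
- move=> k w; rewrite vE (mulr_ge0 (prod0 (fun j => G k w (l j k))) (H0 _))/=.
  have /andP[_ p1] := prod_f01 (fun j => G k w (l j k)).
  apply: (@le_trans _ _ (cutLam M (G k w (4 ^ k)%N, dr (- c) (h k) (G k w) (4 ^ k)%N))).
    by rewrite ler_piMl.
  by case/andP: (cutLam_bound (G k w (4 ^ k)%N, dr (- c) (h k) (G k w) (4 ^ k)%N) M0).
- move=> w; apply: mulr_ge0 (prod0 (fun j => shifted w (s j))) _.
  by case/andP: (cutoff01 M (1 + c * A w t)^-1).
- move=> k.
  have := @brownian_discrete_identity k c _ (fun z => (cutLam M z)%:E) (pickX_ge0 k)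
    (measurable_pickX k).
  move=> <-//; last by apply: measurable_fun_EFin; exact: measurable_cutLam.
- apply: filterS (cubic_variation_cvg0 hB t0) => w cv; right.
  have r0 := den_gt0 w tt.
  have -> : (\prod_(j < m) f j (shifted w (s j)) * cutoff M (1 + c * A w t)^-1 =
    \prod_(j < m) f j (shifted w (s j)) *
      Lam c (W w t) (A w t) * cutLam M (shifted w t, (1 + c * A w t)^-1))%R.
    rewrite cutLamE//= -[RHS]mulrA; congr (_ * _)%R.
    by rewrite mulrCA /shifted Lam_shifted// mulr1.
  under eq_fun do rewrite uE.
  apply: cvgM; first apply: cvgM.
  + apply: (prod_f_cvg (y := fun j k => dX c (h k) (G k w) (l j k))
      (y' := fun j => shifted w (s j))) => j.
    exact: (dX_idx_cvg t0 (cW w) pow4_gt0 (meshE t) (mesh_cvg t) (st j) (den_gt0 w (st j))).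
  + apply: (weight_cvg t0 (cW w) pow4_gt0 (meshE t) (mesh_cvg t)) => //.
    by rewrite /recentred subrr.
  + apply: cutLam_cvg => //.
      under eq_fun do rewrite -idxt.
      exact: (dX_idx_cvg t0 (cW w) pow4_gt0 (meshE t) (mesh_cvg t) tt r0).
    under eq_fun do rewrite -idxt.
    apply: cvgV; first by rewrite gt_eqF.
    exact: (dr_idx_cvg t0 (cW w) pow4_gt0 (meshE t) (mesh_cvg t) (c := c) tt).
- apply: aeW => w; under eq_fun do rewrite vE.
  apply: cvgM.
    apply: (prod_f_cvg (y := fun j k => G k w (l j k)) (y' := fun j => W w (s j))) => j.
    exact: (grid_idx_cvg t0 (cW w) pow4_gt0 (meshE t) (mesh_cvg t) (st j)).
  apply: cutLam_cvg => //.
    under eq_fun do rewrite -idxt.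
    exact: (grid_idx_cvg t0 (cW w) pow4_gt0 (meshE t) (mesh_cvg t) tt).
  under eq_fun do rewrite -idxt; rewrite -mulNr.
  exact: (dr_idx_cvg t0 (cW w) pow4_gt0 (meshE t) (mesh_cvg t) (c := (- c)%R) tt).
Qed.

Lemma shifted_upper_bound :
  \int[P]_w (\prod_(j < m) f j (shifted w (s j)))%R%:E <=
  \int[P]_w (\prod_(j < m) f j (W w (s j)) * (Lam (- c) (W w t) (A w t) *
     (0 < 1 - c * A w t)%R%:R))%R%:E.
Proof.
have mAt := mA tt; have mWt := mW tt.
have prod0 (y : nat -> R) : (0 <= \prod_(j < m) f j (y j))%R by case/andP: (prod_f01 y).
pose u (n : nat) w := (\prod_(j < m) f j (shifted w (s j)) *
     cutoff n.+1%:R (1 + c * A w t)^-1)%R%:E.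
have umono : \int[P]_w u n w @[n --> \oo] -->
    \int[P]_w (\prod_(j < m) f j (shifted w (s j)))%R%:E.
  rewrite [X in _ --> X](_ : _ = \int[P]_w limn (u ^~ w)); last first.
    apply: eq_integral => w _; apply/esym/cvg_lim => //.
    apply: cvg_near_cst; near=> n; rewrite /u; congr (_%:E).
    rewrite -[RHS]mulr1; congr (_ * _)%R; apply/min_idPl.
    rewrite le_max; apply/orP; right.
    rewrite lerBrDr -ler_pdivrMr ?invr_gt0 ?den_gt0// invrK.
    apply: (@le_trans _ _ n%:R); last by rewrite ler_nat.
    near: n; exact: nbhs_infty_ger.
  apply: cvg_monotone_convergence => //.
  - move=> n; apply: measurable_fun_EFin.
    apply: measurable_funM; first exact: measurable_prod_shifted.
    by apply: measurable_cutoff; meas.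
  - move=> n w _; rewrite lee_fin; apply: mulr_ge0 (prod0 (fun j => shifted w (s j))) _.
    by case/andP: (cutoff01 n.+1%:R (1 + c * A w t)^-1).
  - move=> w _ n p np; rewrite lee_fin (ler_wpM2l (prod0 (fun j => shifted w (s j))))// /cutoff le_min2//.
    by rewrite le_max2// lerB// ler_wpM2r ?invr_ge0 ?(ltW (den_gt0 _ _))// ler_nat.
apply: (cvge_to_le umono); apply: nearW => n.
apply: le_trans (shifted_upper_bound_cut _) _; first by rewrite ltr0n.
apply: ge0_le_integral => //.
- move=> w _; rewrite lee_fin; apply: mulr_ge0 (prod0 (fun j => W w (s j))) _.
  by case/andP: (cutLam_bound (W w t, 1 - c * A w t)%R (ltr0Sn R n)).
- apply: measurable_fun_EFin; apply: measurable_funM; first exact: measurable_prod_recentred.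
  by apply: (measurableT_comp (measurable_cutLam _)); meas.
- by apply: measurable_fun_EFin; exact: measurable_prod_density.
move=> w _; rewrite lee_fin (ler_wpM2l (prod0 (fun j => W w (s j))))// cutLamE ?ltr0n//=.
have [p|p] := ltP 0%R (1 - c * A w t)%R; last first.
  by rewrite cutoff_eq0 ?ltr0n// ?mulr0 ?mul0r// (le_trans p)// invr_ge0 ler0n.
rewrite mulr1 Lam_Lamq ler_piMl//.
  by rewrite /Lamq mulr_ge0 ?expR_ge0// invr_ge0 ltW.
by case/andP: (cutoff01 n.+1%:R (1 - c * A w t)).
Unshelve. all: by end_near. Qed.

Theorem shifted_cylinder_identity :
  \int[P]_w (\prod_(j < m) f j (shifted w (s j)))%R%:E =
  \int[P]_w (\prod_(j < m) f j (W w (s j)) * (Lam (- c) (W w t) (A w t) *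
     (0 < 1 - c * A w t)%R%:R))%R%:E.
Proof.
by apply/eqP; rewrite eq_le shifted_upper_bound shifted_lower_bound.
Qed.

End KeyIdentity.

(** * The exponential functional of a transformed path *)

Section TransformAlgebra.
Context {R : realType} (t : R) (phi : R -> R).
Hypothesis t0 : 0 < t.
Hypothesis cphi : {within `[0, t], continuous phi}.
Variable z : R.

Local Notation A := (expA phi).
Local Notation T := (transform t z phi).

Definition den (s : R) : R := 1 + A s / A t * (expR z - 1).

Let At0 : 0 < A t. Proof. exact: (expA_gt0 t0 cphi). Qed.

Lemma den_gt0 s : 0 <= s <= t -> 0 < den s.
Proof.
move=> /andP[s0 st]; rewrite /den; set q := A s / A t.
have q0 : 0 <= q by rewrite divr_ge0// expA_ge0.
have q1 : q <= 1 by rewrite ler_pdivrMr// mul1r; exact: (expA_le cphi).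
rewrite (_ : 1 + _ = (1 - q) + q * expR z); last by ring.
have ez : 0 < expR z := expR_gt0 z.
have [->|qn0] := eqVneq q 0; first by rewrite subr0 mul0r addr0.
by rewrite ltr_wpDl ?subr_ge0// mulr_gt0// lt_def qn0.
Qed.

Lemma den_end : den t = expR z.
Proof. by rewrite /den divff ?gt_eqF// mul1r addrC subrK. Qed.

Lemma transform_end : T t = phi t - z.
Proof. by rewrite /transform -/(den t) den_end expRK. Qed.

Lemma expR_transform s : 0 <= s <= t -> expR (2 * T s) = expR (2 * phi s) / den s ^+ 2.
Proof.
move=> st; rewrite /transform -/(den s) mulrBr expRD expRN (mulrC 2 (ln _)).
by rewrite expRM_natr lnK// posrE den_gt0.
Qed.

(** The integrand is exp (2 phi) / den^2, the derivative of A / den. *)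
Lemma expA_transform s : 0 <= s <= t -> expA T s = A s / den s.
Proof.
move=> /andP[]; rewrite le_eqVlt => /predU1P[<- _|s0 st].
  by rewrite !expA0 mul0r.
have cs : {within `[0, s], continuous phi}.
  by apply: continuous_subspaceW cphi; apply: subset_itvl; rewrite bnd_simp.
have subt u : 0 <= u <= s -> 0 <= u <= t.
  by move=> /andP[-> us]; rewrite (le_trans us).
have cA : {within `[0, s], continuous A}.
  apply: continuous_subspaceW (expA_continuous t0 cphi).
  by apply: subset_itvl; rewrite bnd_simp.
have cden : {within `[0, s], continuous den}.
  apply: (@within_continuous_comp _ _ _ _ A (fun y => 1 + y / A t * (expR z - 1))) => //.
  move=> y _; apply: cvgD; first exact: cvg_cst.
  by apply: cvgMl; apply: cvgMl; exact: cvg_id.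
have cinv : {within `[0, s], continuous (fun u => (den u)^-1)}.
  apply: (@within_continuous_comp _ _ _ _ den (fun y => y^-1)) => //.
  move=> _ /set_mem [u /= + <-]; rewrite in_itv/= => us; apply: cvgV; last exact: cvg_id.
  by rewrite gt_eqF// den_gt0// subt.
pose f u := expR (2 * phi u) * (den u)^-1 ^+ 2.
pose F u := A u / den u.
have cM (f1 f2 : R -> R) : {within `[0, s], continuous f1} ->
    {within `[0, s], continuous f2} ->
    {within `[0, s], continuous (fun u => f1 u * f2 u)}.
  by move=> c1 c2 u; apply: (@cvgM _ (subspace `[0, s])); [exact: c1|exact: c2].
have cexp : {within `[0, s], continuous (fun u => expR (2 * phi u))}.
  exact: path_exp_continuous.
have cf : {within `[0, s], continuous f} by apply: (cM) => //; exact: cM.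
have cF : {within `[0, s], continuous F} by exact: cM.
have derA x : x \in `]0, s[%R -> is_derive x 1 A (expR (2 * phi x)).
  rewrite in_itv/= => /andP[x0 xs].
  have [] := @continuous_FTC1_closed R (fun u => expR (2 * phi u)) 0 x s xs _ x0 _.
  - exact: path_exp_integrable.
  - move/(continuous_within_itvP _ s0) : cexp => [+ _ _]; apply.
    by rewrite in_itv/= x0.
  by move=> dA' <-; rewrite derive1E; apply: DeriveDef.
have derF x : x \in `]0, s[%R -> is_derive x 1 F (f x).
  move=> xs; have dAx := derA x xs.
  have dx : 0 < den x.
    by apply: den_gt0; apply: subt; move: xs; rewrite in_itv/= => /andP[/ltW-> /ltW->].
  have dden : is_derive x 1 den (expR (2 * phi x) / A t * (expR z - 1)).
    have -> : den = (cst 1 + ((expR z - 1) / A t) *: A)%R.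
      apply/funext => u.
      by rewrite -[RHS]/(1 + (expR z - 1) / A t * A u) /den; ring.
    have := is_deriveD (is_derive_cst (1 : R) x 1) (is_deriveZ ((expR z - 1) / A t) dAx).
    rewrite (_ : 0 + _ = expR (2 * phi x) / A t * (expR z - 1))//.
    by rewrite add0r /GRing.scale/=; ring.
  have dinv := is_deriveV (lt0r_neq0 dx) dden.
  have dF := is_deriveM dAx dinv; split; first exact: (@ex_derive _ _ _ _ _ _ _ dF).
  rewrite -[LHS]/('D_1 (A * (fun y => (den y)^-1)) x) (@derive_val _ _ _ _ _ _ _ dF).
  rewrite /GRing.scale/= /f /den; field.
  apply/andP; split; first by rewrite gt_eqF.
  have : A t * den x != 0 by rewrite mulf_neq0 ?gt_eqF.
  by rewrite (_ : A t * den x = A t + A x * (expR z - 1))// /den; field; rewrite gt_eqF.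
have IF := @continuous_FTC2 R f F 0 s s0 cf.
rewrite [LHS](_ : _ = fine (\int[@lebesgue_measure R]_(x in `[0%R, s]) (f x)%:E)%E).
  rewrite IF.
  - by rewrite /F expA0 mul0r sube0.
  - move/(continuous_within_itvP _ s0) : cF => [_ F0 Fs]; split => // x xs.
    by have [] := derF x xs.
  - by move=> x xs; rewrite derive1E; exact: (@derive_val _ _ _ _ _ _ _ (derF x xs)).
rewrite /expA /Rintegral; congr fine; apply: eq_integral => u.
rewrite inE/= in_itv/= => us; congr (_%:E).
by rewrite expR_transform ?subt// /f exprVn.
Qed.

End TransformAlgebra.

(** * Group property, invariants and measurability of the path transformation *)

Section PathTransform.
Context {R : realType} (t : R).
Hypothesis t0 : 0 < t.
Implicit Types (phi : cpath t) (z : R).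

Local Notation A phi := (expA (extend phi)).
Local Notation C := (borel_cpath t).

Lemma eq_expA (f g : R -> R) (s : R) : (forall u : R, 0 <= u <= s -> f u = g u) ->
  expA f s = expA g s.
Proof.
move=> fg; rewrite /expA /Rintegral; congr fine; apply: eq_integral => u.
by rewrite inE/= in_itv/= => us; rewrite fg.
Qed.

Let At0 phi : 0 < A phi t.
Proof. exact: (expA_gt0 t0 (@extend_continuous _ _ phi)). Qed.

Let tt : 0 <= t <= t. Proof. by rewrite lexx ltW. Qed.

Lemma extend_transform z phi s : 0 <= s <= t ->
  extend (path_transform z phi) s = extend phi s - ln (den t (extend phi) z s).
Proof. by move=> st; rewrite extend_restr. Qed.

Lemma extend_transform_end z phi :
  extend (path_transform z phi) t = extend phi t - z.
Proof. by rewrite extend_restr// (transform_end t0 (@extend_continuous _ _ phi)). Qed.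

Lemma expA_path_transform z phi s : 0 <= s <= t ->
  A (path_transform z phi) s = A phi s / den t (extend phi) z s.
Proof.
move=> /andP[s0 st].
rewrite -(expA_transform t0 (@extend_continuous _ _ phi)) ?s0//.
apply: eq_expA => u /andP[u0 us]; rewrite extend_restr// u0.
exact: le_trans st.
Qed.

Lemma expA_path_transform_end z phi :
  A (path_transform z phi) t = A phi t / expR z.
Proof.
by rewrite expA_path_transform// (den_end t0 (@extend_continuous _ _ phi)).
Qed.

Lemma expZ_path_transform z phi :
  expZ (extend (path_transform z phi)) t = expZ (extend phi) t.
Proof.
rewrite /expZ extend_transform_end expA_path_transform_end opprB expRD.
by field; rewrite gt_eqF// expR_gt0.
Qed.

(** The denominator of the second transformation is the inverse of that of
    the first, by [expA_path_transform]. *)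
Lemma path_transformK z phi : path_transform (- z) (path_transform z phi) = phi.
Proof.
apply: cpath_eqP => s st; rewrite !extend_transform//.
have d0 := den_gt0 t0 (@extend_continuous _ _ phi) z st.
rewrite {2}/den expA_path_transform_end expA_path_transform//.
set d := den t (extend phi) z s in d0 *.
rewrite (_ : 1 + _ = d^-1); first by rewrite lnV ?posrE// opprK subrK.
have dE : d = 1 + A phi s / A phi t * (expR z - 1) by [].
rewrite expRN -[RHS]mul1r -[X in X / d](_ : d - (d - 1) = 1); last by ring.
rewrite {3}dE; field.
by rewrite !gt_eqF//= expR_gt0.
Qed.

Lemma measurable_pathA s : 0 <= s <= t ->
  measurable_fun [set: C] (fun phi : C => A phi s).
Proof.
move=> st; apply: (@measurable_expA _ _ t0 _ C (fun phi : C => extend phi)) => //.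
- by move=> phi; exact: extend_continuous.
- by move=> u ut; exact: measurable_eval.
Qed.

Lemma measurable_path_transform d (T : measurableType d) (zeta : T -> R) (psi : T -> C) :
  measurable_fun [set: T] zeta -> measurable_fun [set: T] psi ->
  measurable_fun [set: T] (fun x => path_transform (zeta x) (psi x) : C).
Proof.
move=> mz mpsi; apply: measurable_into_cpath => // s st.
rewrite (_ : (fun x => _) = (fun x => extend (psi x) s -
    ln (1 + A (psi x) s / A (psi x) t * (expR (zeta x) - 1)))); last first.
  by apply/funext => x; rewrite extend_transform.
have me u : 0 <= u <= t -> measurable_fun [set: T] (fun x => extend (psi x) u).
  by move=> ut; apply: (measurableT_comp (measurable_eval ut)).
have mA u : 0 <= u <= t -> measurable_fun [set: T] (fun x => A (psi x) u).
  by move=> ut; apply: (measurableT_comp (measurable_pathA ut)).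
have := me _ st; have := mA _ st; have := mA _ tt => ? ? ?.
by meas.
Qed.

Lemma measurable_expZ : measurable_fun [set: C] (fun phi : C => expZ (extend phi) t).
Proof.
have := measurable_eval tt; have := measurable_pathA tt => ? ?.
by rewrite /expZ; meas.
Qed.

Lemma expZ_gt0 phi : 0 < expZ (extend phi) t.
Proof. by rewrite /expZ mulr_gt0// expR_gt0. Qed.

(** The density D_c with its indicator. *)
Definition tiltweight (c : R) phi : R :=
  Lam (- c) (extend phi t) (A phi t) * (0 < 1 - c * A phi t)%R%:R.

Lemma tiltweight_ge0 c phi : 0 <= tiltweight c phi.
Proof.
rewrite /tiltweight; case: ltP => p; last by rewrite mulr0.
by rewrite mulr1 /Lam mulNr mulr_ge0 ?expR_ge0// invr_ge0 ltW.
Qed.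

Lemma measurable_tiltweight d (T : measurableType d) (c : T -> R) (psi : T -> C) :
  measurable_fun [set: T] c -> measurable_fun [set: T] psi ->
  measurable_fun [set: T] (fun x => tiltweight (c x) (psi x)).
Proof.
move=> mc mpsi.
have m1 : measurable_fun [set: T] (fun x => extend (psi x) t).
  by apply: (measurableT_comp (measurable_eval tt)).
have m2 : measurable_fun [set: T] (fun x => A (psi x) t).
  by apply: (measurableT_comp (measurable_pathA tt)).
by rewrite /tiltweight /Lam; meas.
Qed.

End PathTransform.

(** * Quasi-invariance of the Brownian law *)

Section TransformLaw.
Context d (Omega : measurableType d) (R : realType) (P : probability Omega R).
Variables (B : R -> Omega -> R) (hB : standard_brownian_motion P B) (t : R).
Hypothesis t0 : 0 < t.

Local Notation C := (borel_cpath t).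
Local Notation A phi := (expA (extend phi)).
Local Notation bp := (bm_path hB t).

Let tt : 0 <= t <= t. Proof. by rewrite lexx ltW. Qed.

Lemma measurable_bm_path : measurable_fun [set: Omega] (bp : Omega -> C).
Proof.
apply: measurable_into_cpath => // s /andP[s0 st].
rewrite (_ : (fun x => _) = B s); first exact: (bm_measurable hB).
by apply/funext => w; rewrite extend_restr// s0.
Qed.

Variable c : R.
Hypothesis c0 : 0 < c.

(** The map S_c, as a transformation with parameter ln (1 + c A_t). *)
Definition pushed (phi : C) : C := path_transform (ln (1 + c * A phi t)) phi.

Lemma measurable_pushed : measurable_fun [set: C] pushed.
Proof.
apply: measurable_path_transform => //.
have := measurable_pathA t0 tt => ?; by meas.
Qed.

Lemma extend_pushed (phi : C) s : 0 <= s <= t ->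
  extend (pushed phi) s = extend phi s - ln (1 + c * A phi s).
Proof.
move=> st; rewrite extend_transform//; congr (_ - ln _); rewrite /den.
have At0 : 0 < A phi t by exact: (expA_gt0 t0 (@extend_continuous _ _ phi)).
rewrite lnK ?posrE; last by rewrite ltr_pwDl// mulr_ge0 ?ltW.
by field; rewrite gt_eqF.
Qed.

Lemma bm_path_recentred w : B 0 w = 0 -> forall s, 0 <= s <= t ->
  extend (bp w) s = recentred B w s.
Proof. by move=> B0 s st; rewrite extend_restr// /recentred B0 subr0. Qed.

Lemma bm_pathA_recentred w : B 0 w = 0 -> forall s, 0 <= s <= t ->
  A (bp w) s = expA (recentred B w) s.
Proof.
move=> B0 s /andP[s0 st]; apply: eq_expA => u /andP[u0 us].
by apply: bm_path_recentred; rewrite // u0 (le_trans us).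
Qed.

Local Open Scope ereal_scope.

(** The law of S_c B and the law of B weighted by the density are finite
    measures on the path space that agree on cylinder functions. *)
Theorem pushed_law (F : C -> \bar R) : (forall phi, 0 <= F phi) ->
  measurable_fun [set: C] F ->
  \int[P]_w F (pushed (bp w)) = \int[P]_w (F (bp w) * (tiltweight c (bp w))%:E).
Proof.
move=> F0 mF.
pose mu := image_measure P measurable_bm_path.
have mtilt : measurable_fun [set: C] (tiltweight c : C -> R).
  by apply: (measurable_tiltweight t0 (c := cst c) (psi := id)) => //; exact: measurable_cst.
pose m1 := image_measure mu measurable_pushed.
pose m2 := mdens mu (@tiltweight_ge0 _ t c) mtilt.
have mtiltE : measurable_fun [set: C] (fun phi : C => (tiltweight c phi)%:E).
  exact: measurable_fun_EFin.
have int1 (G : C -> \bar R) : (forall phi, 0 <= G phi) -> measurable_fun [set: C] G ->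
    \int[m1]_phi G phi = \int[P]_w G (pushed (bp w)).
  move=> G0 mG; rewrite integral_image_measure// integral_image_measure//.
  by apply: (measurableT_comp mG); exact: measurable_pushed.
have int2 (G : C -> \bar R) : (forall phi, 0 <= G phi) -> measurable_fun [set: C] G ->
    \int[m2]_phi G phi = \int[P]_w (G (bp w) * (tiltweight c (bp w))%:E).
  move=> G0 mG; rewrite integral_mdens// integral_image_measure//.
    by move=> phi; rewrite mule_ge0// lee_fin tiltweight_ge0.
  by apply: emeasurable_funM.
rewrite -int1// -int2//; apply: eq_measure_integral => D mD _.
apply: (cpath_measure_unique t0) mD => //.
  have : P [set: Omega] < +oo by rewrite probability_setT ltry.
  exact.
move=> m s f st cf f01.
have p0 (phi : C) : 0 <= (\prod_(j < m) f j (extend phi (s j)))%:E.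
  by rewrite lee_fin prodr_ge0// => j _; case/andP: (f01 j (extend phi (s j))).
have mp : measurable_fun [set: C]
    (fun phi : C => (\prod_(j < m) f j (extend phi (s j)))%:E).
  by apply: measurable_fun_EFin; exact: (measurable_cylinder_prod m st cf).
rewrite int1// int2//.
have mp1 := measurableT_comp mp (measurableT_comp measurable_pushed measurable_bm_path).
have mp2 := measurableT_comp mp measurable_bm_path.
have mp3 := measurableT_comp mtiltE measurable_bm_path.
have K := shifted_cylinder_identity hB t0 c0 m st cf f01.
have B0 := bm_start hB.
transitivity (\int[P]_w (\prod_(j < m) f j (shifted B c w (s j)))%:E).
  apply: ge0_ae_eq_integral => //.
  - by apply: measurable_fun_EFin; exact: (measurable_prod_shifted hB t0 c m st cf).
  - by move=> w _; rewrite lee_fin prodr_ge0// => j _; case/andP: (f01 j (shifted B c w (s j))).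
  apply: filterS B0 => w B0 _; congr (_%:E); apply: eq_bigr => j _.
  by rewrite (extend_pushed (bp w) (st j)) (bm_path_recentred B0 (st j))
    (bm_pathA_recentred B0 (st j)).
rewrite K; apply: ge0_ae_eq_integral => //.
- by apply: measurable_fun_EFin; exact: (measurable_prod_density hB t0 c m st cf).
- by apply: emeasurable_funM.
- move=> w _; rewrite lee_fin mulr_ge0//.
    by rewrite prodr_ge0// => j _; case/andP: (f01 j (recentred B w (s j))).
  case: ltP => p; last by rewrite mulr0.
  by rewrite mulr1 /Lam mulNr mulr_ge0 ?expR_ge0// invr_ge0 ltW.
- by move=> w _; rewrite mule_ge0// lee_fin tiltweight_ge0.
apply: filterS B0 => w B0 _; rewrite -EFinM /tiltweight; congr (_%:E).
rewrite (bm_path_recentred B0 tt) (bm_pathA_recentred B0 tt); congr (_ * _)%R.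
by apply: eq_bigr => j _; rewrite (bm_path_recentred B0 (st j)).
Qed.

End TransformLaw.

(** * The Macdonald function of order zero as an integral over the line *)

Section HalfLines.
Context {R : realType}.
Local Notation mu := (@lebesgue_measure R).
Local Open Scope ereal_scope.

Lemma integral_split0 (f : R -> \bar R) : (forall x, 0 <= f x) ->
  measurable_fun [set: R] f ->
  \int[mu]_x f x = \int[mu]_x ((0 < x)%R%:R%:E * f x) +
                   \int[mu]_x ((0 < x)%R%:R%:E * f (- x)%R).
Proof.
move=> f0 mf.
have mN : measurable_fun [set: R] (fun x => f (- x)%R) by apply: measurableT_comp.
have mb : measurable_fun [set: R] (fun x : R => (0 < x)%R%:R%:E : \bar R) by meas.
have b0 (x : R) : 0 <= (0 < x)%R%:R%:E :> \bar R by rewrite lee_fin.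
rewrite -[X in _ = _ + X]ge0_integral_opp; last 2 first.
- by move=> x; rewrite mule_ge0.
- by apply: emeasurable_funM.
have mb' : measurable_fun [set: R] (fun x : R => (0 < - x)%R%:R%:E : \bar R) by meas.
rewrite -ge0_integralD//; last 4 first.
- by move=> x _; rewrite mule_ge0.
- by apply: emeasurable_funM.
- by move=> x _; rewrite mule_ge0.
- by under eq_fun do rewrite opprK; apply: emeasurable_funM.
apply: ge0_ae_eq_integral => //.
- apply: emeasurable_funD; first exact: emeasurable_funM.
  by under eq_fun do rewrite opprK; apply: emeasurable_funM.
- by move=> x _; rewrite adde_ge0// mule_ge0.
exists [set 0%R]; split=> //; first exact: lebesgue_measure_set1.
move=> x /= H; apply: contrapT => x0; apply: H => _.
rewrite opprK oppr_gt0.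
by case: (ltgtP x 0%R) => [||//]; rewrite ?mul1e ?mul0e ?adde0 ?add0e.
Qed.

End HalfLines.

Section Macdonald.
Context {R : realType}.
Local Notation mu := (@lebesgue_measure R).

Lemma coshN (x : R) : cosh (- x) = cosh x.
Proof. by rewrite /cosh opprK addrC. Qed.

(** From exp (x / 2) >= x / 2, squared; the constant is not sharp. *)
Lemma cosh_ge_sqr (x : R) : x ^+ 2 / 8 <= cosh x.
Proof.
wlog x0 : x / 0 <= x.
  move=> H; have [/H//|/ltW x0] := leP 0 x.
  by rewrite -coshN -sqrrN; apply: H; rewrite oppr_ge0.
have e2 : x / 2 <= expR (x / 2) by rewrite (le_trans _ (expR_ge1Dx _))// lerDr.
have e3 : (x / 2) ^+ 2 <= expR x.
  rewrite [X in expR X](_ : x = x / 2 * 2%:R); last by rewrite mulfVK.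
  by rewrite expRM_natr lerXn2r// nnegrE ?expR_ge0// divr_ge0.
have := expR_ge0 (- x); rewrite /cosh => e4.
have -> : x ^+ 2 / 8 = (x / 2) ^+ 2 / 2 by field.
by rewrite ler_pM2r// (le_trans e3)// lerDl.
Qed.

Lemma measurable_cosh : measurable_fun [set: R] (@cosh R).
Proof. by rewrite /cosh; meas. Qed.

Local Open Scope ereal_scope.

Variable y : R.
Hypothesis y0 : (0 < y)%R.

Let g (u : R) : \bar R := (expR (- (y * cosh u)))%:E.

Let g0 u : 0 <= g u. Proof. by rewrite lee_fin expR_ge0. Qed.

Let mg : measurable_fun [set: R] g.
Proof. by have := measurable_cosh => ?; rewrite /g; meas. Qed.

(** By [cosh_ge_sqr] the integrand is below exp (- u^2 / (2 h)) with h = 4 / y. *)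
Lemma integral_exp_cosh_lty : \int[mu]_u g u < +oo.
Proof.
pose h : R := (4 / y)%R; have h0 : (0 < h)%R by rewrite divr_gt0.
pose p : R := normal_peak (Num.sqrt h).
have p0 : (0 < p)%R by rewrite normal_peak_gt0// gt_eqF// sqrtr_gt0.
have := @integral_gaussian _ h (cst 1) h0 (fun=> lee01) (measurable_cst _).
rewrite integral_cst//.
have -> : (gaussian h : {measure set R -> \bar R}) [set: R] = 1.
  exact: (@probability_setT _ _ _ (gaussian h)).
rewrite mule1 /= => I1.
have mp : measurable_fun [set: R] (fun u : R => (expR (- u ^+ 2 / (2 * h)))%:E) by meas.
have I2 : \int[mu]_u (expR (- u ^+ 2 / (2 * h)))%:E = (p^-1)%:E.
  have : 1 = p%:E * \int[mu]_u (expR (- u ^+ 2 / (2 * h)))%:E.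
    rewrite -ge0_integralZl_EFin ?(ltW p0)//.
    by rewrite I1; apply: eq_integral => u _; rewrite mul1e EFinM.
  move/(congr1 (fun e => (p^-1)%:E * e)).
  by rewrite mule1 muleA -EFinM mulVf ?gt_eqF// mul1e.
apply: (@le_lt_trans _ _ (p^-1)%:E); last exact: ltry.
rewrite -I2; apply: ge0_le_integral => // u _.
rewrite lee_fin ler_expR /h.
rewrite (_ : - u ^+ 2 / (2 * (4 / y)) = - (y * (u ^+ 2 / 8)))%R; last first.
  by field; rewrite gt_eqF.
by rewrite lerN2 ler_pM2l// cosh_ge_sqr.
Qed.

Lemma integral_exp_cosh_gt0 : 0 < \int[mu]_u g u.
Proof.
apply: (@lt_le_trans _ _ (expR (- (y * expR 1)))%:E).
  by rewrite lte_fin expR_gt0.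
apply: (@le_trans _ _ (\int[mu]_(u in `[0%R, 1%R]) g u)); last first.
  by apply: ge0_subset_integral.
rewrite -[leLHS]mule1 -[X in _ * X](_ : mu `[0%R, 1%R] = 1); last first.
  by rewrite lebesgue_measure_itv/= lte_fin ltr01 oppr0 adde0.
rewrite -integral_cst//; apply: ge0_le_integral => //.
- by move=> u _; rewrite lee_fin expR_ge0.
- exact: measurable_funTS.
move=> u; rewrite /= in_itv/= => /andP[u0 u1]; rewrite lee_fin ler_expR lerN2 ler_pM2l//.
rewrite /cosh; have : (expR u <= expR 1)%R by rewrite ler_expR.
have : (expR (- u) <= expR 1)%R by rewrite ler_expR; lra.
by move=> ? ?; lra.
Qed.

(** The integrand is even, and besselK integrates over a half-line. *)
Lemma integral_exp_coshE :
  \int[mu]_u (expR (- (y * cosh u)))%:E = (2 * besselK 0 y)%:E.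
Proof.
have [I Idef] : exists I, I =
    \int[mu]_(u in `[0%R, +oo[) (expR (- (y * cosh u)) * cosh (0 * u))%:E.
  by eexists.
have IE : I = \int[mu]_u ((0 < u)%R%:R%:E * g u).
  rewrite -integral_itv0y Idef -integral_itv_obnd_cbnd.
    by apply: eq_integral => u _; rewrite mul0r /cosh oppr0 expR0 divff ?mulr1.
  have := measurable_cosh => ?.
  by apply: measurable_funTS; rewrite /cosh; meas.
have NE : \int[mu]_u g u = I + I.
  have S := integral_split0 g0 mg.
  rewrite S -IE; f_equal; rewrite IE.
  by apply: eq_integral => u _; rewrite /g coshN.
have I0 : 0 <= I by rewrite IE; apply: integral_ge0 => u _; rewrite mule_ge0// lee_fin.
have Ifin : I \is a fin_num.
  rewrite ge0_fin_numE//; apply: le_lt_trans integral_exp_cosh_lty.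
  by rewrite NE leeDl.
rewrite [LHS]NE /besselK /Rintegral -Idef.
by rewrite -[in LHS](fineK Ifin) -EFinD -mulr2n mulr_natl.
Qed.

Lemma besselK0_gt0 : (0 < besselK 0 y)%R.
Proof. by have := integral_exp_cosh_gt0; rewrite integral_exp_coshE lte_fin pmulr_rgt0. Qed.

End Macdonald.

(** * Substitutions between the two parametrizations *)

Section ParameterSubstitution.
Context {R : realType}.
Local Notation mu := (@lebesgue_measure R).
Local Open Scope ereal_scope.
Variables (A : R) (f : R -> \bar R).
Hypotheses (A0 : (0 < A)%R) (f0 : forall x, 0 <= f x) (mf : measurable_fun [set: R] f).

Let A1 : (0 < A^-1)%R. Proof. by rewrite invr_gt0. Qed.

Let mfc (y : R -> R) : measurable_fun [set: R] y -> measurable_fun [set: R] (fun x => f (y x)).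
Proof. by move=> my; exact: measurableT_comp. Qed.

Let b0 (b : bool) (x : \bar R) : 0 <= x -> 0 <= (b%:R : R)%:E * x.
Proof. by move=> x0; rewrite mule_ge0// lee_fin. Qed.

(** The substitution c = (exp z - 1) / A, through the variable 1 + c A. *)
Lemma integral_exp_shift :
  \int[mu]_c ((0 < c)%R%:R%:E * f c) =
  \int[mu]_z ((0 < z)%R%:R%:E * (f ((expR z - 1) / A)%R * (expR z / A)%:E)).
Proof.
pose g c := (0 < c)%R%:R%:E * f c.
have g0 c : 0 <= g c by exact: b0.
have mg : measurable_fun [set: R] g by rewrite /g; meas.
rewrite [LHS](@ge0_integral_affine R A^-1 (- A^-1)%R g A1 g0 mg).
transitivity (A^-1%:E * \int[mu]_(y in `]0%R, +oo[) ((1 < y)%R%:R%:E * f ((y - 1) / A)%R)).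
  congr (_ * _); rewrite integral_itv0y; apply: eq_integral => y _; rewrite /g.
  rewrite (_ : A^-1 * y + - A^-1 = (y - 1) / A)%R; last by ring.
  rewrite pmulr_lgt0// subr_gt0.
  have [y1|] := ltP 1%R y; last by rewrite !mul0e mule0.
  by rewrite (lt_trans ltr01 y1) !mul1e.
rewrite ge0_integral_expR; last 2 first.
- by move=> y; exact: b0.
- by meas; apply: mfc; meas.
rewrite -ge0_integralZl_EFin ?(ltW A1)//; last 2 first.
- by move=> u _; rewrite mule_ge0 ?lee_fin ?expR_ge0// b0.
- by meas; apply: mfc; meas.
apply: eq_integral => u _; rewrite -[X in (X < expR u)%R]expR0 ltr_expR.
by rewrite muleC -!muleA EFinM.
Qed.

(** The substitution c = (1 - exp (- z)) / A, through the variable 1 - c A. *)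
Lemma integral_exp_reflect :
  \int[mu]_c ((0 < c)%R%:R%:E * ((0 < 1 - c * A)%R%:R%:E * f c)) =
  \int[mu]_z ((0 < z)%R%:R%:E *
     (f ((1 - expR (- z)) / A)%R * (expR (- z) / A)%:E)).
Proof.
pose g c := (0 < c)%R%:R%:E * ((0 < 1 - c * A)%R%:R%:E * f c).
have g0 c : 0 <= g c by apply: b0; exact: b0.
have mg : measurable_fun [set: R] g by rewrite /g; meas.
rewrite -[LHS](@ge0_integral_opp R g g0 mg).
have gN0 c : 0 <= g (- c)%R by [].
have mgN : measurable_fun [set: R] (fun c => g (- c)%R) by apply: measurableT_comp.
rewrite [LHS](@ge0_integral_affine R A^-1 (- A^-1)%R _ A1 gN0 mgN).
pose k z := (0 < - z)%R%:R%:E * (f ((1 - expR z) / A)%R * (expR z / A)%:E).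
have k0 z : 0 <= k z by apply: b0; rewrite mule_ge0// lee_fin divr_ge0 ?expR_ge0// ltW.
have mk : measurable_fun [set: R] k by rewrite /k; meas; apply: mfc; meas.
transitivity (\int[mu]_z k z); last first.
  rewrite -(ge0_integral_opp k0 mk); apply: eq_integral => z _.
  by rewrite /k opprK.
transitivity (A^-1%:E * \int[mu]_(y in `]0%R, +oo[) ((y < 1)%R%:R%:E * f ((1 - y) / A)%R)).
  congr (_ * _); rewrite integral_itv0y; apply: eq_integral => y _; rewrite /g.
  rewrite (_ : - (A^-1 * y + - A^-1) = (1 - y) / A)%R; last by ring.
  rewrite pmulr_lgt0// subr_gt0 mulfVK ?gt_eqF// opprB addrC subrK.
  by rewrite muleCA.
rewrite ge0_integral_expR; last 2 first.
- by move=> y; exact: b0.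
- by meas; apply: mfc; meas.
rewrite -ge0_integralZl_EFin ?(ltW A1)//; last 2 first.
- by move=> u _; rewrite mule_ge0 ?lee_fin ?expR_ge0// b0.
- by meas; apply: mfc; meas.
apply: eq_integral => u _; rewrite /k -[X in (expR u < X)%R]expR0 ltr_expR oppr_gt0.
by rewrite muleC -!muleA EFinM.
Qed.

End ParameterSubstitution.

(** * The transformation law for positive parameters *)

Section HalfLineLaw.
Context d (Omega : measurableType d) (R : realType) (P : probability Omega R).
Variables (B : R -> Omega -> R) (hB : standard_brownian_motion P B) (t : R).
Hypothesis t0 : 0 < t.

Local Notation C := (borel_cpath t).
Local Notation A phi := (expA (extend phi) t).
Local Notation bp := (bm_path hB t).
Local Notation mu := (@lebesgue_measure R).

Let tt : 0 <= t <= t. Proof. by rewrite lexx ltW. Qed.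

Let A0 (phi : C) : 0 < A phi.
Proof. exact: (expA_gt0 t0 (@extend_continuous _ _ phi)). Qed.

(** The weight L_z of the transformation law.  It comes from a substitution
    that mixes z with the path, and has a meaning under the integral over z only. *)
Definition likelihood (z : R) (phi : C) : R :=
  expR ((cosh (extend phi t) - cosh (extend phi t + z)) / expZ (extend phi) t).

Lemma likelihood_transform z (phi : C) :
  likelihood z (path_transform z phi) = (likelihood (- z) phi)^-1.
Proof.
rewrite /likelihood expZ_path_transform// extend_transform_end// subrK -expRN.
by congr expR; ring.
Qed.

Lemma measurable_likelihood d' (T : measurableType d') (zeta : T -> R) (psi : T -> C) :
  measurable_fun [set: T] zeta -> measurable_fun [set: T] psi ->
  measurable_fun [set: T] (fun x => likelihood (zeta x) (psi x)).
Proof.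
move=> mz mpsi; rewrite /likelihood /cosh.
have m1 : measurable_fun [set: T] (fun x => extend (psi x) t).
  by apply: (measurableT_comp (measurable_eval tt)).
have m2 : measurable_fun [set: T] (fun x => expZ (extend (psi x)) t).
  by apply: (measurableT_comp (measurable_expZ t0)).
by meas.
Qed.

(** With 1 - c A_t = exp (- z), the exponent of the density becomes a
    difference of cosh, and the prefactor cancels the Jacobian exp (- z) of the
    substitution. *)
Lemma tiltweight_likelihood z (phi : C) : 
  tiltweight ((1 - expR (- z)) / A phi) phi * expR (- z) = likelihood z phi.
Proof.
rewrite /tiltweight /Lam /likelihood /cosh.
have a0 := A0 phi; set a := A phi in a0 *; set x := extend phi t.
have -> : 1 - (1 - expR (- z)) / a * a = expR (- z) by rewrite mulfVK ?gt_eqF// opprB addrC subrK.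
have -> : 1 + - ((1 - expR (- z)) / a) * a = expR (- z).
  by rewrite mulNr mulfVK ?gt_eqF// opprB addrC subrK.
rewrite expR_gt0 mulr1 mulrAC mulVf ?gt_eqF ?expR_gt0// mul1r; congr expR.
rewrite /expZ -/a -/x mulr2n.
have ex := expR_gt0 x; have ez := expR_gt0 z.
rewrite (_ : 2 * x = x + x); last by rewrite mulr_natl mulr2n.
rewrite !opprD !expRD !expRN; field.
by rewrite !gt_eqF.
Qed.

Local Open Scope ereal_scope.

Let mid : measurable_fun [set: measurableTypeR R] (id : measurableTypeR R -> R).
Proof. by []. Qed.

(** For a fixed path, (A_t, ln (1 + c A_t)) is a function of c and of the
    image S_c phi alone, because A_t (S_c phi) = A_t / (1 + c A_t).  Hence, in the
    parameter c, the left-hand side is the integral of a function of S_c B, to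
    which [pushed_law] applies for each c. *)
Lemma half_line_law (G : R -> C -> \bar R) : (forall z phi, 0 <= G z phi) ->
  measurable_fun [set: R * C] (fun x : R * C => G x.1 x.2) ->
  \int[P]_w \int[mu]_z ((0 < z)%R%:R%:E * G z (path_transform z (bp w))) =
  \int[P]_w \int[mu]_z ((0 < z)%R%:R%:E * (G z (bp w) * (likelihood z (bp w))%:E)).
Proof.
move=> G0 mG.
have mGc d' (T : measurableType d') (zeta : T -> R) (psi : T -> C) :
    measurable_fun [set: T] zeta -> measurable_fun [set: T] psi ->
    measurable_fun [set: T] (fun x => G (zeta x) (psi x)).
  move=> m1 m2; apply: (measurableT_comp mG (f := fun x => G x.1 x.2)
    (g := fun x => (zeta x, psi x))).
  exact: measurable_fun_pair.
have mAc d' (T : measurableType d') (psi : T -> C) :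
    measurable_fun [set: T] psi -> measurable_fun [set: T] (fun x => A (psi x)).
  by move=> m2; apply: (measurableT_comp (measurable_pathA t0 tt)).
pose H (c : R) (phi : C) := G (- ln (1 - c * A phi))%R phi * (A phi)%:E.
have H0 c phi : 0 <= H c phi by rewrite mule_ge0// lee_fin ltW.
have mHc d' (T : measurableType d') (zeta : T -> R) (psi : T -> C) :
    measurable_fun [set: T] zeta -> measurable_fun [set: T] psi ->
    measurable_fun [set: T] (fun x => H (zeta x) (psi x)).
  move=> m1 m2; have m3 := mAc _ _ _ m2.
  by rewrite /H; meas; apply: mGc => //; meas.
have mTc d' (T : measurableType d') (zeta : T -> R) (psi : T -> C) :
    measurable_fun [set: T] zeta -> measurable_fun [set: T] psi ->
    measurable_fun [set: T] (fun x => pushed (zeta x) (psi x)).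
  move=> m1 m2; have m3 := mAc _ _ _ m2.
  by rewrite /pushed; apply: measurable_path_transform => //; meas.
have mcst d' (T : measurableType d') (phi : C) :
  measurable_fun [set: T] (fun=> phi) by exact: measurable_cst.
have m2nd : measurable_fun [set: Omega * measurableTypeR R]
    (fun x : Omega * measurableTypeR R => x.2 : R).
  exact: (measurableT_comp mid measurable_snd).
have m1st : measurable_fun [set: Omega * measurableTypeR R]
    (fun x : Omega * measurableTypeR R => bp x.1 : C).
  exact: (measurableT_comp (measurable_bm_path hB t0) measurable_fst).
have step1 (phi : C) : \int[mu]_z ((0 < z)%R%:R%:E * G z (path_transform z phi)) =
    \int[mu]_c ((0 < c)%R%:R%:E * H c (pushed c phi)).
  pose f (c : R) := H c (pushed c phi).
  rewrite (@integral_exp_shift R (A phi) f (A0 phi)); last 2 first.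
  - by move=> c; exact: H0.
  - by apply: mHc => //; apply: mTc.
  apply: eq_integral => z _.
  have [z0|] := ltP 0%R z; last by rewrite !mul0e.
  rewrite !mul1e /f /H /pushed.
  have -> : (1 + (expR z - 1) / A phi * A phi = expR z)%R.
    by rewrite mulfVK ?gt_eqF// addrC subrK.
  rewrite expRK expA_path_transform_end//.
  have -> : (1 - (expR z - 1) / A phi * (A phi / expR z) = expR (- z))%R.
    rewrite expRN; field; rewrite !gt_eqF ?expR_gt0//; exact: A0.
  rewrite expRK opprK -muleA -EFinM.
  rewrite (_ : (_ * _)%R = 1%R) ?mule1//; field.
  by rewrite !gt_eqF ?expR_gt0//; exact: A0.
under eq_integral do rewrite step1.
rewrite (@fubini_tonelli _ _ _ _ _ P mu (fun x : Omega * measurableTypeR R =>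
  (0 < x.2)%R%:R%:E * H x.2 (pushed x.2 (bp x.1))))/=; last 2 first.
- by meas; apply: mHc => //; exact: mTc.
- by move=> x; rewrite mule_ge0// lee_fin.
pose K (x : Omega * measurableTypeR R) :=
  (0 < x.2)%R%:R%:E * (H x.2 (bp x.1) * (tiltweight x.2 (bp x.1))%:E).
have K0 x : 0 <= K x by rewrite mule_ge0 ?lee_fin// mule_ge0// lee_fin tiltweight_ge0.
have mK : measurable_fun setT K.
  rewrite /K; meas; first exact: mHc.
  exact: measurable_tiltweight.
have mbp := measurable_bm_path hB t0.
transitivity (\int[mu]_c \int[P]_w K (w, c)).
  apply: eq_integral => c _; rewrite /K/=.
  have [c0|c0] := ltP 0%R c; last first.
    by under eq_integral do rewrite mul0e; under [RHS]eq_integral do rewrite mul0e.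
  under eq_integral do rewrite mul1e; under [RHS]eq_integral do rewrite mul1e.
  apply: (pushed_law hB t0 c0 (F := H c)) => //.
  by apply: mHc => //; exact: measurable_cst.
rewrite -(@fubini_tonelli _ _ _ _ _ P mu K mK K0).
apply: eq_integral => w _; rewrite /K/=; set phi := bp w.
pose f (c : R) := H c phi * (tiltweight c phi)%:E.
have f0 c : 0 <= f c by rewrite mule_ge0// lee_fin tiltweight_ge0.
have mf : measurable_fun [set: R] f.
  rewrite /f; meas; first by apply: mHc.
  by apply: measurable_tiltweight.
transitivity (\int[mu]_c ((0 < c)%R%:R%:E * ((0 < 1 - c * A phi)%R%:R%:E * f c))).
  apply: eq_integral => c _; congr (_ * _); rewrite /f /tiltweight.
  by case: ltP => p; rewrite ?mul1e// !mulr0 mule0 mule0.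
rewrite (integral_exp_reflect (A0 phi) f0 mf).
apply: eq_integral => z _; congr (_ * _); rewrite /f /H -tiltweight_likelihood.
have -> : (1 - (1 - expR (- z)) / A phi * A phi = expR (- z))%R.
  by rewrite mulfVK ?gt_eqF// opprB addrC subrK.
rewrite expRK opprK -!muleA; congr (_ * _); rewrite -!EFinM; congr (_%:E).
by field; rewrite gt_eqF.
Qed.

End HalfLineLaw.

(** * The transformation law on the line *)

Section WholeLineLaw.
Context d (Omega : measurableType d) (R : realType) (P : probability Omega R).
Variables (B : R -> Omega -> R) (hB : standard_brownian_motion P B) (t : R).
Hypothesis t0 : 0 < t.

Local Notation C := (borel_cpath t).
Local Notation bp := (bm_path hB t).
Local Notation mu := (@lebesgue_measure R).

Let tt : 0 <= t <= t. Proof. by rewrite lexx ltW. Qed.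

Local Open Scope ereal_scope.

Let mid : measurable_fun [set: measurableTypeR R] (id : measurableTypeR R -> R).
Proof. by []. Qed.

Lemma measurable_pair_comp (G : R -> C -> \bar R) :
  measurable_fun [set: R * C] (fun x : R * C => G x.1 x.2) ->
  forall d' (T : measurableType d') (zeta : T -> R) (psi : T -> C),
  measurable_fun [set: T] zeta -> measurable_fun [set: T] psi ->
  measurable_fun [set: T] (fun x => G (zeta x) (psi x)).
Proof.
move=> mG d' T zeta psi m1 m2; apply: (measurableT_comp mG (f := fun x => G x.1 x.2)
    (g := fun x => (zeta x, psi x))).
exact: measurable_fun_pair.
Qed.

(** Apply [half_line_law] to (z, phi) |-> G (z, T_(- z) phi) / L_z (phi),
    using that T_z and T_(- z) are inverse and have reciprocal densities. *)
Lemma half_line_law_opp (G : R -> C -> \bar R) : (forall z phi, 0 <= G z phi) ->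
  measurable_fun [set: R * C] (fun x : R * C => G x.1 x.2) ->
  \int[P]_w \int[mu]_z ((0 < z)%R%:R%:E * G z (path_transform (- z) (bp w))) =
  \int[P]_w \int[mu]_z ((0 < z)%R%:R%:E * (G z (bp w) * (likelihood (- z) (bp w))%:E)).
Proof.
move=> G0 mG.
pose G' z (phi : C) := G z (path_transform (- z) phi) * (likelihood z phi)^-1%:E.
have m1 : measurable_fun [set: R * C] (fst : R * C -> R) by exact: measurable_fst.
have m2 : measurable_fun [set: R * C] (snd : R * C -> C) by exact: measurable_snd.
have G'0 z phi : 0 <= G' z phi by rewrite mule_ge0// lee_fin invr_ge0 expR_ge0.
have mG' : measurable_fun [set: R * C] (fun x : R * C => G' x.1 x.2).
  rewrite /G'; apply: emeasurable_funM.
    apply: (measurable_pair_comp mG) => //.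
    by apply: (measurable_path_transform t0) => //; meas.
  by have := measurable_likelihood t0 m1 m2 => ?; meas.
have L0 z (phi : C) : (likelihood z phi != 0)%R by rewrite gt_eqF// expR_gt0.
have := half_line_law hB t0 G'0 mG'; rewrite /G'.
under eq_integral => w _ do under eq_integral => z _ do
  rewrite path_transformK// likelihood_transform// invrK.
move=> ->; apply: eq_integral => w _; apply: eq_integral => z _; congr (_ * _).
by rewrite -muleA -EFinM mulVf// mule1.
Qed.

Theorem transform_law (G : R -> C -> \bar R) : (forall z phi, 0 <= G z phi) ->
  measurable_fun [set: R * C] (fun x : R * C => G x.1 x.2) ->
  \int[P]_w \int[mu]_z G z (path_transform z (bp w)) =
  \int[P]_w \int[mu]_z (G z (bp w) * (likelihood z (bp w))%:E).
Proof.
move=> G0 mG.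
have mGc := measurable_pair_comp mG.
have mbp := measurable_bm_path hB t0.
have m2nd : measurable_fun [set: Omega * measurableTypeR R]
    (fun x : Omega * measurableTypeR R => x.2 : R).
  exact: (measurableT_comp mid measurable_snd).
have m1st : measurable_fun [set: Omega * measurableTypeR R]
    (fun x : Omega * measurableTypeR R => bp x.1 : C).
  exact: (measurableT_comp mbp measurable_fst).
have split2 (K : Omega -> R -> \bar R) : (forall w z, 0 <= K w z) ->
    (forall d' (T : measurableType d') (om : T -> Omega) (zeta : T -> R),
      measurable_fun [set: T] om -> measurable_fun [set: T] zeta ->
      measurable_fun [set: T] (fun x => K (om x) (zeta x))) ->
    \int[P]_w \int[mu]_z K w z =
    \int[P]_w \int[mu]_z ((0 < z)%R%:R%:E * K w z) +
    \int[P]_w \int[mu]_z ((0 < z)%R%:R%:E * K w (- z)%R).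
  move=> K0 mK.
  have mKw w : measurable_fun [set: R] (K w).
    by apply: (mK _ _ (cst w) id) => //; exact: measurable_cst.
  under eq_integral => w _ do rewrite (integral_split0 (K0 w) (mKw w)).
  have b0 (z : R) x : 0 <= x -> 0 <= (0 < z)%R%:R%:E * x by move=> ?; rewrite mule_ge0// lee_fin.
  rewrite ge0_integralD//.
  - by move=> w _; apply: integral_ge0 => z _; exact: b0.
  - apply: (@measurable_fun_fubini_tonelli_F _ _ _ _ _ mu
      (fun x : Omega * measurableTypeR R => (0 < x.2)%R%:R%:E * K x.1 x.2)).
      by meas; apply: mK => //; meas.
    by move=> x; exact: b0.
  - by move=> w _; apply: integral_ge0 => z _; exact: b0.
  - apply: (@measurable_fun_fubini_tonelli_F _ _ _ _ _ mu
      (fun x : Omega * measurableTypeR R => (0 < x.2)%R%:R%:E * K x.1 (- x.2)%R)).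
      by meas; apply: mK => //; meas.
    by move=> x; exact: b0.
have SL := split2 (fun w z => G z (path_transform z (bp w))) (fun w z => G0 _ _).
have SR := split2 (fun w z => G z (bp w) * (likelihood z (bp w))%:E).
apply: (etrans (SL _)).
  move=> d' T om zeta m1 m2; apply: mGc => //.
  by apply: (measurable_path_transform t0) => //; exact: (measurableT_comp mbp).
apply: esym; apply: (etrans (SR _ _)).
- by move=> w z; rewrite mule_ge0// lee_fin expR_ge0.
- move=> d' T om zeta m1 m2; have m3 := measurableT_comp mbp m1.
  by apply: emeasurable_funM; [exact: mGc|have := measurable_likelihood t0 m2 m3 => ?; meas].
have m1 : measurable_fun [set: R * C] (fst : R * C -> R) by exact: measurable_fst.
have m2 : measurable_fun [set: R * C] (snd : R * C -> C) by exact: measurable_snd.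
have mGN : measurable_fun [set: R * C] (fun x : R * C => G (- x.1)%R x.2).
  by apply: mGc => //; meas.
have HP := half_line_law hB t0 G0 mG.
have HN := half_line_law_opp (fun z phi => G0 (- z)%R phi) mGN.
by rewrite HP HN.
Qed.

End WholeLineLaw.

Section Disintegration.
Context {R : realType} (t : R).
Hypothesis t0 : 0 < t.

Local Notation C := (borel_cpath t).
Local Notation mu := (@lebesgue_measure R).
Local Notation Z phi := (expZ (extend phi) t).

Let tt : 0 <= t <= t. Proof. by rewrite lexx ltW. Qed.

Let mid : measurable_fun [set: measurableTypeR R] (id : measurableTypeR R -> R).
Proof. by []. Qed.

(** The integral of a jointly measurable function depends measurably on the
    parameter, and [integral_exp_coshE] expresses besselK by such an integral. *)
Lemma measurable_besselK0 :
  measurable_fun [set: C] (fun phi : C => besselK 0 (1 / Z phi)).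
Proof.
pose N (phi : C) := (\int[mu]_u (expR (- (1 / Z phi * cosh u)))%:E)%E.
have NE phi : N phi = (2 * besselK 0 (1 / Z phi))%:E.
  by apply: integral_exp_coshE; rewrite divr_gt0// expZ_gt0.
have mN : measurable_fun [set: C] N.
  apply: (@measurable_fun_fubini_tonelli_F _ _ _ _ _ mu
      (fun x : C * measurableTypeR R => (expR (- (1 / Z x.1 * cosh (x.2 : R))))%:E)).
    have m1 : measurable_fun [set: C * measurableTypeR R]
        (fun x : C * measurableTypeR R => Z x.1).
      exact: (measurableT_comp (measurable_expZ t0) measurable_fst).
    have m2 : measurable_fun [set: C * measurableTypeR R]
        (fun x : C * measurableTypeR R => cosh (x.2 : R)).
      by apply: (measurableT_comp measurable_cosh); exact: (measurableT_comp mid measurable_snd).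
    by meas.
  by move=> x; rewrite lee_fin expR_ge0.
rewrite (_ : (fun phi : C => _) = (fun phi : C => fine (N phi) / 2)); last first.
  by apply/funext => phi; rewrite NE /= mulrAC divff ?mul1r.
by apply: measurable_funM; [exact: measurableT_comp mN|exact: measurable_cst].
Qed.

End Disintegration.

Unset Implicit Arguments.
Set Strict Implicit.
Set Printing Implicit Defensive.

Theorem proposition2p1 (R : realType) (d : measure_display)
    (Omega : measurableType d) (P : probability Omega R)
    (B : R -> Omega -> R) (hB : standard_brownian_motion P B)
    (t : R) (t_gt0 : 0 < t)
    (F : borel_cpath t -> \bar R) (F_ge0 : forall phi, (0 <= F phi)%E)
    (mF : measurable_fun [set: borel_cpath t] F) :
  (\int[P]_w F (bm_path hB t w) =
   \int[P]_w
     let phi := bm_path hB t w in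
     \int[@lebesgue_measure R]_xi
       (((2 * besselK 0 (1 / expZ (extend phi) t))^-1)%R%:E
        * F (path_transform (extend phi t - xi) phi)
        * (expR (- (cosh xi / expZ (extend phi) t)))%R%:E))%E.
Proof.
have tt : 0 <= t <= t by rewrite lexx ltW.
pose Z (phi : borel_cpath t) : R := expZ (extend phi) t.
pose K (phi : borel_cpath t) : R := 2 * besselK 0 (1 / Z phi).
have Z0 phi : 0 < Z phi by exact: expZ_gt0.
have K0 phi : 0 < K phi by rewrite mulr_gt0// besselK0_gt0// divr_gt0.
(* The choice for which the right-hand side of [transform_law], integrated
   over z, is F phi. *)
pose G (z : R) (phi : borel_cpath t) : \bar R :=
  (F phi * (expR (- (cosh (extend phi t) / Z phi)) / K phi)%:E)%E.
have G0 z phi : (0 <= G z phi)%E.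
  by rewrite mule_ge0// lee_fin divr_ge0 ?expR_ge0// ltW.
have mG : measurable_fun [set: R * borel_cpath t] (fun x => G x.1 x.2).
  apply: (measurableT_comp (f := G 0)); last exact: measurable_snd.
  have m1 := measurable_eval tt.
  have m2 := measurable_expZ t_gt0.
  have m3 := measurable_besselK0 t_gt0.
  have m4 : measurable_fun [set: borel_cpath t]
      (fun phi : borel_cpath t => cosh (extend phi t)).
    exact: (measurableT_comp measurable_cosh m1).
  by rewrite /G /K /Z; meas.
transitivity (\int[P]_w \int[@lebesgue_measure R]_z
    (G z (bm_path hB t w) * (likelihood z (bm_path hB t w))%:E))%E.
  apply: eq_integral => w _; set phi : borel_cpath t := bm_path hB t w.
  set x := extend phi t.
  pose E (u : R) : \bar R := (expR (- (1 / Z phi * cosh u)))%:E.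
  have E0 u : (0 <= E u)%E by rewrite lee_fin expR_ge0.
  have mE : measurable_fun [set: R] E.
    by have := @measurable_cosh R => ?; rewrite /E; meas.
  have mEx : measurable_fun [set: R] (fun u : R => E (u + x)).
    by apply: (measurableT_comp mE); meas.
  have IE : (\int[@lebesgue_measure R]_z E (z + x)%R = (K phi)%:E)%E.
    rewrite (ge0_integral_shift x E0 mE).
    by apply: integral_exp_coshE; rewrite divr_gt0.
  have GE z : (G z phi * (likelihood z phi)%:E =
      F phi * ((K phi)^-1%:E * E (z + x)%R))%E.
    have e : expR (- (cosh x / Z phi)) / K phi * likelihood z phi =
        (K phi)^-1 * expR (- (1 / Z phi * cosh (z + x))).
      rewrite mulrAC mulrC /likelihood -/x -/(Z phi) -expRD; congr (_ * expR _).
      by rewrite (addrC x z); ring.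
    by rewrite /G -muleA -EFinM e EFinM.
  under eq_integral do rewrite GE.
  rewrite ge0_integralZl//; last 2 first.
  - by apply: emeasurable_funM => //; exact: measurable_cst.
  - by move=> z _; rewrite mule_ge0// lee_fin invr_ge0 ltW.
  rewrite ge0_integralZl_EFin//; last by rewrite invr_ge0 ltW.
  by rewrite IE -EFinM mulVf ?mule1// gt_eqF.
apply: etrans (esym (transform_law hB t_gt0 G0 mG)) _.
apply: eq_integral => w _ /=.
set phi : borel_cpath t := bm_path hB t w; set x := extend phi t.
pose h (xi : R) : \bar R := (((K phi)^-1)%:E * F (path_transform (x - xi) phi)
        * (expR (- (cosh xi / Z phi)))%:E)%E.
have h0 xi : (0 <= h xi)%E.
  by rewrite mule_ge0 ?lee_fin ?expR_ge0// mule_ge0// lee_fin invr_ge0 ltW.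
have mh : measurable_fun [set: R] h.
  have := @measurable_cosh R => ?.
  have mT : measurable_fun [set: R] (fun xi : R => path_transform (x - xi) phi : borel_cpath t).
    by apply: (measurable_path_transform t_gt0) => //; meas.
  by rewrite /h; meas; exact: (measurableT_comp mF mT).
have mhx : measurable_fun [set: R] (fun u : R => h (u + x)).
  by apply: (measurableT_comp mh); meas.
rewrite -[RHS](ge0_integral_shift x h0 mh).
rewrite -[RHS](ge0_integral_opp (fun u => h0 (u + x)) mhx).
apply: eq_integral => z _; rewrite /h /G.
have -> : x - (- z + x) = z by ring.
have -> : Z (path_transform z phi) = Z phi by exact: expZ_path_transform.
have -> : K (path_transform z phi) = K phi by rewrite /K /Z expZ_path_transform.
rewrite extend_transform_end// -/x (addrC (- z)) -(muleA (K phi)^-1%:E) muleC.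
by rewrite [(_ / K phi)%R]mulrC EFinM -!muleA; congr (_ * _)%E; rewrite muleC.
Qed.
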